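(* Let $(T_n)$ be a consistent sequence of uniform spanning trees, $\bar\alpha=\frac43+\frac1{15}\sqrt{205}$, and let $X$ be the almost sure uniform limit on $[0,\infty]$ of $X_n(t)=\mathrm{LI}(u_1T_nu_2)(\bar\alpha^nt)$. Then almost surely $X$ is self-avoiding, i.e. $X(s)\neq X(t)$ for all $0\le s<t\le\mathsf h(X)$, where $\mathsf h(X)=\inf\{t:X(s)=u_2\text{ for all }s\ge t\}$.
   Context: Let $u_1=(0,0)$, $u_2=(1,0)$, $u_3=(\tfrac12,\tfrac{\sqrt3}2)$ in $\mathbb R^2$ and $\psi_i(x)=\tfrac12(x-u_i)+u_i$ for $i\in\{1,2,3\}$. The Sierpiński gasket $K$ is the unique nonempty compact set with $K=\psi_1(K)\cup\psi_2(K)\cup\psi_3(K)$. The Sierpiński graphs $G_n$ (embedded in the plane, all edges as straight segments lie in $K$) are defined recursively: $G_0$ has vertex set $VG_0=\{u_1,u_2,u_3\}$ and edge set $\{\{u_1,u_2\},\{u_2,u_3\},\{u_3,u_1\}\}$; $G_{n+1}$ has vertex set $\psi_1(VG_n)\cup\psi_2(VG_n)\cup\psi_3(VG_n)$ and edge set $\psi_1(EG_n)\cup\psi_2(EG_n)\cup\psi_3(EG_n)$ (edges mapped vertexwise). For a word $w=w_1\cdots w_k\in\{1,2,3\}^k$ put $\psi_w=\psi_{w_1}\circ\cdots\circ\psi_{w_k}$; then $G_n=\bigcup_{w\in\{1,2,3\}^k}\psi_w(G_{n-k})$. For a spanning subgraph $H\subseteq G_n$ and $w\in\{1,2,3\}^k$,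 $\pi_w(H)=\psi_w^{-1}(H\cap\psi_w(G_{n-k}))$. $\mathcal T_n$ denotes the set of spanning trees of $G_n$; $\mathcal S_n^i$ the set of spanning forests of $G_n$ with two components, one containing $u_i$ and the other containing $\{u_1,u_2,u_3\}\setminus\{u_i\}$; $\mathcal R_n$ the set of spanning forests with three components each containing exactly one of $u_1,u_2,u_3$; $\mathcal Q_n=\mathcal T_n\cup\mathcal S_n^1\cup\mathcal S_n^2\cup\mathcal S_n^3\cup\mathcal R_n$. For $g\in\mathcal Q_1$, $\mathrm{Tr}\,g$ is the spanning subgraph of $G_0$ equal to: the two edges at $u_i$ if $g$ is a spanning tree of $G_1$ in which for both $j\neq i$ the path from $u_i$ to $u_j$ lies in $\psi_i(G_0)\cup\psi_j(G_0)$ (every spanning tree of $G_1$ satisfies this for exactly one $i$); the single edge not containing $u_i$ if $g\in\mathcal S_1^i$; the edgeless graph if $g\in\mathcal R_1$. For $f\in\mathcal Q_{n+1}$, $\mathrm{Tr}\,f=\bigcup_{w\in\{1,2,3\}^n}\psi_w(\mathrm{Tr}\,\pi_w(f))$; Tr maps spanning trees of $G_{n+1}$ to spanning trees of $G_n$. A consistent sequence of uniform spanning trees is a sequence $(T_n)_{n\ge0}$ of random spanning trees defined on a common probability space such that $T_n$ is uniformly distributed on $\mathcal T_n$ and $\mathrm{Tr}\,T_{n+1}=T_n$ for all $n$. For a tree $t$ and vertices $x,y$, $xty$ denotes the unique self-avoiding walk in $t$ from $x$ to $y$. For a walk $x=(x_0,\dots,x_r)$, $\mathrm{LI}(x):[0,\infty]\to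 K$ is the linear interpolation $\mathrm{LI}(x)(t)=(k+1-t)x_k+(t-k)x_{k+1}$ for $k\le t<k+1$, $k<r$, and $\mathrm{LI}(x)(t)=x_r$ for $t\ge r$. It is known that $X_n$ converges almost surely uniformly to a continuous curve $X$ with $X(0)=u_1$, $X(\infty)=u_2$. *)

(* Defs.v *)
From HB Require Import structures.
From mathcomp Require Import all_boot all_order all_algebra.
From mathcomp Require Import all_classical all_reals all_analysis.
Set Implicit Arguments. Unset Strict Implicit. Unset Printing Implicit Defensive.
Import Order.TTheory GRing.Theory Num.Theory.
Local Open Scope ring_scope.

Section Sierpinski.
Variable R : realType.

Definition pt := (R * R)%type.
Definition padd (x y : pt) : pt := (x.1 + y.1, x.2 + y.2).
Definition pscale (a : R) (x : pt) : pt := (a * x.1, a * x.2).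
Definition pdist (x y : pt) : R :=
  Num.sqrt ((x.1 - y.1) ^+ 2 + (x.2 - y.2) ^+ 2).

(* corners u_1, u_2, u_3 are indexed by 'I_3 = {0,1,2} *)
Definition u (i : 'I_3) : pt :=
  match val i with
  | 0%N => (0, 0)
  | 1%N => (1, 0)
  | _ => (2^-1, Num.sqrt 3 / 2)
  end.
Definition u1 : pt := (0, 0).
Definition u2 : pt := (1, 0).

Definition psi (i : 'I_3) (x : pt) : pt :=
  padd (pscale (2^-1) (padd x (pscale (-1) (u i)))) (u i).
Definition psiw (w : seq 'I_3) (x : pt) : pt := foldr psi x w.

Definition pmap2 (f : pt -> pt) (e : pt * pt) := (f e.1, f e.2).

Fixpoint VG (n : nat) : seq pt :=
  match n with
  | 0%N => [:: u ord0; u (lift ord0 ord0); u ord_max]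
  | m.+1 => flatten [seq map (psi i) (VG m) | i <- enum 'I_3]
  end.
Fixpoint EG (n : nat) : seq (pt * pt) :=
  match n with
  | 0%N => [:: (u ord0, u (lift ord0 ord0)); (u (lift ord0 ord0), u ord_max);
              (u ord_max, u ord0)]
  | m.+1 => flatten [seq map (pmap2 (psi i)) (EG m) | i <- enum 'I_3]
  end.

(* spanning subgraphs of G_n: sets of edges of G_n (indexed by EG n) *)
Definition sub (n : nat) := {set 'I_(size (EG n))}.

Definition e00 : pt * pt := (u1, u1).
Definition adj (n : nat) (H : sub n) (a b : pt) : Prop :=
  exists2 i, i \in H & (nth e00 (EG n) i = (a, b) \/ nth e00 (EG n) i = (b, a)).

Definition Gedge (n : nat) (a b : pt) : Prop :=
  (a, b) \in EG n \/ (b, a) \in EG n.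

Definition walk (E : pt -> pt -> Prop) (p : seq pt) : Prop :=
  forall k, (k.+1 < size p)%N -> E (nth u1 p k) (nth u1 p k.+1).
Definition conn (E : pt -> pt -> Prop) (x y : pt) : Prop :=
  exists q, last x q = y /\ walk E (x :: q).
Definition saw (E : pt -> pt -> Prop) (x y : pt) (p : seq pt) : Prop :=
  exists q, p = x :: q /\ last x q = y /\ uniq p /\ walk E p.
Definition acyclic (E : pt -> pt -> Prop) : Prop :=
  ~ exists x q, (2 <= size q)%N /\ uniq (x :: q) /\ walk E (x :: q) /\ E (last x q) x.
Definition is_tree (V : seq pt) (E : pt -> pt -> Prop) : Prop :=
  (forall x y, x \in V -> y \in V -> conn E x y) /\ acyclic E.
Definition is_S (V : seq pt) (E : pt -> pt -> Prop) (i : 'I_3) : Prop :=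
  acyclic E /\
  (forall j k, j != i -> k != i -> conn E (u j) (u k)) /\
  (forall j, j != i -> ~ conn E (u i) (u j)) /\
  (forall x, x \in V -> conn E (u i) x \/ exists2 j, j != i & conn E (u j) x).
Definition is_R (V : seq pt) (E : pt -> pt -> Prop) : Prop :=
  acyclic E /\
  (forall j k, j != k -> ~ conn E (u j) (u k)) /\
  (forall x, x \in V -> exists j, conn E (u j) x).

Definition stree (n : nat) (t : sub n) : Prop := is_tree (VG n) (adj t).
Definition num_trees (n : nat) : nat := #|[pred t : sub n | `[< stree t >]]|.

Definition copy_edge (i : 'I_3) (a b : pt) : Prop :=
  exists2 e, e \in EG 0 & (pmap2 (psi i) e = (a, b) \/ pmap2 (psi i) e = (b, a)).

Definition good (g : pt -> pt -> Prop) (i : 'I_3) : Prop :=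
  forall j, j != i -> forall p, saw g (u i) (u j) p ->
    forall k, (k.+1 < size p)%N ->
      copy_edge i (nth u1 p k) (nth u1 p k.+1) \/
      copy_edge j (nth u1 p k) (nth u1 p k.+1).

(* Tr g for g in Q_1 (g a spanning subgraph of G_1 given by its adjacency);
   tr1 g a b holds iff the edge {a,b} of G_0 belongs to Tr g *)
Definition tr1 (g : pt -> pt -> Prop) (a b : pt) : Prop :=
  (is_tree (VG 1) g /\ exists i, good g i /\ (a = u i \/ b = u i)) \/
  (exists i, is_S (VG 1) g i /\ a <> u i /\ b <> u i).

Definition piw (n : nat) (w : seq 'I_3) (f : sub n.+1) (a b : pt) : Prop :=
  Gedge 1 a b /\ adj f (psiw w a) (psiw w b).

Definition Tr_is (n : nat) (f : sub n.+1) (t : sub n) : Prop :=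
  forall i : 'I_(size (EG n)), i \in t <->
    exists w : seq 'I_3, size w = n /\
      exists2 e0, e0 \in EG 0 &
        tr1 (piw w f) e0.1 e0.2 /\
        (nth e00 (EG n) i = pmap2 (psiw w) e0 \/
         nth e00 (EG n) i = pmap2 (psiw w) (e0.2, e0.1)).

(* the self-avoiding path u_1 t u_2 in the subgraph t (unique if t is a tree) *)
Definition upath (n : nat) (t : sub n) : seq pt :=
  xget [:: u1] [set p | saw (adj t) u1 u2 p].

Definition LI (x : seq pt) (t : R) : pt :=
  let r := (size x).-1 in
  let k := Num.truncn t in
  if (k < r)%N then
    padd (pscale (k.+1%:R - t) (nth u1 x k)) (pscale (t - k%:R) (nth u1 x k.+1))
  else nth u1 x r.

Definition alphabar : R := 4 / 3 + Num.sqrt 205 / 15.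

Definition Xn (n : nat) (t : sub n) (s : R) : pt :=
  LI (upath t) (alphabar ^+ n * s).

(* a curve X on [0, oo], given on [0, oo) with X(oo) = u_2 *)
Definition Xext (X : R -> pt) (s : \bar R) : pt :=
  match s with
  | EFin r => X r
  | _ => u2
  end.

Definition hitime (X : R -> pt) : \bar R :=
  ereal_inf ([set (r%:E)%E | r in [set r : R | 0 <= r /\ forall s, r <= s -> X s = u2]]
             `|` [set +oo%E])%classic.

Definition self_avoiding (X : R -> pt) : Prop :=
  forall s t : \bar R, (0%E <= s)%E -> (s < t)%E -> (t <= hitime X)%E ->
    Xext X s <> Xext X t.

(* uniform convergence on [0, oo) (the value at oo is u_2 for all curves) *)
Definition unif_cvg (Y : nat -> R -> pt) (X : R -> pt) : Prop :=
  forall eps : R, 0 < eps -> exists N : nat, forall n, (N <= n)%N ->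
    forall s, 0 <= s -> pdist (Y n s) (X s) < eps.

End Sierpinski.

(* Main.v *)
Require Import Defs.
From HB Require Import structures.
From mathcomp Require Import all_boot all_order all_algebra.
From mathcomp Require Import all_classical all_reals all_analysis.
From mathcomp Require Import ring lra.
Set Implicit Arguments. Unset Strict Implicit. Unset Printing Implicit Defensive.
Import Order.TTheory GRing.Theory Num.Theory.

(** The path from u_1 to u_2 in T_n is encoded as the list of its passes through the level-n cells, each pass being a cell with its entry and exit corners; a pass is refined independently of the others, by a uniform element of the fibre of the trace of the local state. Each cell is passed at most once, so a double point X(s) = X(t) leaves, at every level m, two possibilities. Either X spends the whole of [s, t] in at most two adjacent cells of level m, hence one of them takes a positive fraction of the rescaled time; this does not happen at all levels, since the masses of the cells have a second moment of order alphabar^-m. Or the cells of level m at the vertex X(s) are passed without using this vertex; each further refinement halves the (weighted) expected number of such passes. Refinements are independent because gluing arbitrary local forests with prescribed traces yields exactly the spanning trees with the prescribed trace. *)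

(** * Local combinatorics of G_1 *)

(** A local state is what a spanning tree of [G_{n+1}] cuts out in one copy of [G_1]. There are only
    512 candidates, so all combinatorics of a single refinement is settled by evaluation, and the
    work lies in transferring it to all levels. The mean numbers of refined passes depend only on
    the [kind] of a pass; [alphabar] is the Perron root of this 3 by 3 mean matrix. The second
    moment wins because about alphabar^m cells carry a mass of order alphabar^-m each, so the
    expected sum of the squared masses tends to 0. In the other alternative the point is a vertex of
    some level m0; from then on the cells at it are reached by repeating one letter, and a pass can
    miss it only if the parent pass did. Both alternatives are events about the trees alone. The
    limit curve enters through the closedness of cells and through the fact that the cells of one
    level are passed in an order that refinement does not change. That spanning trees exist, that
    traces of trees are trees and that all trees of a level have equally many lifts is read off from
    the assumed laws. *)

Definition o0 : 'I_3 := @Ordinal 3 0 isT.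
Definition o1 : 'I_3 := @Ordinal 3 1 isT.
Definition o2 : 'I_3 := @Ordinal 3 2 isT.
Definition I3 : seq 'I_3 := [:: o0; o1; o2].
Definition nx (a : 'I_3) : 'I_3 :=
  match val a with 0 => o1 | 1 => o2 | _ => o0 end.
Definition thd (a b : 'I_3) : 'I_3 := if nx a == b then nx b else nx a.

(* A state records which edges of a triangle are present; the k-th base edge joins the corners k and nx k, as in EG 0. *)
Definition st := (bool * bool * bool)%type.
Definition bit (q : st) (k : 'I_3) : bool :=
  match val k with 0 => q.1.1 | 1 => q.1.2 | _ => q.2 end.
Definition mkst (f : 'I_3 -> bool) : st := (f o0, f o1, f o2).
Definition hasE (q : st) (a b : 'I_3) : bool :=
  (nx a == b) && bit q a || (nx b == a) && bit q b.
Definition conn0 (q : st) (a b : 'I_3) : bool :=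
  [|| a == b, hasE q a b | hasE q a (thd a b) && hasE q (thd a b) b].

Definition lst := (st * st * st)%type.
Definition sel (g : lst) (i : 'I_3) : st :=
  match val i with 0 => g.1.1 | 1 => g.1.2 | _ => g.2 end.
Definition mklst (f : 'I_3 -> st) : lst := (f o0, f o1, f o2).

(* The vertices of G_1 are numbered 0, 1, 2 (corners) and 6 - i - j for the midpoint shared by the cells i and j. *)
Definition lv (i a : 'I_3) : nat := if i == a then val i else 6 - i - a.
Definition lpairs : seq ('I_3 * 'I_3) := [seq (i, k) | i <- I3, k <- I3].
Definition ledge (e : 'I_3 * 'I_3) : nat * nat := (lv e.1 e.2, lv e.1 (nx e.2)).
Definition ledges (g : lst) : seq ('I_3 * 'I_3) :=
  [seq e <- lpairs | bit (sel g e.1) e.2].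

(** Adding an edge renames one class to the other. The value at a point is a representative of its
    component, so connectivity becomes an equality test that evaluates. *)
Fixpoint comp (T : eqType) (es : seq (T * T)) : T -> T :=
  match es with
  | [::] => id
  | e :: es' => let f := comp es' in let a := f e.1 in let b := f e.2 in
                fun z => let c := f z in if c == b then a else c
  end.

Definition lcomp (es : seq ('I_3 * 'I_3)) : nat -> nat := comp (map ledge es).
Definition lconn (g : lst) (x y : nat) : bool :=
  let f := lcomp (ledges g) in f x == f y.
Definition lconnD (g : lst) (e : 'I_3 * 'I_3) (x y : nat) : bool :=
  let f := lcomp (seq.filter (predC1 e) (ledges g)) in f x == f y.

(** Membership in $\mathcal Q_1$: every edge is a bridge and each of the six vertices is joined to
    some corner, however the corners are joined among themselves. *)
Definition valid (g : lst) : bool :=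
  all (fun e => ~~ lconnD g e (ledge e).1 (ledge e).2) (ledges g) &&
  all (fun x => has (fun c : 'I_3 => lconn g x c) I3) (iota 0 6).

Definition lstep := ('I_3 * 'I_3 * 'I_3)%type.
Definition lsteps (g : lst) : seq (nat * (nat * lstep)) :=
  flatten [seq [:: (lv e.1 e.2, (lv e.1 (nx e.2), (e.1, e.2, nx e.2)));
                   (lv e.1 (nx e.2), (lv e.1 e.2, (e.1, nx e.2, e.2)))]
          | e <- ledges g].
(** In a forest the search can find only the unique path; fuel 6 is the number of vertices of [G_1].
    The output is certified afterwards by [chkcode]. *)
Fixpoint dfs (ss : seq (nat * (nat * lstep))) (n : nat) (seen : seq nat) (x y : nat)
    : option (seq lstep) :=
  if x == y then Some [::] else
  if n is n'.+1 then
    foldr (fun s r =>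
      if (s.1 != x) || (s.2.1 \in seen) then r else
      if dfs ss n' (x :: seen) s.2.1 y is Some p then Some (s.2.2 :: p) else r)
      None ss
  else None.
(** Consecutive steps in one cell merge into a single pass, which keeps only its entry and exit
    corners. *)
Definition gcons (s : lstep) (l : seq lstep) : seq lstep :=
  match l with
  | s' :: l' => if s.1.1 == s'.1.1 then (s.1, s'.2) :: l' else s :: l
  | [::] => [:: s]
  end.
(* The self-avoiding path from corner a to corner b of G_1 inside g, recorded as its successive passages (i, a', b') through the three cells. *)
Definition lcode (g : lst) (a b : 'I_3) : seq lstep :=
  if dfs (lsteps g) 6 [::] a b is Some p then foldr gcons [::] p else [::].

Definition ltree (g : lst) : bool := all (fun a : 'I_3 => lconn g 0 a) I3.
Definition lS (g : lst) (i : 'I_3) : bool :=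
  lconn g (nx i) (nx (nx i)) && ~~ lconn g i (nx i).
Definition lgood (g : lst) (i : 'I_3) : bool :=
  all (fun j => (j == i) || all (fun s : lstep => (s.1.1 == i) || (s.1.1 == j)) (lcode g i j)) I3.
Definition tr (g : lst) : st :=
  if ltree g then
    let c := [seq i <- I3 | lgood g i] in mkst (fun k => (k \in c) || (nx k \in c))
  else let c := [seq i <- I3 | lS g i] in
    mkst (fun k => has (fun i => (k != i) && (nx k != i)) c).

(** * Checks over all local states by evaluation *)

Definition allb (P : bool -> bool) := P true && P false.
Definition allst (P : st -> bool) :=
  allb (fun a => allb (fun b => allb (fun c => P (a, b, c)))).
Lemma allbP P : allb P -> forall b, P b. Proof. by case/andP => ? ? []. Qed.
Lemma allstP P : allst P -> forall q, P q.
Proof. by move=> H [[a b] c]; exact: (allbP (allbP (allbP H a) b) c). Qed.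
Lemma all3P (P : 'I_3 -> bool) : all P I3 -> forall a, P a.
Proof.
move=> /and4P[h0 h1 h2 _] [[|[|[|m]]] i] //.
- by rewrite (_ : Ordinal i = o0) //; apply: val_inj.
- by rewrite (_ : Ordinal i = o1) //; apply: val_inj.
- by rewrite (_ : Ordinal i = o2) //; apply: val_inj.
Qed.

Definition nb (q : st) : nat := q.1.1 + q.1.2 + q.2.

(* r records which corners of the cell are connected outside of it: deleting e and adding these connections decides whether e lies on a cycle of the whole graph. *)
Definition lcompR (g : lst) (e : 'I_3 * 'I_3) (r : st) : nat -> nat :=
  comp ([seq ledge e' | e' <- ledges g & e' != e] ++
        [seq (nat_of_ord k, nat_of_ord (nx k)) | k <- I3 & bit r k]).
(** Two corners joined both inside and outside the cell: the coarse graph would already contain a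
    cycle. Such [r] are exempt from [chkcyc]. *)
Definition ncompat (q r : st) : bool :=
  has (fun a => has (fun b => (a != b) && conn0 q a b && conn0 r a b) I3) I3.
Definition chkcyc (g : lst) (e : 'I_3 * 'I_3) (r : st) : bool :=
  if ncompat (tr g) r then true else
  let f := lcompR g e r in f (ledge e).1 != f (ledge e).2.

(** The last clause says that a missed corner is inherited: a child cell at a corner of its parent
    misses this corner only if the parent pass misses it too. The geometric decay in [Ex_stay] rests
    on it. *)
Definition chkcode (g : lst) (a b : 'I_3) : bool :=
  let l := lcode g a b in
  if l is s :: l' then
  [&& s.1 == (a, a), (last s l').1.1 == b, (last s l').2 == b,
     all (fun s : lstep => (s.1.2 != s.2) && conn0 (sel g s.1.1) s.1.2 s.2) l,
     uniq [seq s.1.1 | s <- l],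
     path (fun s s' : lstep => lv s.1.1 s.2 == lv s'.1.1 s'.1.2) s l' &
     all (fun s : lstep => (s.1.1 == thd s.1.2 s.2) ==> (s.1.1 == thd a b)) l]
  else false.

Definition bools := [:: true; false].
Definition allst_seq : seq st :=
  flatten [seq [seq (x, y, z) | y <- bools, z <- bools] | x <- bools].
Definition alllst_seq : seq lst :=
  flatten [seq [seq (x, y, z) | y <- allst_seq, z <- allst_seq] | x <- allst_seq].
Definition valid_seq := [seq g <- alllst_seq | valid g].

(** The first conjunct yields acyclicity of glued forests; the second says that the trace preserves
    connections between corners and that the computed paths are correct; the third keeps the tree
    case and the two-component case of the trace apart. *)
Lemma local_facts : all (fun g =>
  [&& all (fun e => all (chkcyc g e) allst_seq) (ledges g),
      all (fun a : 'I_3 => all (fun b : 'I_3 =>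
         (lconn g a b == conn0 (tr g) a b) &&
         (if (a != b) && lconn g a b then chkcode g a b else true)) I3) I3 &
      if ltree g then all (fun i => ~~ lS g i) I3 else true]) valid_seq.
Proof. vm_compute. reflexivity. Qed.

(* 0: inside a spanning tree, along one edge; 1: inside a spanning tree, along two edges; 2: inside a two-component forest. *)
Definition kind (q : st) (a b : 'I_3) : nat :=
  if nb q == 2 then (if hasE q a b then 0 else 1) else 2.
Definition lcnt (g : lst) (a b : 'I_3) (kd : nat) : nat :=
  count (fun s : lstep => kind (sel g s.1.1) s.1.2 s.2 == kd) (lcode g a b).
(* Counts only the passes through the cell at a corner that they miss. *)
Definition lcntc (g : lst) (a b : 'I_3) (kd : nat) : nat :=
  count (fun s : lstep => (s.1.1 == thd s.1.2 s.2) &&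
    (kind (sel g s.1.1) s.1.2 s.2 == kd)) (lcode g a b).

Definition fib_all := [seq (tr g, g) | g <- valid_seq].
Definition fib (q : st) : seq lst := [seq p.2 | p <- fib_all & p.1 == q].
(* The number of refined passes of kinds 0, 1, 2 of a pass of kind kd, summed over a fibre; the fibres have 18, 18 and 30 elements. *)
Definition mean_row (kd : nat) : seq nat :=
  nth [::] [:: [:: 18; 9; 9]; [:: 24; 12; 18]; [:: 24; 12; 30]] kd.
Definition meanc_row (kd : nat) : seq nat :=
  nth [::] [:: [:: 0; 0; 0]; [:: 12; 6; 0]; [:: 0; 0; 6]] kd.

Definition chkfib (fa : seq (st * lst)) (q : st) : bool :=
  if 2 < nb q then true else
  let F := [seq p.2 | p <- fa & p.1 == q] in
  (size F == nth 0 [:: 50; 30; 18] (nb q)) &&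
  all (fun a => all (fun b => if (a != b) && conn0 q a b then
    let r := kind q a b in
    [&& [seq sumn [seq lcnt g a b kd | g <- F] | kd <- iota 0 3] == mean_row r,
    [seq sumn [seq lcntc g a b kd | g <- F] | kd <- iota 0 3] == meanc_row r
    & all (fun g => size (lcode g a b) <= 3) F] else true) I3) I3.

(** The [let] has the table of traces evaluated once for all states. The sizes 50, 30, 18 belong to
    traces with 0, 1, 2 edges. *)
Lemma fibre_counts : let fa := fib_all in all (chkfib fa) allst_seq.
Proof. vm_compute. reflexivity. Qed.

Lemma validE g : valid g =
  all (fun e => ~~ lconnD g e (ledge e).1 (ledge e).2) (ledges g) &&
  all (fun x => has (fun c : 'I_3 => lconn g x c) I3) (iota 0 6).
Proof. by []. Qed.

Lemma bit_mkst f k : bit (mkst f) k = f k.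
Proof. by move: k; have h := @all3P (fun k => bit (mkst f) k == f k); move=> k; apply/eqP/h; rewrite /= !eqxx. Qed.

Lemma sel_mklst f i : sel (mklst f) i = f i.
Proof. by have h := @all3P (fun i => sel (mklst f) i == f i); apply/eqP/h; rewrite /= !eqxx. Qed.

Lemma bit_tr g k : bit (tr g) k =
  if ltree g then lgood g k || lgood g (nx k)
  else has (fun i => [&& lS g i, k != i & nx k != i]) I3.
Proof.
have memf (P : pred 'I_3) i : (i \in [seq i <- I3 | P i]) = P i.
  rewrite mem_filter andbC; suff -> : i \in I3 by [].
  by apply: (@all3P (fun a => a \in I3)).
rewrite /tr; case: ifP => _; rewrite bit_mkst; first by rewrite !memf.
by rewrite has_filter -filter_predI -has_filter; apply: eq_has => i /=; rewrite andbC.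
Qed.

#[global] Opaque valid tr lcode alllst_seq valid_seq fib_all.

Lemma mem_allst q : q \in allst_seq.
Proof. by case: q => [[[] []] []]. Qed.

Lemma mem_alllst g : g \in alllst_seq.
Proof.
Transparent alllst_seq.
apply/flatten_mapP; exists g.1.1; rewrite ?mem_allst //.
by apply/allpairsP; exists (g.1.2, g.2); rewrite !mem_allst; case: g => [[]].
Qed.

Lemma alllst_uniq : uniq alllst_seq.
Proof. Transparent alllst_seq. by vm_compute. Opaque alllst_seq. Qed.

Lemma mem_valid g : (g \in valid_seq) = valid g.
Proof. by rewrite mem_filter mem_alllst andbT. Qed.

Lemma mem_I3 (a : 'I_3) : a \in I3.
Proof. by apply: (@all3P (fun a => a \in I3)). Qed.

Section LocalFacts.
Variables (g : lst) (g_valid : valid g).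

Let facts := allP local_facts g (etrans (mem_valid g) g_valid).

Lemma valid_cyc e r : e \in ledges g -> ~~ ncompat (tr g) r ->
  lcompR g e r (ledge e).1 != lcompR g e r (ledge e).2.
Proof.
have /and3P[/allP h _ _] := facts => eg nc.
have /allP/(_ r (mem_allst r)) := h e eg.
by rewrite /chkcyc (negbTE nc).
Qed.

Lemma lconn_tr (a b : 'I_3) : lconn g a b = conn0 (tr g) a b.
Proof.
have /and3P[_ h _] := facts.
by have /andP[/eqP] := all3P (all3P h a) b.
Qed.

Lemma lcodeP (a b : 'I_3) : a != b -> conn0 (tr g) a b -> chkcode g a b.
Proof.
have /and3P[_ h _] := facts => ab; rewrite -lconn_tr => cab.
by have /andP[_] := all3P (all3P h a) b; rewrite ab cab.
Qed.

Lemma ltree_lS i : ltree g -> ~~ lS g i.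
Proof.
have /and3P[_ _ h] := facts => tg; move: h; rewrite tg => h.
exact: (all3P h i).
Qed.
End LocalFacts.

Definition fibre (q : st) : {set lst} := [set g | valid g & tr g == q].

Lemma mem_fib q g : (g \in fib q) = (g \in fibre q).
Proof.
rewrite [RHS]inE. 
apply/mapP/andP => [[p]|[vg /eqP tg]].
  rewrite (mem_filter _ p) => /andP[/eqP pq /mapP[g' vg' e]] ->; move: pq.
  by rewrite e /= => ->; rewrite -mem_valid.
exists (q, g) => //; rewrite mem_filter eqxx; apply/mapP.
by exists g; rewrite ?mem_valid ?tg.
Qed.

Lemma fibE q : fib q = [seq p.2 | p <- fib_all & p.1 == q].
Proof. by []. Qed.

#[global] Opaque fib.

Lemma fib_uniq q : uniq (fib q).
Proof.
rewrite fibE; have ua : uniq fib_all.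
  Transparent fib_all. rewrite /fib_all. Opaque fib_all.
  rewrite (map_inj_uniq (f := fun g => (tr g, g))); last by move=> x y [].
  Transparent valid_seq. rewrite /valid_seq. Opaque valid_seq.
  exact: filter_uniq alllst_uniq.
rewrite map_inj_in_uniq; first exact: filter_uniq.
move=> p p'; rewrite (mem_filter _ p) (mem_filter _ p').
move=> /andP[/eqP p1 _] /andP[/eqP p1' _].
by case: p p' p1 p1' => [? ?] [? ?] /= -> ->; move=> ->.
Qed.

Lemma sum_fibre (R : nmodType) (F : lst -> R) q :
  (\sum_(g in fibre q) F g = \sum_(g <- fib q) F g)%R.
Proof.
rewrite -big_filter; apply: perm_big; apply: uniq_perm.
- by rewrite filter_uniq ?index_enum_uniq.
- exact: fib_uniq.
move=> g; rewrite (mem_fib q g) (mem_filter _ g (index_enum _)).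
by rewrite mem_index_enum andbT.
Qed.

Section FibreCounts.
Variables (q : st) (q3 : nb q < 3).

Let facts : size (fib q) == nth 0 [:: 50; 30; 18] (nb q) /\
  forall a b : 'I_3, a != b -> conn0 q a b -> let r := kind q a b in
    [&& [seq sumn [seq lcnt g a b kd | g <- fib q] | kd <- iota 0 3] == mean_row r,
    [seq sumn [seq lcntc g a b kd | g <- fib q] | kd <- iota 0 3] == meanc_row r
    & all (fun g => size (lcode g a b) <= 3) (fib q)].
Proof.
have := allP fibre_counts q (mem_allst q).
rewrite /= /chkfib -fibE leqNgt q3; move: (fib q) => F /andP[-> h]; split=> // a b ab cab.
by have := all3P (all3P h a) b; rewrite ab cab.
Qed.

Lemma card_fibre : #|fibre q| = nth 0 [:: 50; 30; 18] (nb q).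
Proof.
have [/eqP <- _] := facts; rewrite -(card_uniqP (fib_uniq q)).
by apply: eq_card => g; exact/esym/mem_fib.
Qed.

Lemma card_fibre_gt0 : 0 < #|fibre q|.
Proof. by rewrite card_fibre; case: (nb q) q3 => [|[|[|]]]. Qed.

Section Pass.
Variables (a b : 'I_3) (ab : a != b) (cab : conn0 q a b).

Let pfacts := (proj2 facts) a b ab cab.

Lemma size_lcode g : g \in fibre q -> size (lcode g a b) <= 3.
Proof. by rewrite -mem_fib => gq; have /and3P[_ _ /allP] := pfacts; apply. Qed.

Local Open Scope ring_scope.

Lemma kind_lt3 q' a' b' : (kind q' a' b' < 3)%N.
Proof. by rewrite /kind; do 2?case: ifP. Qed.

Lemma sum_count_kind (R : pzSemiRingType) (h : nat -> R) (T : eqType) (f : T -> nat)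
    (P : pred T) (l : seq T) : (forall x, f x < 3)%N ->
  \sum_(x <- l | P x) h (f x) =
  \sum_(kd <- iota 0 3) (count (fun x => P x && (f x == kd)) l)%:R * h kd.
Proof.
move=> f3; elim: l => [|x l IH].
  by rewrite big_nil big1 // => kd _; rewrite mul0r.
rewrite big_cons IH /=; case: ifP => Px /=; last by [].
under [RHS]eq_bigr do rewrite natrD mulrDl.
rewrite big_split /=; congr (_ + _).
have : f x \in iota 0 3 by rewrite mem_iota f3.
move: (f x) => m; rewrite !big_cons big_nil.
by rewrite !inE => /or3P[] /eqP -> /=; rewrite !mul1r !mul0r !addr0 ?add0r.
Qed.

(** With arbitrary weights on the kinds, the integer table turns eigenvector identities into linear
    arithmetic. *)
Lemma sum_fibre_kind (R : pzSemiRingType) (h : nat -> R) :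
  \sum_(g in fibre q) \sum_(s <- lcode g a b) h (kind (sel g s.1.1) s.1.2 s.2) =
  \sum_(kd <- iota 0 3) (nth 0%N (mean_row (kind q a b)) kd)%:R * h kd.
Proof.
rewrite sum_fibre.
under eq_bigr => g _ do rewrite (@sum_count_kind R h _
  (fun s : lstep => kind (sel g s.1.1) s.1.2 s.2) predT _ (fun s => kind_lt3 _ _ _)).
rewrite exchange_big /=; move: (fib q) pfacts => F /and3P[/eqP <- _ _].
by rewrite !big_cons !big_nil -!mulr_suml -!natr_sum /nth /= !sumnE !big_map.
Qed.

Lemma sum_fibre_kindc (R : pzSemiRingType) (h : nat -> R) :
  \sum_(g in fibre q) \sum_(s <- lcode g a b | s.1.1 == thd s.1.2 s.2)
     h (kind (sel g s.1.1) s.1.2 s.2) =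
  \sum_(kd <- iota 0 3) (nth 0%N (meanc_row (kind q a b)) kd)%:R * h kd.
Proof.
rewrite sum_fibre.
under eq_bigr => g _ do rewrite (@sum_count_kind R h _
  (fun s : lstep => kind (sel g s.1.1) s.1.2 s.2)
  (fun s => s.1.1 == thd s.1.2 s.2) _ (fun s => kind_lt3 _ _ _)).
rewrite exchange_big /=; move: (fib q) pfacts => F /and3P[_ /eqP <- _].
by rewrite !big_cons !big_nil -!mulr_suml -!natr_sum /nth /= !sumnE !big_map.
Qed.

End Pass.
End FibreCounts.

(** * Geometry of the cells *)

Section Geometry.
Local Open Scope ring_scope.
Variable R : realType.
Implicit Types (x y z : pt R) (i j k a b c : 'I_3) (v w : seq 'I_3).

Let s3_gt0 : 0 < Num.sqrt (3 : R).
Proof. by rewrite sqrtr_gt0 ltr0n. Qed.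

(* The barycentric coordinates with respect to u_1, u_2, u_3. *)
Definition bc k x : R :=
  let l2 := x.2 * 2 / Num.sqrt 3 in let l1 := x.1 - l2 / 2 in
  match val k with 0%N => 1 - l1 - l2 | 1%N => l1 | _ => l2 end.

Lemma bc_sum x : bc o0 x + bc o1 x + bc o2 x = 1.
Proof. by rewrite /bc /=; ring. Qed.

Lemma ord3P (P : 'I_3 -> Prop) : P o0 -> P o1 -> P o2 -> forall k, P k.
Proof.
move=> h0 h1 h2 k; have := mem_I3 k.
by rewrite !inE => /or3P[] /eqP ->.
Qed.

Lemma bc_u k i : bc k (u R i) = (k == i)%:R.
Proof.
have s0 : Num.sqrt (3 : R) != 0 by rewrite gt_eqF.
move: i; apply: ord3P; move: k; apply: ord3P; rewrite /bc /u /=;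
  try by field.
all: by rewrite ?mul0r ?subr0 ?subrr // ?mulfVK //; field.
Qed.

Lemma bc_psi k i x : bc k (psi i x) = (bc k x + (k == i)%:R) / 2.
Proof.
have s0 : Num.sqrt (3 : R) != 0 by rewrite gt_eqF.
rewrite -(bc_u k i) /psi /padd /pscale; move: (u R i) => y.
by move: k; apply: ord3P; rewrite /bc /=; field.
Qed.

Lemma bc_inj x y : (forall k, bc k x = bc k y) -> x = y.
Proof.
case: x y => [x1 x2] [y1 y2] h.
have s0 : Num.sqrt (3 : R) != 0 by rewrite gt_eqF.
have := h o2; have := h o1; rewrite /bc /=.
move=> h1 h2; have e2 : x2 = y2.
  have : x2 * 2 = y2 * 2 by rewrite -(mulfVK s0 (x2 * 2)) h2 mulfVK.
  by move/(mulIf _); apply; rewrite pnatr_eq0.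
by move: h1; rewrite e2 => /addIr ->.
Qed.

(** Cells are treated as full triangles rather than as pieces of the gasket: convexity then keeps
    linear interpolation inside, and distinct triangles of a level still meet only at corners. *)
Definition tri x : Prop := forall k, 0 <= bc k x.

Lemma tri_u i : tri (u R i).
Proof. by move=> k; rewrite bc_u ler0n. Qed.

Lemma tri_psi i x : tri x -> tri (psi i x).
Proof. by move=> tx k; rewrite bc_psi divr_ge0 ?addr_ge0 ?ler0n. Qed.

Lemma tri_psiw w x : tri x -> tri (psiw w x).
Proof. by elim: w => // i w IH tx; exact: tri_psi (IH tx). Qed.

Lemma psi_inj i : injective (@psi R i).
Proof.
move=> x y e; apply: bc_inj => k; have := congr1 (bc k) e.
rewrite !bc_psi => /(divIf _); rewrite pnatr_eq0 => /(_ isT).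
exact: addIr.
Qed.

Lemma psiw_inj w : injective (@psiw R w).
Proof. by elim: w => // i w IH x y /psi_inj /IH. Qed.

Lemma psiw_cat v w x : psiw (v ++ w) x = psiw v (psiw w x).
Proof. by rewrite /psiw foldr_cat. Qed.

Lemma psiw_rcons w i x : psiw (rcons w i) x = psiw w (psi i x).
Proof. by rewrite -cats1 psiw_cat. Qed.

Lemma bc_le1 k x : tri x -> bc k x <= 1.
Proof.
move=> tx; have := bc_sum x; have := tx o0; have := tx o1; have := tx o2.
by move: k; apply: ord3P; lra.
Qed.

Lemma bc1_u k x : tri x -> bc k x = 1 -> x = u R k.
Proof.
move=> tx h; apply: bc_inj => l; rewrite bc_u.
have := bc_sum x; have := tx o0; have := tx o1; have := tx o2.
move: h; move: l; apply: ord3P; move: k; apply: ord3P => /=; rewrite ?eqxx /=; lra.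
Qed.

Lemma u_inj : injective (u R).
Proof.
move=> i j e; have := congr1 (bc i) e; rewrite !bc_u eqxx.
by case: eqP => // _ /eqP; rewrite oner_eq0.
Qed.

(** Coordinate [i] is at least 1/2 on the first triangle and at most 1/2 on the second, and
    symmetrically for [j]; equality pins both arguments. *)
Lemma psi_meet i j x y : i != j -> tri x -> tri y -> psi i x = psi j y ->
  x = u R j /\ y = u R i.
Proof.
move=> ij tx ty e.
have ei := congr1 (bc i) e; have ej := congr1 (bc j) e.
move: ei ej; rewrite !bc_psi !eqxx (negbTE ij) eq_sym (negbTE ij).
have := bc_le1 i ty; have := bc_le1 j tx; have := tx i; have := ty j.
by move=> ? ? ? ? /= ? ?; split; apply: bc1_u => //; lra.
Qed.

Lemma psi_corner i k x : tri x -> psi i x = u R k -> i = k /\ x = u R k.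
Proof.
move=> tx /(congr1 (bc k)); rewrite bc_psi bc_u eqxx => e.
have := bc_le1 k tx; case: (k =P i) e => [->|_] /= e l.
  by split=> //; apply: bc1_u => //; lra.
by exfalso; lra.
Qed.

Lemma psi_u k : psi k (u R k) = u R k.
Proof. by apply: bc_inj => l; rewrite bc_psi !bc_u; case: (l == k) => /=; lra. Qed.

Lemma psiw_corner w k x : tri x -> psiw w x = u R k ->
  w = nseq (size w) k /\ x = u R k.
Proof.
elim: w => // i w IH tx /= /psi_corner[]; first exact: tri_psiw.
by move=> -> /(IH tx)[{1}-> ->].
Qed.

Lemma psiw_u n k : psiw (nseq n k) (u R k) = u R k.
Proof. by elim: n => //= n ->; exact: psi_u. Qed.

Lemma psi_mid i j : psi i (u R j) = psi j (u R i).
Proof. by apply: bc_inj => l; rewrite !bc_psi !bc_u addrC. Qed.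

(** Past the common prefix the cells touch at a midpoint, a corner of each first-level triangle,
    hence by [psiw_corner] a corner of every smaller cell that contains it. *)
Lemma psiw_meet v w x y : size v = size w -> v != w -> tri x -> tri y ->
  psiw v x = psiw w y -> exists a b, x = u R a /\ y = u R b.
Proof.
elim: v w => [|i v IH] [|j w] //= [s] vw tx ty e.
have [ij|ij] := eqVneq i j.
  rewrite ij in e vw; apply: IH (psi_inj e) => //.
  by apply: contraNN vw => /eqP ->.
have [||ex ey] := psi_meet ij _ _ e; try exact: tri_psiw.
have [_ ->] := psiw_corner tx ex; have [_ ->] := psiw_corner ty ey.
by exists j, i.
Qed.

(** Distinct cells of a level share at most one vertex; hence an edge determines its cell. *)
Lemma psiw_meet1 v w a b c d : size v = size w -> v != w ->
  psiw v (u R a) = psiw w (u R b) -> psiw v (u R c) = psiw w (u R d) -> a = c.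
Proof.
elim: v w => [|i v IH] [|j w] //= [s] vw e e'.
have [ij|ij] := eqVneq i j.
  rewrite ij in e e' vw; apply: IH (psi_inj e) (psi_inj e') => //.
  by apply: contraNN vw => /eqP ->.
have tu := fun l => tri_psiw _ (tri_u l).
have [ea _] := psi_meet ij (tu _ _) (tu _ _) e.
have [ec _] := psi_meet ij (tu _ _) (tu _ _) e'.
by apply: u_inj; apply: (@psiw_inj v); rewrite ea ec.
Qed.

(** At most two cells of a level contain a given point. As soon as first letters differ, the point
    is a midpoint, and the remaining letters are forced to be constant. *)
Lemma psiw_meet3 v1 v2 v3 x1 x2 x3 :
  size v1 = size v2 -> size v1 = size v3 -> tri x1 -> tri x2 -> tri x3 ->
  psiw v1 x1 = psiw v2 x2 -> psiw v1 x1 = psiw v3 x3 ->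
  [|| v1 == v2, v1 == v3 | v2 == v3].
Proof.
move=> s12 s13 t1 t2 t3.
elim: v1 v2 v3 s12 s13 => [|i1 v1 IH] [|i2 v2] [|i3 v3] //= [s12] [s13] e12 e13.
have tw := fun v x t => @tri_psiw v x t.
rewrite !eqseq_cons.
have e23 : psi i2 (psiw v2 x2) = psi i3 (psiw v3 x3) by rewrite -e12.
case: (eqVneq i1 i2) e12 => [<- | n12] e12; case: (eqVneq i1 i3) e13 => [<- | n13] e13 /=.
- exact: IH (psi_inj e12) (psi_inj e13).
- have [ea _] := psi_meet n13 (tw _ _ t1) (tw _ _ t3) e13.
  have eb : psiw v2 x2 = u R i3 by rewrite -ea; apply/esym/(psi_inj e12).
  have [-> _] := psiw_corner t1 ea; have [-> _] := psiw_corner t2 eb.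
  by rewrite s12 eqxx ?orbT.
- have [ea _] := psi_meet n12 (tw _ _ t1) (tw _ _ t2) e12.
  have eb : psiw v3 x3 = u R i2 by rewrite -ea; apply/esym/(psi_inj e13).
  have [-> _] := psiw_corner t1 ea; have [-> _] := psiw_corner t3 eb.
  by rewrite s13 eqxx ?orbT.
have [ea _] := psi_meet n12 (tw _ _ t1) (tw _ _ t2) e12.
have [eb _] := psi_meet n13 (tw _ _ t1) (tw _ _ t3) e13.
have i23 : i2 = i3 by apply: u_inj; rewrite -ea.
rewrite i23 eqxx /=; rewrite -i23 in e23.
have [_ ec] := psi_meet n12 (tw _ _ t1) (tw _ _ t2) e12.
have [_ ed] := psi_meet n13 (tw _ _ t1) (tw _ _ t3) e13.
have [-> _] := psiw_corner t2 ec; have [-> _] := psiw_corner t3 ed.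
by rewrite -s12 s13 eqxx ?orbT.
Qed.

Definition incell w x : Prop := exists2 y, tri y & x = psiw w y.

(* The cell w is cut out by lower bounds on the barycentric coordinates. *)
Fixpoint off w k : R := if w is i :: w' then (off w' k + (k == i)%:R) / 2 else 0.

Lemma bc_psiw w k x : bc k (psiw w x) = bc k x / 2 ^+ size w + off w k.
Proof.
elim: w => [|i w IH] /=; first by rewrite expr0 divr1 addr0.
rewrite bc_psi IH exprS; field.
by rewrite expf_eq0 pnatr_eq0 andbF.
Qed.

Definition psi_inv i x : pt R := padd (pscale 2 x) (pscale (-1) (u R i)).

Lemma psi_invK i x : psi i (psi_inv i x) = x.
Proof.
case: x => x1 x2; rewrite /psi /psi_inv /padd /pscale /=.
by congr pair; field.
Qed.

Lemma psiw_surj w x : exists y, psiw w y = x.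
Proof.
elim: w x => [|i w IH] x; first by exists x.
by have [y ey] := IH (psi_inv i x); exists y => /=; rewrite ey psi_invK.
Qed.

(** Lying in a cell is a closed condition; in this form it passes to the limit. *)
Lemma incellP w x : incell w x <-> forall k, off w k <= bc k x.
Proof.
have p2 : 0 < 2 ^+ size w :> R by rewrite exprn_gt0 ?ltr0n.
split=> [[y ty ->] k|h].
  by rewrite bc_psiw lerDr; apply: divr_ge0; [exact: ty | exact: ltW].
have [y ey] := psiw_surj w x; exists y => // k.
by have := h k; rewrite -ey bc_psiw lerDr pmulr_lge0 ?invr_gt0.
Qed.

Lemma off_nseq n k : off (nseq n k) k = 1 - 2 ^- n.
Proof.
elim: n => [|n IH] /=; first by rewrite expr0 invr1 subrr.
rewrite IH eqxx exprS mulr1n; have : 2 ^+ n != 0 :> R by rewrite expf_eq0 pnatr_eq0 andbF.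
by move: (2 ^+ n) => p p0; field.
Qed.

Lemma incell_cat v w x : incell (v ++ w) x -> incell v x.
Proof. by case=> y ty ->; rewrite psiw_cat; exists (psiw w y) => //; exact: tri_psiw. Qed.

Lemma bc_convex k (s : R) x y :
  bc k (padd (pscale s x) (pscale (1 - s) y)) = s * bc k x + (1 - s) * bc k y.
Proof.
have s0 : Num.sqrt (3 : R) != 0 by rewrite gt_eqF.
by move: k; apply: ord3P; rewrite /bc /padd /pscale /=; field.
Qed.

Lemma incell_convex w (s : R) x y : 0 <= s <= 1 -> incell w x -> incell w y ->
  incell w (padd (pscale s x) (pscale (1 - s) y)).
Proof.
move=> /andP[s0 s1] /incellP hx /incellP hy; apply/incellP => k.
rewrite bc_convex; have := hx k; have := hy k; move: (off w k) => o hy1 hx1.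
have : s * o <= s * bc k x by rewrite ler_wpM2l.
have : (1 - s) * o <= (1 - s) * bc k y by rewrite ler_wpM2l ?subr_ge0.
lra.
Qed.

(** A crude constant: the lemma only turns uniform convergence for [pdist] into convergence of
    coordinates. *)
Lemma bc_lip k x y : `|bc k x - bc k y| <= 6 * pdist x y.
Proof.
have s0 : Num.sqrt (3 : R) != 0 by rewrite gt_eqF.
have p0 : 0 <= pdist x y by exact: sqrtr_ge0.
have h1 : `|x.1 - y.1| <= pdist x y.
  by rewrite -sqrtr_sqr ler_sqrt ?lerDl ?addr_ge0 ?sqr_ge0.
have h2 : `|x.2 - y.2| <= pdist x y.
  by rewrite -sqrtr_sqr ler_sqrt ?lerDr ?addr_ge0 ?sqr_ge0.
have i3 : (Num.sqrt (3:R))^-1 <= 1.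
  rewrite invf_le1 // -[leLHS]sqrtr1 ler_sqrt ?ler1n ?ler0n //.
have e : `|(x.2 - y.2) * 2 / Num.sqrt 3| <= 2 * pdist x y.
  rewrite !normrM normr_nat normfV (gtr0_norm s3_gt0).
  have : `|x.2 - y.2| / Num.sqrt 3 <= `|x.2 - y.2| by rewrite ler_piMr.
  by rewrite mulrAC; move: (_ / _) => q; lra.
set d := pdist x y in h1 h2 e p0 *; set D := _ * 2 / _ in e.
have q k' : bc k' x - bc k' y = match val k' with
  0%N => - (x.1 - y.1) - D / 2 | 1%N => x.1 - y.1 - D / 2 | _ => D end.
  by move: k'; apply: ord3P; rewrite /bc /D /=; field.
rewrite q; move: h1 e; rewrite !ler_norml; clearbody d D.
by move: k {q}; apply: ord3P => /= /andP[? ?] /andP[? ?]; apply/andP; split; lra.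
Qed.

Definition ee k : pt R * pt R := (u R k, u R (nx k)).

Lemma enumI3 : enum 'I_3 = I3.
Proof. by apply: (inj_map val_inj); rewrite val_enum_ord. Qed.

Lemma lift00 : lift ord0 ord0 = o1 :> 'I_3. Proof. exact: val_inj. Qed.
Lemma max2 : ord_max = o2 :> 'I_3. Proof. exact: val_inj. Qed.
Lemma zero0 : ord0 = o0 :> 'I_3. Proof. exact: val_inj. Qed.

Lemma EG0 : EG R 0 = [seq ee k | k <- I3].
Proof. by rewrite /= lift00 max2 zero0. Qed.
Lemma VG0 : VG R 0 = [seq u R k | k <- I3].
Proof. by rewrite /= lift00 max2 zero0. Qed.

Lemma mem_EG n e : reflect (exists w k, size w = n /\ e = pmap2 (psiw w) (ee k)) (e \in EG R n).
Proof.
apply: (iffP idP).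
  elim: n e => [|n IH] e.
    by rewrite EG0 => /mapP[k _ ->]; exists [::], k; split.
  case/flatten_mapP => i _ /mapP[e' /IH[w [k [sw ->]]] ->].
  by exists (i :: w), k; rewrite /= sw.
move=> [w [k [sw ->]]]; elim: n w sw => [|n IH] [|i w] //.
  by move=> _; rewrite EG0; apply/mapP; exists k => //; exact: mem_I3.
move=> [sw]; apply/flatten_mapP; exists i; first by rewrite mem_enum.
apply/mapP; exists (pmap2 (psiw w) (ee k)) => //; exact: IH.
Qed.

Lemma mem_VG n x : reflect (exists w k, size w = n /\ x = psiw w (u R k)) (x \in VG R n).
Proof.
apply: (iffP idP).
  elim: n x => [|n IH] x.
    by rewrite VG0 => /mapP[k _ ->]; exists [::], k; split.
  case/flatten_mapP => i _ /mapP[e' /IH[w [k [sw ->]]] ->].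
  by exists (i :: w), k; rewrite /= sw.
move=> [w [k [sw ->]]]; elim: n w sw => [|n IH] [|i w] //.
  by move=> _; rewrite VG0; apply/mapP; exists k => //; exact: mem_I3.
move=> [sw]; apply/flatten_mapP; exists i; first by rewrite mem_enum.
apply/mapP; exists (psiw w (u R k)) => //; exact: IH.
Qed.

Lemma nx_neq k : nx k != k.
Proof. by move: k; apply: ord3P. Qed.

Lemma nx_nx_neq k : nx (nx k) != k.
Proof. by move: k; apply: ord3P. Qed.

Lemma edge_cell_inj v w k l : size v = size w ->
  pmap2 (psiw v) (ee k) = pmap2 (psiw w) (ee l) -> v = w /\ k = l.
Proof.
move=> s [e1 e2]; have [vw|vw] := eqVneq v w.
  by split=> //; move: e1; rewrite vw => /psiw_inj/u_inj.
have := psiw_meet1 s vw e1 e2 => /eqP.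
by rewrite eq_sym (negbTE (nx_neq k)).
Qed.

(** All copies keep the orientation of the base edges, so the two alternatives in [adj] and [Tr_is]
    are never confused. *)
Lemma edge_cell_rev v w k l : size v = size w ->
  pmap2 (psiw v) (ee k) <> (psiw w (u R (nx l)), psiw w (u R l)).
Proof.
move=> s [e1 e2]; have [vw|vw] := eqVneq v w.
  move: e1 e2; rewrite vw => /psiw_inj/u_inj -> /psiw_inj/u_inj /eqP.
  by rewrite (negbTE (nx_nx_neq l)).
have := psiw_meet1 s vw e1 e2 => /eqP.
by rewrite eq_sym (negbTE (nx_neq k)).
Qed.

(** Subgraphs are sets of positions in [EG]; without repetitions a position amounts to a cell
    together with a base edge. *)
Lemma EG_uniq n : uniq (EG R n).
Proof.
elim: n => [|n IH].
  rewrite EG0 map_inj_uniq //.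
  by move=> k l [/u_inj].
rewrite /= enumI3 /= cats0.
have pi i : injective (pmap2 (@psi R i)).
  move=> [x1 x2] [y1 y2] e.
  have /= e1 := psi_inj (congr1 fst e); have /= e2 := psi_inj (congr1 snd e).
  by rewrite e1 e2.
have dis i j e : i != j -> e \in map (pmap2 (psi i)) (EG R n) ->
    e \in map (pmap2 (psi j)) (EG R n) -> false.
  move=> ij /mapP[e1 /mem_EG[v [k [sv ->]]] ->] /mapP[e2 /mem_EG[w [l [sw ->]]] e3].
  have sz : size (i :: v) = size (j :: w) by rewrite /= sv sw.
  have [[h] _] := @edge_cell_inj (i :: v) (j :: w) k l sz e3.
  by rewrite h eqxx in ij.
rewrite !cat_uniq !(map_inj_uniq (@pi _)) IH /= andbT has_cat negb_or.
rewrite -andbA; apply/and3P; split; apply/hasPn => e h; apply/negP => h'.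
- by apply/notF/(dis o0 o1 e).
- by apply/notF/(dis o0 o2 e).
- by apply/notF/(dis o1 o2 e).
Qed.

End Geometry.

(** * Walks, trees and gluing *)

Section Comp.
Variables (T : eqType).
Implicit Types (es : seq (T * T)).

Lemma comp_edge es e : e \in es -> comp es e.1 = comp es e.2.
Proof.
elim: es => // e' es IH; rewrite inE => /orP[/eqP -> /=|/IH /= ->] //.
by rewrite eqxx; case: eqP => [->|].
Qed.

Lemma comp_sound es (Q : T -> T -> Prop) x y :
  (forall z, Q z z) -> (forall z t, Q z t -> Q t z) ->
  (forall z t s, Q z t -> Q t s -> Q z s) ->
  (forall e, e \in es -> Q e.1 e.2) -> comp es x = comp es y -> Q x y.
Proof.
move=> Qr Qs Qt; elim: es x y => [|e es IH] x y Qe /=; first by move=> ->.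
have {}IH z t : comp es z = comp es t -> Q z t.
  by apply: IH => e' e'es; apply: Qe; rewrite inE e'es orbT.
have Qe1 : Q e.1 e.2 by apply: Qe; rewrite mem_head.
case: eqP => [/IH x2|_]; case: eqP => [/IH y2|_].
- by move=> _; apply: Qt x2 (Qs _ _ y2).
- by move/IH => y1; apply: Qt x2 (Qt _ _ _ (Qs _ _ Qe1) y1).
- by move/IH => x1; apply: Qt x1 (Qt _ _ _ Qe1 (Qs _ _ y2)).
- exact: IH.
Qed.
End Comp.

Section Graphs.
Variable R : realType.
Implicit Types (E F : pt R -> pt R -> Prop) (x y z a b : pt R) (q p : seq (pt R)).

Definition brel E : rel (pt R) := fun x y => `[< E x y >].

Lemma walkP E x q : walk E (x :: q) <-> path (brel E) x q.
Proof.
split=> [W|/(pathP (u1 R)) W k]; last by move=> /W /asboolP.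
by apply/(pathP (u1 R)) => k kq; apply/asboolP; exact: (W k).
Qed.

Lemma walk_cons E x y q : walk E (x :: y :: q) <-> E x y /\ walk E (y :: q).
Proof.
rewrite !walkP /=; split=> [/andP[/asboolP]|[xy ?]] //.
by apply/andP; split=> //; apply/asboolP.
Qed.

Lemma conn_refl E x : conn E x x.
Proof. by exists [::]; split=> //; apply/walkP. Qed.

Lemma conn_trans E x y z : conn E x y -> conn E y z -> conn E x z.
Proof.
move=> [q [<- /walkP Wq]] [q' [<- /walkP Wq']]; exists (q ++ q').
by rewrite last_cat; split=> //; apply/walkP; rewrite cat_path Wq.
Qed.

Lemma conn_edge E x y : E x y -> conn E x y.
Proof. by move=> e; exists [:: y]; split=> //; apply/walk_cons; split=> //; apply/walkP. Qed.

Lemma conn_ind E x (P : pt R -> Prop) : P x ->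
  (forall y z, P y -> E y z -> P z) -> forall y, conn E x y -> P y.
Proof.
move=> Px IP y [q [<-]]; elim: q x Px => //= z q IH x Px /walk_cons[xz].
by apply: IH; exact: IP xz.
Qed.

Lemma conn_mono E F : (forall x y, E x y -> conn F x y) ->
  forall x y, conn E x y -> conn F x y.
Proof.
move=> EF x; apply: conn_ind; first exact: conn_refl.
by move=> y z xy /EF; exact: conn_trans.
Qed.

Lemma conn_sym E : (forall x y, E x y -> E y x) -> forall x y, conn E x y -> conn E y x.
Proof.
move=> Es x; apply: conn_ind; first exact: conn_refl.
by move=> y z yx /Es/conn_edge zy; exact: conn_trans zy yx.
Qed.

Lemma conn_saw E x y : conn E x y -> exists p, saw E x y p.
Proof.
move=> [q [<- /walkP]] /shortenP[q' W U _].
by exists (x :: q'), q'; do !split=> //; apply/walkP.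
Qed.

Definition del E a b x y : Prop := E x y /\ (x, y) <> (a, b) /\ (x, y) <> (b, a).

Lemma del_sym E a b : (forall x y, E x y -> E y x) ->
  forall x y, del E a b x y -> del E a b y x.
Proof.
by move=> Es x y [/Es ? [h1 h2]]; split=> //; split=> -[e1 e2]; subst;
  [apply: h2|apply: h1].
Qed.

Lemma acyclic_del E a b : (forall x y, E x y -> E y x) -> acyclic E -> a <> b ->
  E a b -> ~ conn (del E a b) a b.
Proof.
move=> Es ac ab Eab /conn_saw[_ [q [-> [lq [Uq Wq]]]]]; apply: ac.
have WE : walk E (a :: q).
  apply/walkP; apply: sub_path (proj1 (walkP _ _ _) Wq).
  by move=> x y /asboolP[? _]; apply/asboolP.
exists a, q; split; last by rewrite lq; do !split=> //; exact: Es.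
case: q lq Wq {Uq WE} => [|c [|]] //= lq.
by move=> /walk_cons[[_ [+ _]] _]; rewrite lq; case.
Qed.

Lemma walk_avoid E x a y q : x \notin y :: q -> walk E (y :: q) -> walk (del E x a) (y :: q).
Proof.
elim: q y => [|z q IH] y; first by move=> _ _; apply/walkP.
rewrite inE negb_or => /andP[xy xq] /walk_cons[yz Wq].
apply/walk_cons; split; last exact: IH.
split=> //; split=> -[e1 e2]; first by rewrite e1 eqxx in xy.
by move: xq; rewrite e2 inE eqxx.
Qed.

Lemma del_acyclic E : (forall a b, E a b -> ~ conn (del E a b) a b) ->
  (forall x y, E x y -> E y x) -> acyclic E.
Proof.
move=> h Es [x [[|y q] [sq [U [W Elx]]]]] //.
move: U; rewrite cons_uniq => /andP[xq Uq].
have /walk_cons[xy Wq] := W; move: Elx => /= Elx.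
apply: (h _ _ (Es _ _ Elx)); apply: (@conn_trans _ _ y).
  apply: conn_edge; split=> //; split; last first.
    by move=> -[e1 _]; move: xq; rewrite e1 mem_last.
  move=> -[]; case: q sq Uq {W Wq xq Elx} => // z q _ /andP[yq _] /= e2.
  by move: yq; rewrite {1}e2 mem_last.
exists q; split=> //; exact: walk_avoid.
Qed.

Lemma saw_unique E x y p p' : (forall x y, E x y -> E y x) -> acyclic E ->
  saw E x y p -> saw E x y p' -> p = p'.
Proof.
move=> Es ac [q [-> [lq [Uq Wq]]]] [q' [-> [lq' [Uq' Wq']]]]; congr cons.
elim: q x q' lq Uq Wq lq' Uq' Wq' => [|a q IH] x [|b q'] //=.
- by move=> -> _ _ <- /andP[]; rewrite mem_last.
- by move=> <- /andP[+ _] _ e; rewrite {1}e mem_last.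
move=> lq /andP[xq Uq] /walk_cons[xa Wq] lq' /andP[xq' Uq'] /walk_cons[xb Wq'].
have [ab|/eqP ab] := eqVneq a b.
  by rewrite ab in lq Uq Wq *; congr cons; exact: IH Wq'.
exfalso; apply: (acyclic_del Es ac _ xa).
  by move=> e; move: xq; rewrite e inE eqxx.
have c1 : conn (del E x a) x y.
  apply: (@conn_trans _ x b).
    apply: conn_edge; split=> //; split; first by move=> -[e]; exact: ab.
    by move=> -[e _]; move: xq; rewrite e inE eqxx.
  by exists q'; split=> //; exact: walk_avoid.
apply: conn_trans c1 _; apply: conn_sym; first exact: del_sym.
by exists q; split=> //; exact: walk_avoid.
Qed.

Fixpoint nonbacktracking (x : pt R) q : bool :=
  if q is y :: q' then (if q' is z :: _ then x != z else true) && nonbacktracking y q'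
  else true.

(** A return to an earlier vertex closes a cycle unless the walk turns back at once. Self-avoidance
    of concatenated local paths thus reduces to a check of consecutive steps. *)
Lemma nonbacktracking_uniq E x q : acyclic E -> (forall x, ~ E x x) ->
  walk E (x :: q) -> nonbacktracking x q -> uniq (x :: q).
Proof.
move=> ac irr; elim: q x => // y q IH x /walk_cons[xy Wq] /andP[xz nb].
have U := IH _ Wq nb; rewrite cons_uniq U andbT.
apply/negP; rewrite inE => /orP[/eqP e|xq]; first by rewrite e in xy; exact: irr xy.
(* [q1] is the stretch before the return to [x]; by [xz] it is nonempty, so [x], [y], [q1] form a
   cycle. *)
case/splitPr: xq xz Wq U {IH nb} => q1 q2 xz /walkP Wq U.
apply: ac; exists x, (y :: q1).
move: Wq; rewrite cat_path /= => /and3P[W1 /asboolP l1 _].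
have xy' : x != y by apply/eqP => e; rewrite e in xy; exact: irr xy.
split; first by case: q1 xz {U W1 l1} => //=; rewrite eqxx.
split.
  move: U; rewrite /= cat_uniq mem_cat negb_or inE /= negb_or => /andP[/andP[y1 _] /and3P[u1 n _]].
  by rewrite inE negb_or xy' y1 u1 !andbT /=; case/norP: n.
split=> //=; apply/walk_cons; split=> //; exact/walkP.
Qed.

End Graphs.

Lemma hasE_sym q a b : hasE q a b = hasE q b a.
Proof. by rewrite /hasE orbC. Qed.

Lemma hasE_nx q k : bit q k -> hasE q k (nx k).
Proof. by rewrite /hasE eqxx => ->. Qed.

Lemma hasE_bit q a b : hasE q a b -> exists k, bit q k /\ ((a, b) = (k, nx k) \/ (a, b) = (nx k, k)).
Proof.
by case/orP => /andP[/eqP <- h]; [exists a|exists b]; split=> //; [left|right].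
Qed.

Lemma hasE_neq q a b : hasE q a b -> a != b.
Proof.
case/hasE_bit => k [_ [] [-> ->]]; last by move: k; apply: (@all3P (fun k => nx k != k)).
by move: k; apply: (@all3P (fun k => k != nx k)).
Qed.

Lemma conn0_trans q a b c : conn0 q a b -> conn0 q b c -> conn0 q a c.
Proof.
have h := @allstP (fun q => all (fun a => all (fun b => all (fun c =>
  conn0 q a b ==> conn0 q b c ==> conn0 q a c) I3) I3) I3) isT q.
by move=> h1 h2; have := all3P (all3P (all3P h a) b) c; rewrite h1 h2.
Qed.

Lemma conn0_refl q a : conn0 q a a.
Proof. by rewrite /conn0 eqxx. Qed.

Lemma hasE_conn0 q a b : hasE q a b -> conn0 q a b.
Proof. by rewrite /conn0 => ->; rewrite orbT. Qed.

Lemma lvC i j : lv i j = lv j i.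
Proof.
have h := @all3P (fun i => all (fun j => lv i j == lv j i) I3) isT i.
exact/eqP/(all3P h).
Qed.

Lemma lvii i : lv i i = i.
Proof. by rewrite /lv eqxx. Qed.

Lemma lv_lt6 i j : (lv i j < 6)%N.
Proof. by have h := @all3P (fun i => all (fun j => lv i j < 6)%N I3) isT i; exact: (all3P h). Qed.

Lemma lv_surj x : (x < 6)%N -> exists i j, x = lv i j.
Proof.
case: x => [|[|[|[|[|[|]]]]]] // _; by [exists o0, o0|exists o1, o1|exists o2, o2|
  exists o1, o2|exists o0, o2|exists o0, o1].
Qed.

Lemma mem_lpairs e : e \in lpairs.
Proof. by case: e => i k; apply/allpairsP; exists (i, k); rewrite !mem_I3. Qed.

Lemma mem_ledges g e : (e \in ledges g) = bit (sel g e.1) e.2.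
Proof. by rewrite mem_filter mem_lpairs andbT. Qed.

Lemma pairI (S T : Type) (a c : S) (b d : T) : (a, b) = (c, d) -> a = c /\ b = d.
Proof. by case. Qed.

(** * Subgraphs as families of cell states *)

Section Cells.
Variable R : realType.
Implicit Types (E F : pt R -> pt R -> Prop) (x y z : pt R) (i j k a b c d : 'I_3) (v w : seq 'I_3).
Implicit Types (g : lst) (q : st).
Local Notation U := (u R).

Definition E0 q x y : Prop := exists a b, [/\ hasE q a b, x = U a & y = U b].
Definition E1 g x y : Prop :=
  exists i a b, [/\ hasE (sel g i) a b, x = psi i (U a) & y = psi i (U b)].
Definition glue n (L : seq 'I_3 -> pt R -> pt R -> Prop) x y : Prop :=
  exists w x' y', [/\ size w = n, L w x' y', x = psiw w x' & y = psiw w y'].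

Lemma E0_sym q x y : E0 q x y -> E0 q y x.
Proof. by move=> [a [b [h -> ->]]]; exists b, a; rewrite hasE_sym. Qed.
Lemma E1_sym g x y : E1 g x y -> E1 g y x.
Proof. by move=> [i [a [b [h -> ->]]]]; exists i, b, a; rewrite hasE_sym. Qed.
Lemma glue_sym n L x y : (forall w x y, L w x y -> L w y x) -> glue n L x y -> glue n L y x.
Proof. by move=> Ls [w [x' [y' [sw /Ls h -> ->]]]]; exists w, y', x'. Qed.
Lemma E1_tri g x y : E1 g x y -> tri x /\ tri y.
Proof. by move=> [i [a [b [h -> ->]]]]; split; apply: tri_psi; exact: tri_u. Qed.

Lemma conn_map E F (f : pt R -> pt R) : (forall x y, E x y -> conn F (f x) (f y)) ->
  forall x y, conn E x y -> conn F (f x) (f y).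
Proof.
move=> EF x; apply: conn_ind; first exact: conn_refl.
by move=> y z xy /EF; exact: conn_trans.
Qed.

Lemma conn_E0 q a b : conn0 q a b -> conn (E0 q) (U a) (U b).
Proof.
case/or3P => [/eqP ->|h|/andP[h1 h2]]; first exact: conn_refl.
  by apply: conn_edge; exists a, b.
by apply: (@conn_trans _ _ _ (U (thd a b))); apply: conn_edge;
  [exists a, (thd a b)|exists (thd a b), b].
Qed.

Definition posv (x : nat) : pt R :=
  match x with
  | 0 => U o0 | 1 => U o1 | 2 => U o2
  | 3 => psi o1 (U o2) | 4 => psi o0 (U o2) | _ => psi o0 (U o1)
  end.

Lemma posv_lv i a : posv (lv i a) = psi i (U a).
Proof.
by move: a; apply: ord3P; move: i; apply: ord3P; rewrite /posv /= ?psi_u // psi_mid.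
Qed.

Lemma psi_lv i a j b : psi i (U a) = psi j (U b) <-> lv i a = lv j b.
Proof.
split=> [e|e]; last by rewrite -!posv_lv e.
have [ij|ij] := eqVneq i j.
  by move: e; rewrite ij => /psi_inj/u_inj ->.
have [/u_inj -> /u_inj ->] := psi_meet ij (tri_u _ _) (tri_u _ _) e.
exact: lvC.
Qed.

Definition EL (es : seq ('I_3 * 'I_3)) x y : Prop :=
  exists2 e, e \in es & (x, y) = (posv (ledge e).1, posv (ledge e).2) \/
                        (x, y) = (posv (ledge e).2, posv (ledge e).1).

Lemma E1_EL g x y : E1 g x y <-> EL (ledges g) x y.
Proof.
split=> [[i [a [b [/hasE_bit[k [kb h]] -> ->]]]]|[[i k]]].
  exists (i, k); first by rewrite mem_ledges.
  by rewrite /ledge /= !posv_lv; case: h => -[-> ->]; [left|right].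
rewrite mem_ledges /ledge /= !posv_lv => kb [] [-> ->].
  by exists i, k, (nx k); split=> //; exact: hasE_nx.
by exists i, (nx k), k; split=> //; rewrite hasE_sym; exact: hasE_nx.
Qed.

Lemma conn_EL es i a j b :
  conn (EL es) (psi i (U a)) (psi j (U b)) <-> lcomp es (lv i a) = lcomp es (lv j b).
Proof.
have EL_sym x y : EL es x y -> EL es y x.
  by move=> [e ees [] [-> ->]]; exists e => //; [right|left].
split=> [h|h].
  suff [j' [b' [/psi_lv -> ->//]]] : exists j' b', psi j (U b) = psi j' (U b') /\
      lcomp es (lv i a) = lcomp es (lv j' b').
  move: h; apply: (conn_ind (P := fun z => exists j' b', z = psi j' (U b') /\
      lcomp es (lv i a) = lcomp es (lv j' b'))); first by exists i, a.
  move=> y z [j' [b' [-> ->]]] [[i' k] ees].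
  have he : lcomp es (lv i' k) = lcomp es (lv i' (nx k)).
    by apply: (comp_edge (map_f ledge ees)).
  rewrite /ledge /= !posv_lv => -[] h; have [/psi_lv e1 e2] := pairI h; rewrite e1.
    by exists i', (nx k).
  by exists i', k.
rewrite -!posv_lv.
refine (@comp_sound _ (map ledge es) (fun m n => conn (EL es) (posv m) (posv n))
  (lv i a) (lv j b) _ _ _ _ h).
- by move=> z; exact: conn_refl.
- by move=> z t; exact: conn_sym.
- by move=> z t s; exact: conn_trans.
move=> e /mapP[e' e'es ->]; apply: conn_edge; exists e' => //; by left.
Qed.

Lemma conn_E1 g i a j b :
  conn (E1 g) (psi i (U a)) (psi j (U b)) <-> lconn g (lv i a) (lv j b).
Proof.
rewrite /lconn -(rwP eqP) -conn_EL; split; apply: conn_mono => x y h; apply: conn_edge;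
  exact/E1_EL.
Qed.

Lemma conn_E1_u g a b : conn (E1 g) (U a) (U b) <-> lconn g a b.
Proof. by rewrite -(lvii a) -(lvii b) -conn_E1 !psi_u. Qed.

Lemma lconn_refl g (x : nat) : lconn g x x. Proof. exact: eqxx. Qed.
Lemma lconn_sym g (x y : nat) : lconn g x y = lconn g y x. Proof. exact: eq_sym. Qed.
Lemma lconn_trans g (x y z : nat) : lconn g x y -> lconn g y z -> lconn g x z.
Proof. by rewrite /lconn => /eqP ->. Qed.
Lemma lconn_E1 g i a b : hasE (sel g i) a b -> lconn g (lv i a) (lv i b).
Proof. by move=> h; apply/conn_E1/conn_edge; exists i, a, b. Qed.

Lemma glue_meet v w x y : size v = size w -> v <> w -> tri x -> tri y ->
  psiw v x = psiw w y -> exists c d, x = U c /\ y = U d.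
Proof. by move=> s /eqP; exact: psiw_meet. Qed.

(** Indexing by words instead of edge positions makes refinement a matter of appending a letter. For
    a subgraph of [G_n] the words of length [n] are the relevant ones. *)
Definition cfg n (t : sub R n) (w : seq 'I_3) : st :=
  mkst (fun k => `[< adj t (psiw w (U k)) (psiw w (U (nx k))) >]).
Definition lcfg (c : seq 'I_3 -> st) (w : seq 'I_3) : lst :=
  mklst (fun i => c (rcons w i)).

Lemma sel_lcfg (c : seq 'I_3 -> st) w i : sel (lcfg c w) i = c (rcons w i).
Proof. exact: sel_mklst. Qed.

Lemma adj_sym n (t : sub R n) x y : adj t x y -> adj t y x.
Proof. by move=> [i it [] h]; exists i => //; [right|left]. Qed.

Lemma adj_glue n (t : sub R n) x y : adj t x y <-> glue n (fun w => E0 (cfg t w)) x y.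
Proof.
split.
  wlog h : x y / exists2 i, i \in t & nth (e00 R) (EG R n) i = (x, y).
    move=> H [i it []] h; first by apply: H; exists i => //; left.
    by apply: glue_sym => [w ? ?|]; [exact: E0_sym|apply: H; exists i => //; left].
  case: h => i it e _.
  have /mem_EG[w [k [sw ew]]] : (x, y) \in EG R n by rewrite -e mem_nth.
  case: ew e => -> -> e.
  exists w, (U k), (U (nx k)); split=> //; exists k, (nx k); split=> //.
  by apply: hasE_nx; rewrite bit_mkst; apply/asboolP; exists i => //; left.
move=> [w [_ [_ [sw [a [b [/hasE_bit[k [kb h]] -> ->]]] -> ->]]]].
move: kb; rewrite bit_mkst => /asboolP kb.
by case: h => -[-> ->] //; exact: adj_sym.
Qed.

Lemma adj_glue1 n (t : sub R n.+1) x y :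
  adj t x y <-> glue n (fun w => E1 (lcfg (cfg t) w)) x y.
Proof.
rewrite adj_glue; split.
  move=> [v [_ [_ [sv [a [b [h -> ->]]] -> ->]]]].
  case/lastP: v sv h => // w i; rewrite size_rcons => -[sw] h.
  exists w, (psi i (U a)), (psi i (U b)); rewrite !psiw_rcons; split=> //.
  by exists i, a, b; rewrite sel_lcfg.
move=> [w [_ [_ [sw [i [a [b [h -> ->]]]] -> ->]]]].
exists (rcons w i), (U a), (U b); rewrite size_rcons sw !psiw_rcons; split=> //.
by exists a, b; rewrite -sel_lcfg.
Qed.

Lemma piw_E1 n (f : sub R n.+1) w (a b : pt R) : size w = n ->
  piw w f a b <-> E1 (lcfg (cfg f) w) a b.
Proof.
move=> sw; split.
  have key k i : adj f (psiw w (psi i (U k))) (psiw w (psi i (U (nx k)))) ->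
      hasE (sel (lcfg (cfg f) w) i) k (nx k).
    move=> h; apply: hasE_nx; rewrite sel_lcfg bit_mkst; apply/asboolP.
    by rewrite !psiw_rcons.
  move=> [e h]; have h' := adj_sym h; move: h h'.
  case: e => /mem_EG[w1 [k [s1 e]]]; have [/= ea eb] := pairI e;
    case: w1 s1 ea eb {e} => [|i [|//]] //= _ -> -> h h'.
    by exists i, k, (nx k); split=> //; exact: key.
  by exists i, (nx k), k; split=> //; rewrite hasE_sym; apply: key.
move=> h; split; last by apply/adj_glue1; exists w, a, b.
case: h => i [a' [b' [/hasE_bit[k [_ h]] -> ->]]].
by case: h => -[-> ->]; [left|right]; apply/mem_EG; exists [:: i], k.
Qed.

Lemma psi_in_VG n w i a : size w = n -> psiw w (psi i (U a)) \in VG R n.+1.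
Proof.
by move=> sw; apply/mem_VG; exists (rcons w i), a; rewrite size_rcons sw psiw_rcons.
Qed.

Lemma u_in_VG n w a : size w = n -> psiw w (U a) \in VG R n.+1.
Proof. by move=> sw; rewrite -(psi_u R a); exact: psi_in_VG. Qed.

(** Acyclicity is inherited. A tree path from a vertex of the cell to one of its corners either
    stays inside or leaves the cell, which is possible only through a corner. *)
Lemma tree_valid n (f : sub R n.+1) w : stree f -> size w = n -> valid (lcfg (cfg f) w).
Proof.
move=> [cf af] sw; set g := lcfg _ _; rewrite validE; apply/andP; split.
  apply/allP => -[i k] eg; apply/negP => /eqP /conn_EL h.
  have Eik : E1 g (psi i (U k)) (psi i (U (nx k))).
    by exists i, k, (nx k); split=> //; apply: hasE_nx; rewrite -(mem_ledges g (i, k)).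
  apply: (acyclic_del (@adj_sym _ f) af (a := psiw w (psi i (U k)))
                     (b := psiw w (psi i (U (nx k))))).
  - by move=> /psiw_inj/psi_inj/u_inj/eqP; rewrite eq_sym (negbTE (nx_neq k)).
  - by apply/adj_glue1; exists w, (psi i (U k)), (psi i (U (nx k))).
  move: h; apply: conn_map => x y [[j l]]; rewrite mem_filter => /andP[/= ne jl] xy.
  have key : forall x y, (x, y) = (posv (lv j l), posv (lv j (nx l))) ->
      del (adj f) (psiw w (psi i (U k))) (psiw w (psi i (U (nx k)))) (psiw w x) (psiw w y).
    move=> x1 y1 /(@pairI (pt R) (pt R))[-> ->]; rewrite !posv_lv; split.
      apply/adj_glue1; exists w, (psi j (U l)), (psi j (U (nx l))); split=> //.
      by exists j, l, (nx l); split=> //; apply: hasE_nx; rewrite -(mem_ledges g (j, l)).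
    split=> e; have [/psiw_inj e1 /psiw_inj e2] := pairI e.
      have [[jk] lk] := @edge_cell_inj R [:: j] [:: i] l k erefl (congr2 pair e1 e2).
      by rewrite jk lk eqxx in ne.
    exact: (@edge_cell_rev R [:: j] [:: i] l k erefl (congr2 pair e1 e2)).
  apply: conn_edge; case: xy => e; first exact: key.
  by apply: del_sym; [exact: adj_sym|apply: key; case: e => -> ->].
apply/allP => x; rewrite mem_iota => /andP[_ /lv_surj[i [a ->]]].
have /cf : psiw w (psi i (U a)) \in VG R n.+1 by exact: psi_in_VG.
move=> /(_ (psiw w (U o0)) (u_in_VG _ sw)) h.
have : (exists j b, psiw w (U o0) = psiw w (psi j (U b)) /\ lconn g (lv i a) (lv j b)) \/
       (exists c : 'I_3, lconn g (lv i a) c).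
  move: h; apply: (conn_ind (P := fun z => (exists j b, z = psiw w (psi j (U b)) /\
       lconn g (lv i a) (lv j b)) \/ (exists c : 'I_3, lconn g (lv i a) c))).
    by left; exists i, a; rewrite lconn_refl.
  move=> y z [|]; last by right.
  move=> [j [b [-> jb]]] /adj_glue1[v [x' [y' [sv xy ex ->]]]].
  have [vw|vw] := pselect (v = w).
    left; move: ex xy; rewrite vw => /psiw_inj <- [i' [a' [b' [h' /psi_lv e ->]]]].
    exists i', b'; split=> //; apply: lconn_trans jb _.
    by rewrite e; exact: lconn_E1.
  right; have [tx _] := E1_tri xy.
  have [||c [d [ec _]]] := glue_meet _ (nesym vw) _ tx ex.
  - by rewrite sv.
  - exact: tri_psi (tri_u _ _).
  have [jc /u_inj bc] := psi_corner (tri_u _ _) ec.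
  by exists c; move: jb; rewrite jc bc lvii.
case=> [[j [b [/psiw_inj e jb]]]|[c hc]]; apply/hasP; last by exists c; rewrite ?mem_I3.
exists o0; rewrite ?mem_I3 //; rewrite -(lvii o0).
by have /psi_lv -> : psi o0 (U o0) = psi j (U b) by rewrite psi_u.
Qed.

End Cells.

Lemma compR_edge g e r e' : e' \in ledges g -> e' != e ->
  lcompR g e r (ledge e').1 = lcompR g e r (ledge e').2.
Proof.
move=> e'g ne; apply: comp_edge; rewrite mem_cat; apply/orP; left.
by apply: map_f; rewrite mem_filter ne.
Qed.

Lemma compR_conn0 g e r (a b : 'I_3) : conn0 r a b -> lcompR g e r a = lcompR g e r b.
Proof.
have key c d : hasE r c d -> lcompR g e r c = lcompR g e r d.
  have h k : bit r k -> lcompR g e r k = lcompR g e r (nx k).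
    move=> kb; apply: (@comp_edge _ _ (k : nat, nx k : nat)).
    rewrite mem_cat; apply/orP; right; apply/mapP; exists k => //.
    by rewrite mem_filter kb mem_I3.
  by move=> /hasE_bit[k [/h kb [] [-> ->]]].
by case/or3P => [/eqP -> //|/key //|/andP[/key -> /key]].
Qed.

(** * Local forests with prescribed traces glue to a spanning tree *)

Section Gluing.
Variable R : realType.
Implicit Types (E F : pt R -> pt R -> Prop) (x y z : pt R) (i j k a b c d : 'I_3) (v w : seq 'I_3).
Local Notation U := (u R).
Variables (n : nat) (f : sub R n.+1) (t : sub R n).
Hypothesis (t_tree : stree t).
Hypothesis (f_cells : forall w, size w = n ->
  valid (lcfg (cfg f) w) /\ tr (lcfg (cfg f) w) = cfg t w).

Lemma lconn_cfg w a b : size w = n -> lconn (lcfg (cfg f) w) a b = conn0 (cfg t w) a b.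
Proof. by move=> /f_cells[vg <-]; exact: lconn_tr. Qed.

Lemma conn_cell w i a j b : size w = n -> lconn (lcfg (cfg f) w) (lv i a) (lv j b) ->
  conn (adj f) (psiw w (psi i (U a))) (psiw w (psi j (U b))).
Proof.
move=> sw /(@conn_E1 R); apply: (@conn_map R _ _ (psiw w)) => x y h; apply: conn_edge.
by apply/adj_glue1; exists w, x, y.
Qed.

(** Every vertex hangs on a corner of its cell by validity, and an edge of [t] is replaced by a
    local connection, which exists because the trace preserves connections of corners. *)
Lemma glued_connected x y : x \in VG R n.+1 -> y \in VG R n.+1 -> conn (adj f) x y.
Proof.
have toc z : z \in VG R n.+1 -> exists2 z', z' \in VG R n & conn (adj f) z z'.
  move=> /mem_VG[v [a [+ ->]]]; case/lastP: v => // w i; rewrite size_rcons => -[sw].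
  have [vg _] := f_cells sw; move: vg; rewrite validE => /andP[_ /allP h].
  have /h/hasP[c _ hc] : lv i a \in iota 0 6 by rewrite mem_iota lv_lt6.
  exists (psiw w (U c)); first by apply/mem_VG; exists w, c.
  by rewrite psiw_rcons -(psi_u R c); apply: conn_cell; rewrite ?lvii.
have fs := @adj_sym R n.+1 f.
move=> /toc[x' /t_tree.1 h xx'] /toc[y' /h xy' yy'].
apply: conn_trans xx' _; apply: conn_trans (conn_sym fs yy').
move: xy'; apply: conn_mono => _ _ /adj_glue[w [_ [_ [sw [a [b [h' -> ->]]] -> ->]]]].
rewrite -(psi_u R a) -(psi_u R b); apply: conn_cell => //.
by rewrite !lvii lconn_cfg //; exact: hasE_conn0.
Qed.

Definition out (m : nat) (L : seq 'I_3 -> pt R -> pt R -> Prop) w :=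
  glue m (fun v x y => v <> w /\ L v x y).

Lemma out_corner m L w a x : (forall v x y, L v x y -> tri x /\ tri y) -> size w = m ->
  conn (out m L w) (psiw w (U a)) (psiw w x) -> tri x -> exists c, x = U c.
Proof.
move=> Lt sw h tx.
suff : forall x', tri x' -> psiw w x = psiw w x' -> exists c, x' = U c by apply.
move: h; apply: (conn_ind (P := fun z => forall x', tri x' -> z = psiw w x' -> exists c, x' = U c)).
  by move=> x' _ /psiw_inj <-; exists a.
move=> y z _ [v [y' [z' [sv [vw /Lt[_ tz']] _ ->]]]] x' tx' e.
by have [|c [d [_ ->]]] := glue_meet _ vw tz' tx' e; [rewrite sv|exists d].
Qed.

Lemma out_sym m L w : (forall v x y, L v x y -> L v y x) ->
  forall x y, out m L w x y -> out m L w y x.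
Proof. by move=> Ls x y; apply: glue_sym => v x' y' [vw /Ls]. Qed.

Let Fo := out n (fun v => E1 (lcfg (cfg f) v)).
Let To := out n (fun v => E0 (cfg t v)).

(** A stretch of the walk through another cell runs from corner to corner, and the state of [t] in
    that cell connects the same corners. The invariant records the current cell [v] and the corner
    [c] by which it was entered. *)
Lemma Fo_To w a b : size w = n ->
  conn (Fo w) (psiw w (U a)) (psiw w (U b)) -> conn (To w) (psiw w (U a)) (psiw w (U b)).
Proof.
move=> sw h; set A := psiw w (U a).
have : psiw w (U b) = A \/ exists v c j b', [/\ size v = n, v <> w,
    psiw w (U b) = psiw v (psi j (U b')), conn (To w) A (psiw v (U c)) &
    lconn (lcfg (cfg f) v) c (lv j b')].
  move: h; apply: (conn_ind (P := fun z => z = A \/ exists v c j b', [/\ size v = n, v <> w,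
    z = psiw v (psi j (U b')), conn (To w) A (psiw v (U c)) &
    lconn (lcfg (cfg f) v) c (lv j b')])); first by left.
  move=> y z IH [v [y' [z' [sv [vw [i [a' [b' [h ey ez]]]]] ey' ez']]]]; right.
  have ty' : tri y' by rewrite ey; apply/tri_psi/tri_u.
  suff [c [Ac hc]] : exists c, conn (To w) A (psiw v (U c)) /\
      lconn (lcfg (cfg f) v) c (lv i a').
    exists v, c, i, b'; split=> //; first by rewrite ez' ez.
    by apply: lconn_trans hc _; exact: lconn_E1.
  case: IH => [yA|[v2 [c2 [j2 [b2 [sv2 vw2 ey2 Ac2 hc2]]]]]].
    have [||c [d [ec ed]]] := @glue_meet R v w y' (U a) _ vw ty' (tri_u _ _).
    - by rewrite sv.
    - by rewrite -ey' yA.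
    exists c; split; first by rewrite -ec -ey' yA; exact: conn_refl.
    have /psi_lv <- : psi c (U c) = psi i (U a') by rewrite psi_u -ec.
    by rewrite lvii lconn_refl.
  have [vv|vv] := pselect (v = v2).
    exists c2; rewrite vv; split=> //; suff -> : lv i a' = lv j2 b2 by [].
    by apply/(@psi_lv R); apply: (@psiw_inj R v); rewrite -ey -ey' ey2 vv.
  have [||c [d [ec ed]]] := @glue_meet R v v2 y' (psi j2 (U b2)) _ vv ty' (tri_psi _ (tri_u _ _)).
  - by rewrite sv.
  - by rewrite -ey' ey2.
  exists c; split; last first.
    have /psi_lv <- : psi c (U c) = psi i (U a') by rewrite psi_u -ec.
    by rewrite lvii lconn_refl.
  rewrite -ec -ey' ey2 ed; apply: conn_trans Ac2 _.
  have [jd /u_inj bd] := psi_corner (tri_u _ _) ed.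
  have {}hc2 : conn0 (cfg t v2) c2 d by rewrite -lconn_cfg // -(lvii d) -{1}jd -bd.
  have := @conn_E0 R _ _ _ hc2; apply: (@conn_map R _ _ (psiw v2)) => x1 y1 h1; apply: conn_edge.
  by exists v2, x1, y1.
case=> [->|[v [c [j [b' [sv vw e Ac hc]]]]]]; first exact: conn_refl.
have [||d1 [d [ed1 ed]]] := @glue_meet R w v (U b) (psi j (U b')) _ (nesym vw) (tri_u _ _) (tri_psi _ (tri_u _ _)).
- by rewrite sv.
- by [].
rewrite e ed; apply: conn_trans Ac _.
have [jd /u_inj bd] := psi_corner (tri_u _ _) ed.
have {}hc : conn0 (cfg t v) c d by rewrite -lconn_cfg // -(lvii d) -{1}jd -bd.
have := @conn_E0 R _ _ _ hc; apply: (@conn_map R _ _ (psiw v)) => x1 y1 h1; apply: conn_edge.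
by exists v, x1, y1.
Qed.

Lemma To_disconnected w a b : size w = n -> a != b -> conn0 (cfg t w) a b ->
  ~ conn (To w) (psiw w (U a)) (psiw w (U b)).
Proof.
move=> sw ab.
have incl c d : c != d -> forall x y, To w x y ->
    del (adj t) (psiw w (U c)) (psiw w (U d)) x y.
  move=> cd x y [v [_ [_ [sv [vw [a' [b' [h -> ->]]]] -> ->]]]].
  split; first by apply/adj_glue; exists v, (U a'), (U b'); split=> //; exists a', b'.
  have svw : size v = size w by rewrite sv.
  have := hasE_neq h => /eqP nab.
  by split=> e; have [e1 e2] := pairI e; apply: nab; move/eqP: vw => vw;
    exact: psiw_meet1 svw vw e1 e2.
have edge c d : hasE (cfg t w) c d -> adj t (psiw w (U c)) (psiw w (U d)).
  by move=> h; apply/adj_glue; exists w, (U c), (U d); split=> //; exists c, d.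
have ne c d : c != d -> psiw w (U c) <> psiw w (U d).
  by move=> /eqP cd /psiw_inj/u_inj.
have acy c d := acyclic_del (@adj_sym R n t) t_tree.2 (a := psiw w (U c)) (b := psiw w (U d)).
case/or3P => [e|h|/andP[h1 h2]] H; first by rewrite e in ab.
  apply: (acy a b (ne _ _ ab) (edge _ _ h)).
  by move: H; apply: conn_mono => x y /(incl _ _ ab); exact: conn_edge.
have ac := hasE_neq h1; have cb := hasE_neq h2.
apply: (acy a (thd a b) (ne _ _ ac) (edge _ _ h1)).
apply: (@conn_trans _ _ _ (psiw w (U b))).
  by move: H; apply: conn_mono => x y /(incl _ _ ac); exact: conn_edge.
apply: conn_edge; split; first by apply: adj_sym; exact: edge.
split=> e; have [e1 e2] := pairI e; first by apply: (ne a b ab).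
by apply: (ne (thd a b) b cb).
Qed.

(** A cycle through an edge of the cell [w] leaves and re-enters [w] only at corners, so it shows up
    in the finite graph tested by [chkcyc]: the local edges plus the outside connections [r]. These
    do not conflict with the trace because [t] is acyclic. *)
Lemma glued_edge w i k : size w = n -> bit (sel (lcfg (cfg f) w) i) k ->
  let A := psiw w (psi i (U k)) in let B := psiw w (psi i (U (nx k))) in
  ~ conn (del (adj f) A B) A B.
Proof.
move=> sw kb A B; set g := lcfg (cfg f) w in kb; have [vg tg] := f_cells sw.
pose e := (i, k); have eg : e \in ledges g by rewrite mem_ledges.
pose r := mkst (fun l => `[< conn (Fo w) (psiw w (U l)) (psiw w (U (nx l))) >]).
have Fos : forall x y, Fo w x y -> Fo w y x by apply: out_sym => v x y; exact: E1_sym.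
have rP c d : conn0 r c d -> conn (Fo w) (psiw w (U c)) (psiw w (U d)).
  have key c' d' : hasE r c' d' -> conn (Fo w) (psiw w (U c')) (psiw w (U d')).
    case/hasE_bit => l []; rewrite bit_mkst => /asboolP h [] [-> ->] //.
    exact: conn_sym.
  case/or3P => [/eqP ->|/key//|/andP[/key h1 /key h2]]; first exact: conn_refl.
  exact: conn_trans h1 h2.
have rC c d : conn (Fo w) (psiw w (U c)) (psiw w (U d)) -> conn0 r c d.
  move=> h; rewrite /conn0 /hasE; have [//|cd] := eqVneq c d.
  have : (nx c == d) || (nx d == c).
    have h' := @all3P (fun c => all (fun d => (c != d) ==> (nx c == d) || (nx d == c)) I3) isT c.
    by have := all3P h' d; rewrite cd.
  case/orP => /eqP e1; rewrite e1 !bit_mkst eqxx /=; apply/orP; left.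
    by apply/orP; left; rewrite e1; apply/asboolP.
  by apply/orP; right; rewrite e1; apply/asboolP/conn_sym.
have nc : ~~ ncompat (tr g) r.
  apply/negP => /hasP[c _ /hasP[d _ /andP[/andP[cd h1] /rP h2]]].
  by apply: (To_disconnected sw cd) (Fo_To sw h2); rewrite -tg.
have := valid_cyc vg eg nc; set L := lcompR g e r; rewrite /e /= => /eqP LAB h.
(* Invariant along the walk: inside [w] the label [L] is that of the starting vertex; outside, the
   walk has come from a corner carrying this label. *)
have : (exists j b, B = psiw w (psi j (U b)) /\ L (lv j b) = L (lv i k)) \/
       (exists d, L d = L (lv i k) /\ conn (Fo w) (psiw w (U d)) B).
  move: h; apply: (conn_ind (P := fun z =>
    (exists j b, z = psiw w (psi j (U b)) /\ L (lv j b) = L (lv i k)) \/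
    (exists d, L d = L (lv i k) /\ conn (Fo w) (psiw w (U d)) z))).
    by left; exists i, k.
  move=> y z IH [/adj_glue1[v [y' [z' [sv [i' [a' [b' [h' ey ez]]]] ey' ez']]]] [nab nba]].
  have ty' : tri y' by rewrite ey; apply/tri_psi/tri_u.
  have [vw|vw] := pselect (v = w).
    left; exists i', b'; rewrite ez' ez vw; split=> //.
    have -> : L (lv i' b') = L (lv i' a').
      case/hasE_bit: h' => l [lb e1].
      have el : (i', l) \in ledges g by rewrite mem_ledges /g -vw.
      have nel : (i', l) != e.
        apply/eqP => -[ei el']; move: nab nba; rewrite ey' ez' ey ez vw ei /A /B -el'.
        by case: e1 => -[-> ->] nab nba; [apply: nab|apply: nba].
      by have /= := compR_edge r el nel; case: e1 => -[-> ->].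
    case: IH => [[j [b [ej <-]]]|[d [<- dz]]].
      congr L; apply/(@psi_lv R); apply: (@psiw_inj R w).
      by rewrite -ej ey' ey vw.
    rewrite ey' vw in dz.
    have [c cy] := out_corner (fun v x y => @E1_tri R _ x y) sw dz ty'.
    have -> : lv i' a' = c.
      have /psi_lv <- : psi c (U c) = psi i' (U a') by rewrite psi_u -ey.
      by rewrite lvii.
    by apply/esym/compR_conn0/rC; rewrite -cy.
  right; case: IH => [[j [b [ej jb]]]|[d [dL dz]]]; last first.
    exists d; split=> //; apply: conn_trans dz _; apply: conn_edge.
    by exists v, y', z'; split=> //; split=> //; exists i', a', b'.
  have [||c [d [ec ed]]] := @glue_meet R v w y' (psi j (U b)) _ vw ty' (tri_psi _ (tri_u _ _)).
  - by rewrite sv.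
  - by rewrite -ey' ej.
  exists d; split.
    have [jd /u_inj bd] := psi_corner (tri_u _ _) ed.
    by rewrite -jb jd bd lvii.
  apply: conn_edge; exists v, y', z'; split=> //; first by split=> //; exists i', a', b'.
  by rewrite -ed -ej -ey'.
case=> [[j [b [/psiw_inj eB Lb]]]|[d [dL dB]]]; apply: LAB.
  by rewrite -Lb; congr L; apply/(@psi_lv R).
have [c cB] := out_corner (fun v x y => @E1_tri R _ x y) sw dB (tri_psi _ (tri_u _ _)).
have -> : lv i (nx k) = c.
  have /psi_lv <- : psi c (U c) = psi i (U (nx k)) by rewrite psi_u -cB.
  by rewrite lvii.
by rewrite -dL; apply: compR_conn0; apply: rC; rewrite -cB.
Qed.

Lemma glued_acyclic : acyclic (adj f).
Proof.
have fs := @adj_sym R n.+1 f.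
apply: del_acyclic; last exact: fs.
move=> A B /adj_glue1[w [_ [_ [sw [i [a [b [/hasE_bit[k [kb h0]] -> ->]]]] -> ->]]]].
have H := glued_edge sw kb; case: h0 => -[-> ->]; first exact: H.
move=> h; apply: H; apply: conn_sym; first exact: del_sym.
by move: h; apply: conn_mono => x y [? []] *; apply: conn_edge.
Qed.

Lemma glued_tree : stree f.
Proof. by split; [exact: glued_connected|exact: glued_acyclic]. Qed.

End Gluing.

(** * Codes of paths *)

Definition pass := (seq 'I_3 * 'I_3 * 'I_3)%type.
Implicit Types (p : pass) (C : seq pass) (s : lstep).

Section Code.
Variable R : realType.
Implicit Types (x y z : pt R) (i j k a b c d : 'I_3) (v w : seq 'I_3).
Implicit Types (g : lst) (q : st) (cf : seq 'I_3 -> st).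
Local Notation U := (u R).

Definition cgraph n cf : pt R -> pt R -> Prop := glue n (fun w => E0 (cf w)).
(** The entry vertex is left out so that segments of consecutive passes concatenate without
    repetition; hence [pts] omits the starting point. *)
Definition seg q a b : seq 'I_3 := if hasE q a b then [:: b] else [:: thd a b; b].
Definition pseg cf p : seq (pt R) := [seq psiw p.1.1 (U c) | c <- seg (cf p.1.1) p.1.2 p.2].
Definition pts cf C : seq (pt R) := flatten [seq pseg cf p | p <- C].

Fixpoint chain x y C : Prop :=
  if C is p :: C' then x = psiw p.1.1 (U p.1.2) /\ chain (psiw p.1.1 (U p.2)) y C'
  else x = y.
Definition ok_pass n cf p : bool :=
  [&& size p.1.1 == n, p.1.2 != p.2 & conn0 (cf p.1.1) p.1.2 p.2].
Definition ok_code n cf x y C : Prop :=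
  [/\ all (ok_pass n cf) C, uniq [seq p.1.1 | p <- C] & chain x y C].

Lemma walk_cat E x (q q' : seq (pt R)) :
  walk E (x :: q ++ q') <-> walk E (x :: q) /\ walk E (last x q :: q').
Proof. by rewrite !walkP cat_path; split=> [/andP[]|[-> ->]]. Qed.

Lemma last_pseg cf x p : last x (pseg cf p) = psiw p.1.1 (U p.2).
Proof. by rewrite /pseg /seg; case: ifP. Qed.

Lemma last_pts cf x y C : chain x y C -> last x (pts cf C) = y.
Proof.
elim: C x => //= p C IH x [-> h].
by rewrite last_cat last_pseg; exact: IH.
Qed.

Lemma thd_neq a b : a != b -> (a != thd a b) && (thd a b != b).
Proof.
have h := @all3P (fun a => all (fun b => (a != b) ==> (a != thd a b) && (thd a b != b)) I3) isT a.
by move=> ab; have := all3P h b; rewrite ab.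
Qed.

Lemma pseg_walk n cf p : ok_pass n cf p ->
  walk (cgraph n cf) (psiw p.1.1 (U p.1.2) :: pseg cf p).
Proof.
case: p => [[w a] b] /and3P[/= /eqP sw ab cab]; rewrite /pseg /seg /=.
have edge c d : hasE (cf w) c d -> cgraph n cf (psiw w (U c)) (psiw w (U d)).
  by move=> h; exists w, (U c), (U d); split=> //; exists c, d.
case: ifP => h; first by apply/walk_cons; split; [exact: edge|apply/walkP].
move: cab; rewrite /conn0 (negbTE ab) h => /andP[h1 h2].
by apply/walk_cons; split; [exact: edge|]; apply/walk_cons; split; [exact: edge|apply/walkP].
Qed.

Lemma pts_walk n cf x y C : all (ok_pass n cf) C -> chain x y C ->
  walk (cgraph n cf) (x :: pts cf C).
Proof.
elim: C x => [|p C IH] x /=; first by move=> _ _; apply/walkP.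
move=> /andP[op oC] [-> h]; apply/walk_cat; rewrite last_pseg; split; last exact: IH.
exact: pseg_walk.
Qed.

(** Within a pass the vertices are distinct; between passes the cells differ and share a single
    vertex, so the step after it cannot go back. *)
Lemma pts_nonbacktracking n cf x y C : ok_code n cf x y C -> nonbacktracking x (pts cf C).
Proof.
case; elim: C x => // -[[w a] b] C IH x /= /andP[/and3P[/= /eqP sw ab _] oC] /andP[wC uC] [-> h].
have {IH} IH := IH _ oC uC h; rewrite /pts /= -/(pts cf C).
have first c : c != b -> if pts cf C is z :: _ then psiw w (U c) != z else true.
  case: C h oC wC {uC IH} => // -[[w' a'] b'] C' /= [e _] /andP[/and3P[/= /eqP sw' _ _] _].
  rewrite inE negb_or => /andP[ww' _] cb.
  have key d : psiw w (U c) != psiw w' (U d).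
    apply: contra_neq cb => e'; have sww : size w = size w' by rewrite sw sw'.
    exact: psiw_meet1 sww ww' e' e.
  by rewrite /pts /pseg /seg /=; case: (hasE (cf w') a' b') => /=; exact: key.
rewrite /pseg /seg /=; case: (hasE (cf w) a b) => /=.
  by rewrite IH andbT; case: (pts cf C) (first _ ab) => //.
have /andP[ac cb] := thd_neq ab.
rewrite IH andbT; apply/andP; split; last by case: (pts cf C) (first _ cb).
by apply: contra_neq ab => /psiw_inj/u_inj.
Qed.

Lemma glue_E0_irr n cf x : ~ cgraph n cf x x.
Proof.
move=> [w [x' [y' [_ [a [b [h -> ->]]] -> /psiw_inj/u_inj e]]]].
by have := hasE_neq h; rewrite e eqxx.
Qed.

Lemma code_saw n cf x y C : acyclic (cgraph n cf) ->
  ok_code n cf x y C -> saw (cgraph n cf) x y (x :: pts cf C).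
Proof.
move=> ac ok; have [oC uC ch] := ok; exists (pts cf C); split=> //.
have W := pts_walk oC ch; split; first exact: last_pts.
split=> //; apply: nonbacktracking_uniq ac _ W (pts_nonbacktracking ok).
exact: glue_E0_irr.
Qed.

(** A local state seen as a configuration of level 1, so that the results on codes apply to [G_1]
    itself. *)
Definition lcf g v : st := sel g (head o0 v).
Definition lpass s : pass := ([:: s.1.1], s.1.2, s.2).

Lemma glue_E1 g x y : cgraph 1 (lcf g) x y <-> E1 g x y.
Proof.
split.
  move=> [v [_ [_ [sv [a [b [h -> ->]]] -> ->]]]].
  by case: v sv h => [|i []] //= _ h; exists i, a, b.
move=> [i [a [b [h -> ->]]]]; exists [:: i], (U a), (U b); split=> //.
by exists a, b.
Qed.

Lemma lcode_ok g a b : valid g -> a != b -> conn0 (tr g) a b ->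
  [/\ forall w, chain (psiw w (U a)) (psiw w (U b))
        [seq (rcons w s.1.1, s.1.2, s.2) | s <- lcode g a b],
      all (fun s => (s.1.2 != s.2) && conn0 (sel g s.1.1) s.1.2 s.2) (lcode g a b),
      uniq [seq s.1.1 | s <- lcode g a b] &
      all (fun s => (s.1.1 == thd s.1.2 s.2) ==> (s.1.1 == thd a b)) (lcode g a b)].
Proof.
move=> vg ab cab; have := lcodeP vg ab cab; rewrite /chkcode.
case: (lcode g a b) => // s l /and5P[/eqP s1 /eqP l1 /eqP l2 h1 /and3P[h2 h3 h4]].
split=> // w.
have : forall x y, psi s.1.1 (U s.1.2) = x -> psi (last s l).1.1 (U (last s l).2) = y ->
    chain (psiw w x) (psiw w y) [seq (rcons w s.1.1, s.1.2, s.2) | s <- s :: l].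
  elim: l s h3 {s1 l1 l2 h1 h2 h4} => [|s' l IH] s /=.
    by move=> _ x y <- <-; rewrite !psiw_rcons.
  move=> /andP[/eqP/(@psi_lv R) e h3] x y <- <-; rewrite psiw_rcons; split=> //.
  by rewrite psiw_rcons; apply: IH.
by apply; rewrite ?s1 ?l1 ?l2 /= psi_u.
Qed.

Lemma lcode_saw g a b : valid g -> acyclic (E1 (R := R) g) -> a != b -> conn0 (tr g) a b ->
  saw (E1 g) (U a) (U b) (U a :: pts (lcf g) (map lpass (lcode g a b))).
Proof.
move=> vg ac ab cab.
have e : E1 (R := R) g = cgraph 1 (lcf g).
  by apply/funext => x; apply/funext => y; apply/propext; rewrite glue_E1.
rewrite e in ac *; apply: code_saw => //.
have [h1 h2 h3 _] := lcode_ok vg ab cab; split.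
- by rewrite all_map; apply: sub_all h2 => s /andP[sab cs]; rewrite /= /ok_pass /= sab; exact: cs.
- by rewrite -map_comp (map_comp (fun i => [:: i]) (fun s : lstep => s.1.1)) map_inj_uniq // => i j [].
- exact: h1 [::].
Qed.

End Code.

(** * The trace in terms of local states, and the code of the path *)

Section Trace.
Variable R : realType.
Implicit Types (x y z : pt R) (i j k a b c d : 'I_3) (v w : seq 'I_3).
Implicit Types (g : lst) (q : st) (cf : seq 'I_3 -> st).
Local Notation U := (u R).

Section Valid.
Variables (g : lst) (vg : valid g).

Lemma valid_acyclic : acyclic (E1 (R := R) g).
Proof.
apply: del_acyclic; last by move=> x y; exact: E1_sym.
suff key i k : bit (sel g i) k -> ~ conn (del (E1 g) (psi i (U k)) (psi i (U (nx k))))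
    (psi i (U k)) (psi i (U (nx k))).
  move=> A B [i [a [b [/hasE_bit[k [kb h]] -> ->]]]]; case: h => -[-> ->].
    exact: key.
  move=> h; apply: (key i k kb); apply: conn_sym; first by apply: del_sym => x y; exact: E1_sym.
  by move: h; apply: conn_mono => x y [? []] *; apply: conn_edge.
move=> kb h; have := vg; rewrite validE => /andP[/allP/(_ (i, k)) + _].
rewrite mem_ledges => /(_ kb)/negP; apply; apply/eqP/(@conn_EL R).
move: h; apply: conn_mono => x y [/E1_EL[e el h] [n1 n2]]; apply: conn_edge.
exists e => //; rewrite mem_filter el andbT; apply/eqP => ee; apply: (_ : False).
by case: h; rewrite ee /= !posv_lv.
Qed.

Lemma valid_corner i a : exists c : 'I_3, lconn g (lv i a) c.
Proof.
have := vg; rewrite validE => /andP[_ /allP h].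
by have /h/hasP[c _ hc] : lv i a \in iota 0 6 by [rewrite mem_iota lv_lt6]; exists c.
Qed.

Lemma VG1P x : x \in VG R 1 -> exists i a, x = psi i (U a).
Proof. by move=> /mem_VG[w [k [sw ->]]]; case: w sw => [|i []] //= _; exists i, k. Qed.

Lemma u_VG1 a : U a \in VG R 1.
Proof. by apply: (@u_in_VG R 0 [::]). Qed.

Lemma ltreeP : reflect (forall a b, lconn g a b) (ltree g).
Proof.
apply: (iffP idP) => [/all3P h a b|h]; last by apply/allP => a _; exact: (h o0).
by apply: (@lconn_trans _ _ 0%N); [rewrite lconn_sym; exact: (h a)|exact: (h b)].
Qed.

Lemma is_tree_ltree : is_tree (VG R 1) (E1 g) <-> ltree g.
Proof.
split=> [[h _]|/ltreeP h].
  by apply/ltreeP => a b; apply/(@conn_E1_u R)/h; exact: u_VG1.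
split; last exact: valid_acyclic.
move=> _ _ /VG1P[i [a ->]] /VG1P[j [b ->]]; apply/conn_E1.
have [c hc] := valid_corner i a; have [d hd] := valid_corner j b.
by apply: lconn_trans hc _; apply: lconn_trans (h c d) _; rewrite lconn_sym.
Qed.

Lemma is_S_lS i : is_S (VG R 1) (E1 g) i <-> lS g i.
Proof.
have n1 := nx_neq i; have n2 := nx_nx_neq i.
have cases j : j != i -> j = nx i \/ j = nx (nx i).
  have h := @all3P (fun i => all (fun j => (j != i) ==> (j == nx i) || (j == nx (nx i))) I3) isT i.
  by have := all3P h j => /implyP h' /h' /orP[] /eqP; [left|right].
split=> [[_ [h1 [h2 _]]]|/andP[h1 h2]].
  apply/andP; split; first by apply/(@conn_E1_u R)/h1.
  by apply/negP => /(@conn_E1_u R); exact: h2.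
have nc j : j != i -> ~~ lconn g i j.
  case/cases => -> //; apply: contraNN h2 => h; apply: lconn_trans h _.
  by rewrite lconn_sym.
split; first exact: valid_acyclic.
split.
  move=> j k /cases[] -> /cases[] -> ; apply/conn_E1_u; rewrite ?lconn_refl //.
  by rewrite lconn_sym.
split; first by move=> j /nc/negP h /conn_E1_u.
move=> _ /VG1P[j [a ->]]; have [c hc] := valid_corner j a.
have hc' : conn (E1 g) (U c) (psi j (U a)).
  by rewrite -(psi_u R c); apply/conn_E1; rewrite lconn_sym lvii.
by have [<-|ci] := eqVneq c i; [left|right; exists c].
Qed.

Lemma copy_edge_psi i a b : a != b -> copy_edge i (psi i (U a)) (psi i (U b)).
Proof.
move=> ab; have : (nx a == b) || (nx b == a).
  have h := @all3P (fun a => all (fun b => (a != b) ==> (nx a == b) || (nx b == a)) I3) isT a.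
  by have := all3P h b; rewrite ab.
case/orP => /eqP <-; [exists (ee R a)|exists (ee R b)]; rewrite ?EG0 ?map_f ?mem_I3 //.
  by left.
by right.
Qed.

Lemma copy_edge_cell i j a b : a != b -> copy_edge i (psi j (U a)) (psi j (U b)) -> j = i.
Proof.
move=> ab [e]; rewrite EG0 => /mapP[k _ ->].
have key c d : psi j (U a) = psi i (U c) -> psi j (U b) = psi i (U d) -> j = i.
  move=> e1 e2; have [//|ji] := eqVneq j i.
  have ji' : [:: j] != [:: i] by apply: contraNN ji => /eqP[->].
  by have := @psiw_meet1 R [:: j] [:: i] _ _ _ _ erefl ji' e1 e2 => /eqP; rewrite (negbTE ab).
by case=> h; have [e1 e2] := pairI h; exact: key (esym e1) (esym e2) || exact: key (esym e2) (esym e1).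
Qed.

Lemma walk_copies (I : pred 'I_3) x y C (E := fun x y => exists2 i, I i & copy_edge i x y) :
  (forall p, p \in C -> size p.1.1 = 1%N /\ p.1.2 != p.2) -> chain x y C ->
  walk E (x :: pts R (lcf g) C) <-> all (fun p => I (head o0 p.1.1)) C.
Proof.
elim: C x => [|[[w a] b] C IH] x hC /=; first by move=> _; split=> // _; apply/walkP.
move=> [-> ch]; have [/= sw ab] := hC _ (mem_head _ _).
case: w sw ch {hC} (fun p pC => hC p (mem_behead (s := _ :: _) pC)) => [|i []] //= _ ch hC.
rewrite /pts /= -/(pts R (lcf g) C) walk_cat last_pseg /= (IH _ hC ch).
suff : walk E (psi i (U a) :: pseg R (lcf g) ([:: i], a, b)) <-> I i.
  by move=> ->; split=> [[-> ->]|/andP[]].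
have /andP[ac cb] := thd_neq ab.
have edge c d : c != d -> I i <-> E (psi i (U c)) (psi i (U d)).
  move=> cd; split=> [Ii|[j Ij]]; first by exists i => //; exact: copy_edge_psi.
  by move=> /(copy_edge_cell cd) ->.
rewrite /pseg /seg /=; case: (hasE _ _ _) => /=.
  rewrite walk_cons -edge //; split=> [[]//|h]; split=> //; exact/walkP.
rewrite !walk_cons -!edge //; split=> [[]//|h]; do !split=> //; exact/walkP.
Qed.

(** The self-avoiding walks over which [good] quantifies are unique in a forest, hence are those
    spelled out by [lcode]; their edges lie in the cells of their passes. *)
Lemma good_lgood i : ltree g -> good (E1 (R := R) g) i <-> lgood g i.
Proof.
move=> /ltreeP tg.
have cc a b : conn0 (tr g) a b by rewrite -lconn_tr.
have key j : j != i -> let p := U i :: pts R (lcf g) (map lpass (lcode g i j)) in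
   walk (fun x y => copy_edge i x y \/ copy_edge j x y) p <->
   all (fun s => (s.1.1 == i) || (s.1.1 == j)) (lcode g i j).
  move=> ji; rewrite eq_sym in ji; have [h1 h2 _ _] := lcode_ok R vg ji (cc i j).
  have := @walk_copies (fun l => (l == i) || (l == j)) _ _ _ _ (h1 [::]).
  rewrite [X in all _ X](_ : _ = map lpass (lcode g i j)) //.
  rewrite all_map /= => <-; last first.
    move=> p /mapP[s sl ->]; split=> //=.
    by have /allP/(_ s sl)/andP[] := h2.
  split=> W k /W; first by case=> h; [exists i|exists j]; rewrite ?eqxx ?orbT.
  by case=> l /orP[] /eqP ->; [left|right].
split=> [G|G].
  apply/allP => j _; have [//|/= ji] := eqVneq j i.
  apply/(key j ji); apply: (G j ji); apply: lcode_saw => //; first exact: valid_acyclic.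
  by rewrite eq_sym.
move=> j ji p sp.
have ij : i != j by rewrite eq_sym.
have sp' := lcode_saw vg valid_acyclic ij (cc i j).
rewrite (saw_unique (fun x y => @E1_sym R g x y) valid_acyclic sp sp').
by apply/(key j ji); have := all3P G j; rewrite (negbTE ji).
Qed.

Lemma tr1_bit k : tr1 (E1 g) (U k) (U (nx k)) <-> bit (tr g) k.
Proof.
rewrite bit_tr /tr1; case: ifP => tg.
  split.
    case=> [[_ [i [/(good_lgood _ tg) h e]]]|[i [/is_S_lS h _]]]; last first.
      by have := ltree_lS vg i tg; rewrite h.
    by case: e => /u_inj ->; rewrite h ?orbT.
  move=> h; left; split; first exact/is_tree_ltree.
  by case/orP: h => /good_lgood h; [exists k|exists (nx k)]; split; auto.
split.
  case=> [[/is_tree_ltree]|[i [/is_S_lS h [h1 h2]]]]; first by rewrite tg.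
  apply/hasP; exists i; rewrite ?mem_I3 // h /=.
  by apply/andP; split; apply/eqP => e; [apply: h1|apply: h2]; rewrite e.
case/hasP => i _ /and3P[/is_S_lS h h1 h2]; right; exists i; split=> //.
by split=> /u_inj e; [move: h1|move: h2]; rewrite e eqxx.
Qed.

End Valid.

Definition trc cf w : st := tr (lcfg cf w).

(** Since an edge position determines its cell and base edge, the trace of the statement can be
    compared with the computed one bit by bit. *)
Lemma Tr_is_trc n (f : sub R n.+1) (t : sub R n) w : stree f -> Tr_is f t ->
  size w = n -> cfg t w = trc (cfg f) w.
Proof.
move=> tf tr_ft sw.
suff bits k : bit (cfg t w) k = bit (trc (cfg f) w) k.
  move: (cfg t w) (trc (cfg f) w) bits => [[a1 a2] a3] [[b1 b2] b3] bits.
  by move: (bits o0) (bits o1) (bits o2); rewrite /bit /= => -> -> ->.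
have vg := tree_valid tf sw.
have e : piw w f = E1 (lcfg (cfg f) w).
  by apply/funext => x; apply/funext => y; apply/propext; exact: piw_E1.
apply/idP/idP => h.
  apply/(tr1_bit vg); rewrite -e; move: h; rewrite bit_mkst => /asboolP[i it ei].
  have [w' [sw' [e0 e0G [tr_e nth_e]]]] := (tr_ft i).1 it.
  move: e0G tr_e nth_e; rewrite EG0 => /mapP[k' _ ->] tr_e nth_e.
  have s : size w' = size w by rewrite sw' sw.
  have ei' : nth (e00 R) (EG R n) i = pmap2 (psiw w) (ee R k).
    case: ei => // ei; have /mem_EG[v [l [sv el]]] := mem_nth (e00 R) (ltn_ord i).
    have sv' : size v = size w by rewrite sv sw.
    by case: (@edge_cell_rev R v w l k sv'); rewrite -el ei.
  case: nth_e => ne.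
    have [ww kk] := @edge_cell_inj R w' w k' k s (etrans (esym ne) ei').
    by move: tr_e; rewrite ww kk.
  by case: (@edge_cell_rev R w w' k k' (esym s)); rewrite -ei' ne.
have := (tr1_bit vg k).2 h; rewrite -e => te.
have eG : pmap2 (psiw w) (ee R k) \in EG R n by apply/mem_EG; exists w, k.
have iG : (index (pmap2 (psiw w) (ee R k)) (EG R n) < size (EG R n))%N by rewrite index_mem.
rewrite bit_mkst; apply/asboolP; exists (Ordinal iG); last by left; rewrite nth_index.
apply/tr_ft; exists w; split=> //; exists (ee R k); first by rewrite EG0 map_f ?mem_I3.
by split=> //; left; rewrite nth_index.
Qed.

Definition refine1 cf p : seq pass :=
  [seq (rcons p.1.1 s.1.1, s.1.2, s.2) | s <- lcode (lcfg cf p.1.1) p.1.2 p.2].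
Definition refine cf C : seq pass := flatten [seq refine1 cf p | p <- C].
(** The recursion runs through the coarser configuration [trc cf]. The initial pass crosses the
    whole triangle from u_1 to u_2. *)
Fixpoint code n cf : seq pass :=
  if n is m.+1 then refine cf (code m (trc cf)) else [:: ([::], o0, o1)].

(* A necessary condition for cf to come from a spanning tree of G_n, sufficient for its code to be a path. *)
Fixpoint tree_cfg n cf : Prop :=
  if n is m.+1 then (forall w, size w = m -> valid (lcfg cf w)) /\ tree_cfg m (trc cf)
  else conn0 (cf [::]) o0 o1.

Lemma chain_cat x y z C C' : @chain R x y C -> @chain R y z C' -> @chain R x z (C ++ C').
Proof. by elim: C x => [|p C IH] x /= => [->//|[-> h] h']; split=> //; exact: IH. Qed.

Lemma refine1_word cf p p' : p' \in refine1 cf p -> exists i, p'.1.1 = rcons p.1.1 i.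
Proof. by case/mapP => s _ ->; exists s.1.1. Qed.

(** Cells never repeat: children of different cells differ, and [lcode] visits each child of a cell
    at most once. *)
Lemma code_ok n cf : tree_cfg n cf -> ok_code n cf (u1 R) (u2 R) (code n cf).
Proof.
elim: n cf => [|n IH] cf /=.
  by move=> h; split=> //=; rewrite andbT /ok_pass /= h.
move=> [vc /IH]; move: (code n _) => C; rewrite /ok_code.
elim: C (u1 R) => [|p C IHC] x; first by move=> [_ _ h]; split.
move=> [/= /andP[/and3P[/eqP sp abp cp] oC] /andP[pC uC] [-> ch]].
have [h1 h2 h3] := IHC _ (And3 oC uC ch); rewrite /refine /= -/(refine cf C).
have [k1 k2 k3 _] := lcode_ok R (vc _ sp) abp cp.
split; last exact: chain_cat (k1 _) h3.
  rewrite all_cat h1 andbT; apply/allP => _ /mapP[s sl ->].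
  have /allP/(_ s sl)/andP[n1 n2] := k2.
  by rewrite /ok_pass /= size_rcons sp eqxx n1 -sel_lcfg.
rewrite map_cat cat_uniq h2 andbT -map_comp; apply/andP; split.
  rewrite (map_comp (rcons p.1.1) (fun s : lstep => s.1.1)) map_inj_uniq //.
  exact: rcons_injr.
apply/hasPn => _ /mapP[p1 /flatten_mapP[p2 p2C /refine1_word[i e1]] ->].
apply/negP => /mapP[s _]; rewrite e1 => /eqP; rewrite /= eqseq_rcons => /andP[/eqP e2 _].
by move: pC; rewrite -e2 (map_f (fun p : pass => p.1.1) p2C).
Qed.

Lemma code_size n cf p : p \in code n cf -> size p.1.1 = n.
Proof.
elim: n cf p => [|n IH] cf p /=; first by rewrite inE => /eqP ->.
by case/flatten_mapP => p1 /IH s1 /refine1_word[i ->]; rewrite size_rcons s1.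
Qed.

Lemma lcfg_ext n cf cf' : (forall w, size w = n.+1 -> cf w = cf' w) ->
  forall w, size w = n -> lcfg cf w = lcfg cf' w.
Proof. by move=> e w sw; rewrite /lcfg /mklst !e ?size_rcons ?sw. Qed.

Lemma code_ext n cf cf' : (forall w, size w = n -> cf w = cf' w) -> code n cf = code n cf'.
Proof.
elim: n cf cf' => [//|n IH] cf cf' /lcfg_ext e /=.
have -> : code n (trc cf) = code n (trc cf').
  by apply: IH => w sw; rewrite /trc e.
rewrite /refine; congr flatten; apply/eq_in_map => p /code_size sp.
by rewrite /refine1 e.
Qed.

Lemma tree_cfg_ext n cf cf' : (forall w, size w = n -> cf w = cf' w) ->
  tree_cfg n cf -> tree_cfg n cf'.
Proof.
elim: n cf cf' => [|n IH] cf cf' e /=; first by rewrite e.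
have e' := lcfg_ext e => -[vc tc]; split; first by move=> w sw; rewrite -e' //; exact: vc.
by apply: IH tc => w sw; rewrite /trc e'.
Qed.

Lemma adj_cgraph n (t : sub R n) : adj t = cgraph n (cfg t).
Proof. by apply/funext => x; apply/funext => y; apply/propext; exact: adj_glue. Qed.

(** The points of the code form a self-avoiding path, and uniqueness in a tree identifies it with
    the one chosen by [xget]. *)
Lemma upath_code n (t : sub R n) : stree t -> tree_cfg n (cfg t) ->
  upath t = u1 R :: pts R (cfg t) (code n (cfg t)).
Proof.
move=> tt /code_ok ok; have ac := tt.2; have as_ := @adj_sym R n t.
have := code_saw _ ok; rewrite -adj_cgraph => /(_ ac) sp.
rewrite /upath; case: xgetP => [y _ /= sy|]; first exact: saw_unique as_ ac sy sp.
by move=> /(_ _ sp).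
Qed.

Lemma conn_conn0 q a b : conn (E0 q) (U a) (U b) -> conn0 q a b.
Proof.
suff h : conn (E0 q) (U a) (U b) -> exists c, U b = U c /\ conn0 q a c.
  by move=> /h[c [/u_inj ->]].
apply: (conn_ind (P := fun z => exists c, z = U c /\ conn0 q a c)).
  by exists a; rewrite conn0_refl.
move=> y z [c [-> ac]] [c' [d [h /u_inj e ->]]]; exists d; split=> //.
by apply: conn0_trans ac _; rewrite e; exact: hasE_conn0.
Qed.

Lemma stree0_cfg (t : sub R 0) : stree t -> tree_cfg 0 (cfg t).
Proof.
move=> [ct _]; apply: conn_conn0.
have := ct (U o0) (U o1); rewrite !VG0 !map_f ?mem_I3 // => /(_ isT isT).
apply: conn_mono => x y /adj_glue[w [x' [y' [/size0nil -> h -> ->]]]].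
exact: conn_edge.
Qed.

Lemma cfg_chain n (t : forall m, sub R m) : (forall m, stree (t m)) ->
  (forall m, Tr_is (t m.+1) (t m)) -> tree_cfg n (cfg (t n)).
Proof.
move=> tt trt; elim: n => [|n IH]; first exact: stree0_cfg.
split; first by move=> w; exact: tree_valid.
by apply: tree_cfg_ext IH => w; exact: Tr_is_trc.
Qed.

End Trace.

(** * The law of the refinement *)

Section FiniteLaw.
Local Open Scope classical_set_scope.
Local Open Scope ring_scope.
Variables (R : realType) (d : measure_display) (Omega : measurableType d).
Variables (P : probability Omega R) (S : finType) (X : Omega -> S).
Hypothesis X_meas : forall t, measurable [set w | X w = t].

Lemma level_measurable_seq (s : seq S) : measurable [set w | X w \in s].
Proof.
elim: s => [|t s IH]; first by rewrite (_ : [set _ | _] = set0) ?measurable0 //; apply/seteqP; split.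
rewrite (_ : [set _ | _] = [set w | X w = t] `|` [set w | X w \in s]).
  exact: measurableU.
apply/seteqP; split=> w /=; rewrite inE; first by case/orP => [/eqP|]; [left|right].
by case=> [->|->]; rewrite ?eqxx ?orbT.
Qed.

Lemma prob_level_seq (s : seq S) : uniq s ->
  P [set w | X w \in s] = (\sum_(t <- s) P [set w | X w = t])%E.
Proof.
elim: s => [_|t s IH /= /andP[ts us]].
  by rewrite big_nil (_ : [set _ | _] = set0) ?measure0 //; apply/seteqP; split.
rewrite big_cons -IH // (_ : [set _ | _] = [set w | X w = t] `|` [set w | X w \in s]).
  rewrite measureU //; first exact: level_measurable_seq.
  by apply/seteqP; split=> // w [/= ->]; rewrite (negbTE ts).
apply/seteqP; split=> w /=; rewrite inE; first by case/orP => [/eqP|]; [left|right].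
by case=> [->|->]; rewrite ?eqxx ?orbT.
Qed.

Lemma level_enum (A : pred S) : [set w | A (X w)] = [set w | X w \in enum A].
Proof. by apply/seteqP; split=> w /=; rewrite mem_enum. Qed.

Lemma level_measurable (A : pred S) : measurable [set w | A (X w)].
Proof. by rewrite level_enum; exact: level_measurable_seq. Qed.

Lemma prob_level (A : pred S) :
  P [set w | A (X w)] = (\sum_(t | A t) P [set w | X w = t])%E.
Proof. by rewrite level_enum prob_level_seq ?enum_uniq // big_enum. Qed.

End FiniteLaw.

(** * Independence of the coordinates of a uniform choice function *)

Section ProductAverage.
Local Open Scope ring_scope.
Variables (F : fieldType) (I J : finType) (A : I -> pred J).

Let c i : F := #|A i|%:R.
Hypothesis c_neq0 : forall i, c i != 0.

Lemma family_avg (G : I -> J -> F) :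
  \sum_(g in family A) \prod_i G i (g i) =
  #|family A|%:R * \prod_i ((\sum_(x in A i) G i x) / c i).
Proof.
have card_fam : (#|family A|%:R : F) = \prod_i c i.
  have := bigA_distr_big_dep (R := F) (plus := +%R) (times := *%R) A (fun _ _ => 1) => h.
  transitivity (\sum_(f in family A) \prod_(i : I) (1 : F)).
    by rewrite big1_eq sumr_const.
  by rewrite -h; apply: eq_bigr => i _; rewrite sumr_const.
rewrite card_fam -big_split /= -(bigA_distr_big_dep (R := F)).
by apply: eq_bigr => i _; rewrite mulrCA divff ?mulr1.
Qed.

Lemma family_avg1 i (phi : J -> F) :
  \sum_(g in family A) phi (g i) = #|family A|%:R * ((\sum_(x in A i) phi x) / c i).
Proof.
pose G k x : F := if k == i then phi x else 1.
transitivity (\sum_(g in family A) \prod_k G k (g k)).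
  apply: eq_bigr => g _; rewrite (bigD1 i) //= {1}/G eqxx big1 ?mulr1 // => k ki.
  by rewrite /G (negbTE ki).
have h : \prod_(k | k != i) ((\sum_(x in A k) G k x) / c k) = 1.
  by apply: big1 => k ki; rewrite /G (negbTE ki) sumr_const; apply: divff; exact: c_neq0.
by rewrite family_avg (bigD1 i) //= h mulr1 /G eqxx.
Qed.

Lemma family_avg2 i j (phi psi : J -> F) : i != j ->
  \sum_(g in family A) phi (g i) * psi (g j) =
  #|family A|%:R * ((\sum_(x in A i) phi x) / c i * ((\sum_(x in A j) psi x) / c j)).
Proof.
move=> ij; pose G k x : F := if k == i then phi x else if k == j then psi x else 1.
have ji : (j == i) = false by rewrite eq_sym (negbTE ij).
transitivity (\sum_(g in family A) \prod_k G k (g k)).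
  apply: eq_bigr => g _; rewrite (bigD1 i) //= (bigD1 j) ?ji //= {1 2}/G !eqxx ji.
  rewrite big1 ?mulr1 // => k /andP[ki kj].
  by rewrite /G (negbTE ki) (negbTE kj).
have h : \prod_(k | (k != i) && (k != j)) ((\sum_(x in A k) G k x) / c k) = 1.
  by apply: big1 => k /andP[ki kj]; rewrite /G (negbTE ki) (negbTE kj) sumr_const; apply: divff; exact: c_neq0.
by rewrite family_avg (bigD1 i) //= (bigD1 j) ?ji //= h mulr1 /G !eqxx ji.
Qed.

End ProductAverage.

(** * Correspondence between subgraphs and families of cell states *)

Section Configurations.
Local Open Scope ring_scope.
Variable R : realType.
Implicit Types (i j k a b c : 'I_3) (v w : seq 'I_3).

Lemma bit_cfg n (t : sub R n) w k (i : 'I_(size (EG R n))) : size w = n ->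
  nth (e00 R) (EG R n) i = pmap2 (psiw w) (ee R k) -> bit (cfg t w) k = (i \in t).
Proof.
move=> sw ei; rewrite bit_mkst; apply/asboolP/idP => [[j jt]|it]; last by exists i => //; left.
case=> ej.
  rewrite (_ : i = j) //; apply/ord_inj/eqP.
  by rewrite -(nth_uniq (e00 R) (ltn_ord i) (ltn_ord j) (EG_uniq R n)) ei ej.
have /mem_EG[v [l [sv el]]] := mem_nth (e00 R) (ltn_ord j).
have s : size v = size w by rewrite sv sw.
by case: (@edge_cell_rev R v w l k s); rewrite -el ej.
Qed.

Lemma cfg_inj n (t t' : sub R n) : (forall w, size w = n -> cfg t w = cfg t' w) -> t = t'.
Proof.
move=> e; apply/setP => i; have /mem_EG[w [k [sw ei]]] := mem_nth (e00 R) (ltn_ord i).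
by rewrite -(bit_cfg t sw ei) -(bit_cfg t' sw ei) e.
Qed.

Lemma cfg_surj n (cf : seq 'I_3 -> st) :
  exists t : sub R n, forall w, size w = n -> cfg t w = cf w.
Proof.
exists [set i : 'I_(size (EG R n)) | `[< exists w k, [/\ size w = n,
   nth (e00 R) (EG R n) i = pmap2 (psiw w) (ee R k) & bit (cf w) k] >]] => w sw.
set t := finset _.
suff bits k : bit (cfg t w) k = bit (cf w) k.
  move: (cfg t w) (cf w) bits => [[a1 a2] a3] [[b1 b2] b3] bits.
  by move: (bits o0) (bits o1) (bits o2); rewrite /bit /= => -> -> ->.
have eG : pmap2 (psiw w) (ee R k) \in EG R n by apply/mem_EG; exists w, k.
have iG : (index (pmap2 (psiw w) (ee R k)) (EG R n) < size (EG R n))%N by rewrite index_mem.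
rewrite (@bit_cfg n t w k (Ordinal iG)) ?nth_index // inE.
apply/asboolP/idP => [[v [l [sv]]]|h]; last by exists w, k; split; rewrite ?nth_index.
have s : size w = size v by rewrite sv sw.
by rewrite /= nth_index // => /(edge_cell_inj s)[<- <-].
Qed.

Lemma stree_nb n (t : sub R n) w : stree t -> size w = n -> (nb (cfg t w) < 3)%N.
Proof.
move=> [_ ac] sw; rewrite ltnNge; apply/negP => n3; apply: ac.
have allk k : adj t (psiw w (u R k)) (psiw w (u R (nx k))).
  apply/asboolP; rewrite -(bit_mkst (fun k => `[< adj t (psiw w (u R k)) (psiw w (u R (nx k))) >])).
  by move: n3; rewrite /nb -/(cfg t w); case: (cfg t w) => [[[] []] []] //= _; move: k; apply: ord3P.
exists (psiw w (u R o0)), [:: psiw w (u R o1); psiw w (u R o2)]; split=> //.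
split; last by split; [apply/walk_cons; split; [exact: allk|apply/walk_cons; split;
  [exact: allk|exact/walkP]]|exact: (allk o2)].
have ne a b : a != b -> psiw w (u R a) != psiw w (u R b).
  by apply: contra_neq => /psiw_inj/u_inj.
by rewrite /= !inE !negb_or !ne.
Qed.

End Configurations.

(** * The conditional law of a lift *)

Section Law.
Local Open Scope classical_set_scope.
Local Open Scope ring_scope.
Variables (R : realType) (d : measure_display) (Omega : measurableType d).
Variables (P : probability Omega R) (T : forall n : nat, Omega -> sub R n).
Hypothesis T_meas : forall (n : nat) (t : sub R n), measurable [set w | T n w = t].
Hypothesis T_unif_tree : forall (n : nat) (t : sub R n), stree t ->
  P [set w | T n w = t] = ((num_trees R n)%:R^-1)%:E.
Hypothesis T_unif_nontree : forall (n : nat) (t : sub R n), ~ stree t ->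
  P [set w | T n w = t] = 0%E.
Hypothesis T_consistent : forall (n : nat) (w : Omega), Tr_is (T n.+1 w) (T n w).

Definition treeb n : pred (sub R n) := fun t => `[< stree t >].
Let NT n : R := (num_trees R n)%:R.

Definition Ex n (F : sub R n -> R) : R :=
  (num_trees R n)%:R^-1 * \sum_(t | treeb t) F t.

Lemma prob_event n (A : pred (sub R n)) :
  P [set w | A (T n w)] = (Ex (fun t => (A t)%:R))%:E.
Proof.
rewrite (prob_level P (@T_meas n)) /Ex mulr_sumr -sumEFin.
rewrite (bigID (@treeb n)) /= [X in (_ + X)%E]big1 ?adde0; last first.
  by move=> t /andP[_ /asboolPn]; exact: T_unif_nontree.
rewrite big_mkcond [RHS]big_mkcond /=; apply: eq_bigr => t _.
case: (boolP (treeb t)) => [/asboolP tt|_]; last by rewrite andbF.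
by rewrite andbT; case: (A t); rewrite ?mulr1 ?mulr0 // T_unif_tree.
Qed.

(** Without spanning trees every value of [T n] would have probability zero, against total mass
    1. *)
Lemma num_trees_gt0 n : 0 < NT n.
Proof.
rewrite ltr0n lt0n; apply/eqP => n0.
have := prob_event (fun _ : sub R n => true).
rewrite /Ex n0 invr0 mul0r (_ : [set _ | _] = setT); last exact/seteqP.
by rewrite probability_setT => -[] /eqP; rewrite oner_eq0.
Qed.

Lemma Ex_le n (F G : sub R n -> R) : (forall t, stree t -> F t <= G t) -> Ex F <= Ex G.
Proof.
move=> FG; rewrite /Ex ler_pM2l ?invr_gt0 ?num_trees_gt0 //.
by apply: ler_sum => t /asboolP; exact: FG.
Qed.

Lemma ExD n (F G : sub R n -> R) : Ex (fun t => F t + G t) = Ex F + Ex G.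
Proof. by rewrite /Ex big_split mulrDr. Qed.

Lemma ExZ n c (F : sub R n -> R) : Ex (fun t => c * F t) = c * Ex F.
Proof. by rewrite /Ex -mulr_sumr mulrCA. Qed.

Lemma prob_le_Ex n (A : pred (sub R n)) (F : sub R n -> R) :
  (forall t, stree t -> 0 <= F t) -> (forall t, stree t -> A t -> 1 <= F t) ->
  (P [set w | A (T n w)] <= (Ex F)%:E)%E.
Proof.
move=> F0 F1; rewrite prob_event lee_fin; apply: Ex_le => t tt.
by case: (boolP (A t)) => [/F1|_]; [exact|exact: F0].
Qed.

Lemma tree_ae n : P [set w | ~~ treeb (T n w)] = 0%E.
Proof.
rewrite (prob_level P (@T_meas n) (fun t => ~~ treeb t)) big1 // => t /asboolPn.
exact: T_unif_nontree.
Qed.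

Lemma Tr_is_unique n (f : sub R n.+1) (t t' : sub R n) : Tr_is f t -> Tr_is f t' -> t = t'.
Proof.
move=> h h'; apply/setP => i; apply/idP/idP; first by move/h => ?; apply/h'.
by move/h' => ?; apply/h.
Qed.

(** A probabilistic existence argument: [f] is attained with positive probability, so at some
    outcome with [T n.+1 w = f] the value [T n w] is a tree, and consistency makes it the trace. *)
Lemma tree_Tr n (f : sub R n.+1) : stree f -> exists2 t : sub R n, stree t & Tr_is f t.
Proof.
move=> tf; have [[w [fw tw]]|no] := pselect (exists w, T n.+1 w = f /\ stree (T n w)).
  by exists (T n w); rewrite -?fw.
have : (P [set w | T n.+1 w = f] <= P [set w | ~~ treeb (T n w)])%E.
  apply: le_measure; rewrite ?inE //; first exact: (level_measurable (@T_meas n) (fun t => ~~ treeb t)).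
  by move=> w /= fw; apply/asboolPn => tw; apply: no; exists w.
by rewrite tree_ae T_unif_tree // lee_fin leNgt invr_gt0 num_trees_gt0.
Qed.

Definition liftb n (t : sub R n) : pred (sub R n.+1) :=
  fun f => treeb f && `[< Tr_is f t >].

(** By consistency, [T n = t] is the event that [T n.+1] has trace [t]; comparing the two uniform
    laws shows that all trees have equally many lifts. *)
Lemma card_liftb n (t : sub R n) : stree t -> (#|liftb t|%:R : R) = NT n.+1 / NT n.
Proof.
move=> tt; have n0 := lt0r_neq0 (num_trees_gt0 n).
have n1 := lt0r_neq0 (num_trees_gt0 n.+1).
have : P [set w | T n w = t] = P [set w | `[< Tr_is (T n.+1 w) t >]].
  congr (P _); apply/seteqP; split=> w /= h.
    by apply/asboolP; rewrite -h.
  exact: (Tr_is_unique (@T_consistent n w) (asboolW h)).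
rewrite T_unif_tree // (prob_event (fun f => `[< Tr_is f t >])) /Ex => -[].
rewrite (eq_bigr (fun f => if `[< Tr_is f t >] then 1 else 0)); last by move=> f _; case: ifP.
rewrite -big_mkcondr /= sumr_const -[#|_|]/(#|liftb t|) -/(NT n) -/(NT n.+1) => ->.
by rewrite mulrA divff // mul1r.
Qed.

(** A comparison of conditional expectations: traces partition the trees of level n+1 into classes
    of equal size. *)
Lemma Ex_step n (F : sub R n.+1 -> R) (G : sub R n -> R) :
  (forall t, stree t -> \sum_(f | liftb t f) F f <= #|liftb t|%:R * G t) -> Ex F <= Ex G.
Proof.
move=> h; have n0 := num_trees_gt0 n; have n1 := num_trees_gt0 n.+1.
rewrite {1}/Ex; have -> : \sum_(f | treeb f) F f = \sum_(t | treeb t) \sum_(f | liftb t f) F f.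
  rewrite (exchange_big_dep (@treeb n.+1)) /=; last by move=> t f _ /andP[].
  apply: eq_bigr => f /asboolP tf; have [t tt tr_ft] := tree_Tr tf.
  rewrite (big_pred1 t) // => t' /=; rewrite /liftb; apply/idP/eqP.
    by move=> /and3P[_ _ /asboolP /Tr_is_unique]; exact.
  by move=> ->; apply/and3P; split; exact/asboolP.
rewrite mulrC ler_pdivrMr //; apply: (@le_trans _ _ (\sum_(t | treeb t) NT n.+1 / NT n * G t)).
  by apply: ler_sum => t /asboolP tt; rewrite -(card_liftb tt); exact: h.
by rewrite -mulr_sumr [leRHS]mulrC /Ex mulrA.
Qed.

Definition tup n w : n.-tuple 'I_3 := insubd (nseq_tuple n o0) w.
Lemma val_tup n w : size w = n -> tup n w = w :> seq 'I_3.
Proof. by move=> sw; rewrite val_insubd sw eqxx. Qed.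

Definition locals n (f : sub R n.+1) : {ffun n.-tuple 'I_3 -> lst} :=
  [ffun w : n.-tuple 'I_3 => lcfg (cfg f) w].

Lemma lcfg_locals n (f : sub R n.+1) w : size w = n -> lcfg (cfg f) w = locals f (tup n w).
Proof. by move=> sw; rewrite ffunE val_tup. Qed.

Lemma lcfg_cfg (cf cf' : seq 'I_3 -> st) w i : lcfg cf w = lcfg cf' w ->
  cf (rcons w i) = cf' (rcons w i).
Proof. by move=> e; rewrite -!sel_lcfg e. Qed.

Lemma locals_inj n : injective (@locals n).
Proof.
move=> f f' e; apply: cfg_inj => v; case/lastP: v => // w i; rewrite size_rcons => -[sw].
by apply: lcfg_cfg; rewrite !lcfg_locals // e.
Qed.

Definition cell_fibre n (t : sub R n) (w : n.-tuple 'I_3) : pred lst := mem (fibre (cfg t w)).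

(** This is the independence of the refinements: a lift of [t] is a free choice, cell by cell, in
    the fibre of the state. Surjectivity is [glued_tree], with [cfg_inj] identifying the trace. *)
Lemma locals_lift n (t : sub R n) : stree t ->
  imset (@locals n) (mem (liftb t)) =i family (cell_fibre t).
Proof.
move=> tt g; apply/imsetP/familyP => [[f /andP[/asboolP tf /asboolP trf] ->] w|gt].
  rewrite ffunE inE; apply/andP; split; first by apply: tree_valid; rewrite ?size_tuple.
  by rewrite (Tr_is_trc tf trf) // size_tuple.
(* A word of length n+1 splits into its level-n cell and the letter of the child. *)
pose cf (v : seq 'I_3) : st := sel (g (tup n (take n v))) (last o0 v).
have [f fP] := @cfg_surj R n.+1 cf.
have lf w : size w = n -> lcfg (cfg f) w = g (tup n w).
  move=> sw; rewrite /lcfg; suff -> : (fun i => cfg f (rcons w i)) = sel (g (tup n w)).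
    by rewrite /mklst /sel /=; case: (g _) => [[]].
  apply/funext => i; rewrite fP ?size_rcons ?sw // /cf last_rcons.
  by rewrite -cats1 take_size_cat.
have gw w : size w = n -> valid (lcfg (cfg f) w) /\ tr (lcfg (cfg f) w) = cfg t w.
  move=> sw; rewrite lf //; have := gt (tup n w); rewrite /cell_fibre inE val_tup //.
  by case/andP => ? /eqP.
have tf := glued_tree tt gw.
have [t' tt' trt'] := tree_Tr tf.
have tt'e : t' = t.
  by apply: cfg_inj => w sw; rewrite (Tr_is_trc tf trt') //; have [] := gw w sw.
exists f; first by apply/andP; split; apply/asboolP; rewrite -?tt'e.
by apply/ffunP => w; rewrite ffunE lf ?size_tuple // /tup /insubd valK.
Qed.

Lemma sum_lift n (t : sub R n) (Phi : {ffun n.-tuple 'I_3 -> lst} -> R) : stree t ->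
  \sum_(f | liftb t f) Phi (locals f) = \sum_(g in family (cell_fibre t)) Phi g.
Proof.
move=> tt; rewrite -(eq_bigl _ _ (locals_lift tt)) big_imset //=.
by move=> f f' _ _; exact: locals_inj.
Qed.

Lemma card_lift_family n (t : sub R n) : stree t ->
  (#|liftb t|%:R : R) = #|family (cell_fibre t)|%:R.
Proof.
move=> tt; have := sum_lift (fun _ => 1) tt.
by rewrite !sumr_const => h; rewrite -h.
Qed.

Lemma cell_fibre_gt0 n (t : sub R n) w : stree t -> #|cell_fibre t w|%:R != 0 :> R.
Proof.
move=> tt; rewrite pnatr_eq0 -lt0n.
by apply: card_fibre_gt0; apply: stree_nb; rewrite ?size_tuple.
Qed.

Lemma lift_avg1 n (t : sub R n) (w : n.-tuple 'I_3) (phi : lst -> R) : stree t ->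
  \sum_(f | liftb t f) phi (lcfg (cfg f) w) =
  #|liftb t|%:R * ((\sum_(g in fibre (cfg t w)) phi g) / #|fibre (cfg t w)|%:R).
Proof.
move=> tt; transitivity (\sum_(f | liftb t f) phi (locals f w)).
  by apply: eq_bigr => f _; rewrite ffunE.
rewrite (sum_lift (fun g => phi (g w)) tt) card_lift_family //.
by rewrite (family_avg1 (fun w => cell_fibre_gt0 w tt)).
Qed.

Lemma lift_avg2 n (t : sub R n) (v w : n.-tuple 'I_3) (phi psi : lst -> R) : stree t -> v != w ->
  \sum_(f | liftb t f) phi (lcfg (cfg f) v) * psi (lcfg (cfg f) w) =
  #|liftb t|%:R * ((\sum_(g in fibre (cfg t v)) phi g) / #|fibre (cfg t v)|%:R *
    ((\sum_(g in fibre (cfg t w)) psi g) / #|fibre (cfg t w)|%:R)).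
Proof.
move=> tt vw; transitivity (\sum_(f | liftb t f) phi (locals f v) * psi (locals f w)).
  by apply: eq_bigr => f _; rewrite !ffunE.
rewrite (sum_lift (fun g => phi (g v) * psi (g w)) tt) card_lift_family //.
by rewrite (family_avg2 (fun w => cell_fibre_gt0 w tt)).
Qed.

Lemma stree_tree_cfg n (t : sub R n) : stree t -> tree_cfg n (cfg t).
Proof.
elim: n t => [|n IH] t tt; first exact: stree0_cfg.
split; first by move=> w; exact: tree_valid.
have [t' tt' trt'] := tree_Tr tt.
by apply: tree_cfg_ext (IH _ tt') => w; exact: Tr_is_trc.
Qed.

End Law.

(** * Moments and null events *)

Section Weights.
Local Open Scope ring_scope.
Variable R : realType.
Local Notation al := (alphabar R).

Lemma alphabar_gt1 : 1 < al.
Proof.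
rewrite /alphabar; have : 0 <= Num.sqrt (205 : R) by exact: sqrtr_ge0.
by move: (Num.sqrt _) => r; lra.
Qed.

Lemma alphabar_gt0 : 0 < al.
Proof. exact: lt_trans ltr01 alphabar_gt1. Qed.

(** The characteristic equation of the mean matrix. Its first two columns are proportional, so 0 is
    an eigenvalue and a quadratic factor remains. *)
Lemma alphabar_root : al ^+ 2 = 8 / 3 * al - 13 / 15.
Proof.
have : Num.sqrt (205 : R) ^+ 2 = 205 by rewrite sqr_sqrtr ?ler0n.
rewrite /alphabar; move: (Num.sqrt _) => r e.
have -> : (4 / 3 + r / 15) ^+ 2 = 16 / 9 + 8 / 45 * r + r ^+ 2 / 225 by field.
by rewrite e; field.
Qed.

(* The eigenvector for alphabar of the mean matrix of the three kinds, read off mean_row divided by the fibre sizes 18, 18, 30. *)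
Definition hk (kd : nat) : R :=
  let s := 5 / 4 * (al - 1) in
  match kd with 0%N => (s + 2^-1) / al | 1%N => (4 / 3 * s + 1) / al | _ => 1 end.

(** The mean matrix of [meanc_row] shrinks this vector at least by half. The entry 1/4 balances kind
    1, where 2/3 * 1/4 + 1/3 = 1/2. *)
Definition vk (kd : nat) : R := if kd is 0%N then 4^-1 else 1.

Arguments hk : simpl never.
Arguments vk : simpl never.

Lemma hk_gt0 kd : 0 < hk kd.
Proof.
have a1 := alphabar_gt1; have a0 := alphabar_gt0; move: a1 a0; rewrite /hk; move: al => x a1 a0.
by case: kd => [|[|]] // *; rewrite divr_gt0 //; lra.
Qed.

Lemma hk_le kd : hk kd <= 4.
Proof.
have a1 := alphabar_gt1; have a0 := alphabar_gt0; move: a1 a0; rewrite /hk; move: al => x a1 a0.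
case: kd => [|[|kd]]; last by rewrite ler1n.
  by rewrite ler_pdivrMr //; lra.
by rewrite ler_pdivrMr //; lra.
Qed.

Lemma hk_ge kd : 4^-1 <= hk kd.
Proof.
have := alphabar_gt1 => a1; have a0 := alphabar_gt0.
have a2 := alphabar_root.
have a3 : al <= 3.
  rewrite leNgt; apply/negP => a3; have : al * 3 < al ^+ 2 by rewrite expr2 ltr_pM2l.
  by rewrite a2; lra.
rewrite /hk; move: al a0 a1 a3 {a2} => x a0 a1 a3.
case: kd => [|[|kd]]; last by rewrite invf_le1 ?ler1n ?ltr0n.
  by rewrite ler_pdivlMr //; lra.
by rewrite ler_pdivlMr //; lra.
Qed.

Lemma vk_ge kd : 4^-1 <= vk kd.
Proof. by rewrite /vk; case: kd => [|n] //; rewrite invf_le1 ?ler1n ?ltr0n. Qed.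
Lemma vk_le1 kd : vk kd <= 1.
Proof. by rewrite /vk; case: kd => [|n] //; rewrite invf_le1 ?ler1n ?ltr0n. Qed.

Lemma card_fibre_kind q (a b : 'I_3) : (nb q < 3)%N -> a != b -> conn0 q a b ->
  #|fibre q| = nth 0 [:: 18; 18; 30]%N (kind q a b).
Proof.
move=> q3 ab cab; rewrite card_fibre //.
have h := @allstP (fun q => all (fun a => all (fun b => [&& nb q < 3, a != b & conn0 q a b]%N ==>
  (nth 0%N [:: 50; 30; 18] (nb q) == nth 0%N [:: 18; 18; 30] (kind q a b))) I3) I3) isT q.
by have := all3P (all3P h a) b; rewrite q3 ab cab => /eqP.
Qed.

Lemma sum_fibre_hk q (a b : 'I_3) : (nb q < 3)%N -> a != b -> conn0 q a b ->
  \sum_(g in fibre q) \sum_(s <- lcode g a b) hk (kind (sel g s.1.1) s.1.2 s.2) =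
  #|fibre q|%:R * (al * hk (kind q a b)).
Proof.
move=> q3 ab cab; rewrite (sum_fibre_kind q3 ab cab) (card_fibre_kind q3 ab cab).
have := kind_lt3 q a b; move: (kind q a b) => kd.
have a0 : al != 0 by rewrite gt_eqF ?alphabar_gt0.
have e := alphabar_root.
(* Every row of the table involves the first two weights only through this sum, their columns being
   in ratio 2 to 1. Its value is where the quadratic equation for [alphabar] is used. *)
have key : hk 0 + hk 1 / 2 = 5 / 4 * (al - 1).
  rewrite /hk; move: al a0 e => x a0 e.
  have e' : 5 / 4 * (x - 1) * x = 5 / 3 * (5 / 4 * (x - 1)) + 1.
    have -> : 5 / 4 * (x - 1) * x = 5 / 4 * (x ^+ 2 - x) by field.
    by rewrite e; field.
  by rewrite -[RHS](mulfK a0) e'; field.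
have k0 : al * hk 0 = 5 / 4 * (al - 1) + 2^-1 by rewrite /hk mulrC mulfVK.
have k1 : al * hk 1 = 4 / 3 * (5 / 4 * (al - 1)) + 1 by rewrite /hk mulrC mulfVK.
have k2 : hk 2 = 1 by [].
case: kd => [|[|[|]]] // _; rewrite !big_cons big_nil /= ?k0 ?k1 ?k2;
  move: key; move: (hk 0) (hk 1) => x y; lra.
Qed.

Lemma sum_fibre_vk q (a b : 'I_3) : (nb q < 3)%N -> a != b -> conn0 q a b ->
  \sum_(g in fibre q) \sum_(s <- lcode g a b | s.1.1 == thd s.1.2 s.2)
     vk (kind (sel g s.1.1) s.1.2 s.2) <=
  #|fibre q|%:R * (2^-1 * vk (kind q a b)).
Proof.
move=> q3 ab cab; rewrite (sum_fibre_kindc q3 ab cab) (card_fibre_kind q3 ab cab).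
have := kind_lt3 q a b; move: (kind q a b) => kd.
by case: kd => [|[|[|]]] // _; rewrite !big_cons big_nil /vk /=; lra.
Qed.

End Weights.

(** * First moments of sums over passes *)

Section Moments.
Local Open Scope classical_set_scope.
Local Open Scope ring_scope.
Variables (R : realType) (d : measure_display) (Omega : measurableType d).
Variables (P : probability Omega R) (T : forall n : nat, Omega -> sub R n).
Hypothesis T_meas : forall (n : nat) (t : sub R n), measurable [set w | T n w = t].
Hypothesis T_unif_tree : forall (n : nat) (t : sub R n), stree t ->
  P [set w | T n w = t] = ((num_trees R n)%:R^-1)%:E.
Hypothesis T_unif_nontree : forall (n : nat) (t : sub R n), ~ stree t ->
  P [set w | T n w = t] = 0%E.
Hypothesis T_consistent : forall (n : nat) (w : Omega), Tr_is (T n.+1 w) (T n w).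
Local Notation al := (alphabar R).

Definition stat (sg : pass -> st -> R) n (f : sub R n) : R :=
  \sum_(p <- code n (cfg f)) sg p (cfg f p.1.1).
Definition child p s : pass := (rcons p.1.1 s.1.1, s.1.2, s.2).
Definition loc (sg : pass -> st -> R) p (g : lst) : R :=
  \sum_(s <- lcode g p.1.2 p.2) sg (child p s) (sel g s.1.1).

Lemma code_lift n (t : sub R n) f : liftb t f ->
  code n.+1 (cfg f) = refine (cfg f) (code n (cfg t)).
Proof.
move=> /andP[/asboolP tf /asboolP trf] /=; congr refine; apply: code_ext => w sw.
by rewrite (Tr_is_trc tf trf).
Qed.

Lemma big_code_lift n (t : sub R n) f (F : pass -> R) : liftb t f ->
  \sum_(p <- code n.+1 (cfg f)) F p =
  \sum_(p <- code n (cfg t)) \sum_(s <- lcode (lcfg (cfg f) p.1.1) p.1.2 p.2) F (child p s).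
Proof.
by move=> /code_lift ->; rewrite big_flatten big_map; apply: eq_bigr => p _; rewrite big_map.
Qed.

Lemma stat_lift sg n (t : sub R n) f : liftb t f ->
  stat sg f = \sum_(p <- code n (cfg t)) loc sg p (lcfg (cfg f) p.1.1).
Proof.
move=> ltf; rewrite /stat (big_code_lift _ ltf); apply: eq_bigr => p _.
by apply: eq_bigr => s _; rewrite sel_lcfg.
Qed.

Lemma code_pass n (t : sub R n) p : stree t -> p \in code n (cfg t) ->
  [/\ size p.1.1 = n, p.1.2 != p.2, conn0 (cfg t p.1.1) p.1.2 p.2 & (nb (cfg t p.1.1) < 3)%N].
Proof.
move=> tt pC; have [/allP/(_ p pC)/and3P[/eqP sp ab cp] _ _] :=
  code_ok R (stree_tree_cfg T_meas T_unif_tree T_unif_nontree T_consistent tt).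
by split=> //; exact: stree_nb.
Qed.

Lemma code_word_inj n (t : sub R n) p p' : stree t -> p \in code n (cfg t) ->
  p' \in code n (cfg t) -> p.1.1 = p'.1.1 -> p = p'.
Proof.
move=> tt; have [_ + _] :=
  code_ok R (stree_tree_cfg T_meas T_unif_tree T_unif_nontree T_consistent tt).
elim: (code n (cfg t)) => //= p1 C IH /andP[p1C uC].
rewrite !inE => /orP[/eqP ->|pC] /orP[/eqP ->|p'C] // e; last exact: IH.
  by move: p1C; rewrite e (map_f (fun p : pass => p.1.1) p'C).
by move: p1C; rewrite -e (map_f (fun p : pass => p.1.1) pC).
Qed.

Lemma code_uniq n (t : sub R n) : stree t -> uniq (code n (cfg t)).
Proof.
move=> tt; have [_ u _] :=
  code_ok R (stree_tree_cfg T_meas T_unif_tree T_unif_nontree T_consistent tt).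
exact: map_uniq u.
Qed.

(** Each summand sees the local state of one cell only, so by [lift_avg1] an inequality over a
    single fibre suffices. *)
Lemma linear_step sg sg' n :
  (forall p q, size p.1.1 = n -> p.1.2 != p.2 -> conn0 q p.1.2 p.2 -> (nb q < 3)%N ->
    \sum_(g in fibre q) loc sg' p g <= #|fibre q|%:R * sg p q) ->
  Ex (@stat sg' n.+1) <= Ex (@stat sg n).
Proof.
move=> h; apply: (Ex_step T_meas T_unif_tree T_unif_nontree T_consistent) => t tt.
under eq_bigr => f ltf do rewrite (stat_lift _ ltf).
rewrite exchange_big /= /stat mulr_sumr [leLHS]big_seq_cond [leRHS]big_seq_cond.
apply: ler_sum => p /andP[pC _]; have [sp ab cp q3] := code_pass tt pC.
under eq_bigr => f _ do rewrite -[p.1.1](val_tup sp).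
rewrite (lift_avg1 T_meas T_unif_tree T_unif_nontree T_consistent) // val_tup //.
rewrite ler_pM2l; last first.
  rewrite (card_liftb T_meas T_unif_tree T_unif_nontree T_consistent tt).
  by rewrite divr_gt0 // (num_trees_gt0 T_meas T_unif_tree T_unif_nontree).
rewrite ler_pdivrMr ?ltr0n ?card_fibre_gt0 // mulrC; exact: h.
Qed.

Definition hsg p q : R := hk R (kind q p.1.2 p.2).

Lemma Ex_hsg n : Ex (@stat hsg n) <= 4 * al ^+ n.
Proof.
elim: n => [|n IH].
  rewrite mulr1; apply: (@le_trans _ _ (Ex (fun t : sub R 0 => 4 * 1))).
    apply: (Ex_le T_meas T_unif_tree T_unif_nontree) => t _.
    by rewrite /stat big_seq1 mulr1; exact: hk_le.
  rewrite ExZ ler_piMr // /Ex sumr_const /num_trees mulVf //.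
  exact: lt0r_neq0 (num_trees_gt0 T_meas T_unif_tree T_unif_nontree 0).
apply: (@le_trans _ _ (Ex (fun t : sub R n => al * stat hsg t))).
  apply: (@le_trans _ _ (Ex (@stat (fun p q => al * hsg p q) n))).
    apply: linear_step => p q sp ab cp q3.
    by rewrite /loc /hsg sum_fibre_hk.
  by apply: (Ex_le T_meas T_unif_tree T_unif_nontree) => t _; rewrite /stat mulr_sumr.
by rewrite ExZ exprS [leRHS]mulrCA ler_pM2l ?alphabar_gt0.
Qed.

End Moments.

(** * Second moments of the masses of cells *)

Section SecondMoments.
Local Open Scope classical_set_scope.
Local Open Scope ring_scope.
Variables (R : realType) (d : measure_display) (Omega : measurableType d).
Variables (P : probability Omega R) (T : forall n : nat, Omega -> sub R n).
Hypothesis T_meas : forall (n : nat) (t : sub R n), measurable [set w | T n w = t].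
Hypothesis T_unif_tree : forall (n : nat) (t : sub R n), stree t ->
  P [set w | T n w = t] = ((num_trees R n)%:R^-1)%:E.
Hypothesis T_unif_nontree : forall (n : nat) (t : sub R n), ~ stree t ->
  P [set w | T n w = t] = 0%E.
Hypothesis T_consistent : forall (n : nat) (w : Omega), Tr_is (T n.+1 w) (T n w).
Local Notation al := (alphabar R).
Local Notation hw f p := (hsg R p (cfg f p.1.1)).

Let ExLe := @Ex_le R d Omega P T T_meas T_unif_tree T_unif_nontree.
Let codeP := @code_pass R d Omega P T T_meas T_unif_tree T_unif_nontree T_consistent.

Definition same m (v w : seq 'I_3) : R := (take m v == take m w)%:R.
(** This is the sum over level-m cells of the squared weight of the passes in them, written as a
    double sum so that distinct passes can be refined independently. *)
Definition pairs m n (f : sub R n) : R :=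
  \sum_(p <- code n (cfg f)) \sum_(p' <- code n (cfg f))
     same m p.1.1 p'.1.1 * (hw f p * hw f p').

Lemma hsg_ge0 p q : 0 <= hsg R p q. Proof. exact/ltW/hk_gt0. Qed.

Lemma same_ge0 m v w : 0 <= same m v w. Proof. exact: ler0n. Qed.

Lemma take_rcons_le m (w : seq 'I_3) i : (m <= size w)%N -> take m (rcons w i) = take m w.
Proof. by move=> mw; rewrite -cats1 takel_cat. Qed.

Lemma pairs_lift m n (t : sub R n) f : (m <= n)%N -> stree t -> liftb t f ->
  pairs m f = \sum_(p <- code n (cfg t)) \sum_(p' <- code n (cfg t))
     same m p.1.1 p'.1.1 *
     (loc (hsg R) p (lcfg (cfg f) p.1.1) * loc (hsg R) p' (lcfg (cfg f) p'.1.1)).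
Proof.
move=> mn tt ltf; rewrite /pairs (big_code_lift _ ltf).
rewrite big_seq [RHS]big_seq; apply: eq_bigr => p pC.
have [sp _ _ _] := codeP tt pC.
transitivity (\sum_(s <- lcode (lcfg (cfg f) p.1.1) p.1.2 p.2)
  \sum_(p' <- code n (cfg t)) same m p.1.1 p'.1.1 *
    (hsg R (child p s) (sel (lcfg (cfg f) p.1.1) s.1.1) * loc (hsg R) p' (lcfg (cfg f) p'.1.1))).
  apply: eq_bigr => s _; rewrite (big_code_lift _ ltf).
  rewrite big_seq [RHS]big_seq; apply: eq_bigr => p' pC'.
  have [sp' _ _ _] := codeP tt pC'.
  rewrite /loc !mulr_sumr; apply: eq_bigr => s' _.
  by rewrite /same /= !take_rcons_le ?sp ?sp' // !sel_lcfg.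
rewrite exchange_big /=; apply: eq_bigr => p' _.
by rewrite -mulr_sumr -mulr_suml.
Qed.

Lemma loc_ge0 p g : 0 <= loc (hsg R) p g.
Proof. by apply: sumr_ge0 => s _; exact: hsg_ge0. Qed.

Lemma loc_le p q g : (nb q < 3)%N -> p.1.2 != p.2 -> conn0 q p.1.2 p.2 ->
  g \in fibre q -> loc (hsg R) p g <= 12.
Proof.
move=> q3 ab cab gq; have s3 := size_lcode q3 ab cab gq.
apply: (@le_trans _ _ (\sum_(s <- lcode g p.1.2 p.2) 4)).
  by apply: ler_sum => s _; exact: hk_le.
rewrite big_const_seq count_predT iter_addr addr0.
by apply: (@le_trans _ _ (4 *+ 3)); [exact: ler_wpMn2l | rewrite -mulrnA].
Qed.

(** Distinct passes lie in distinct cells, so the conditional mean factorizes and gains exactly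
    [al ^+ 2]. On the diagonal [loc] is at most 3 * 4 = 12, and 144 = 576 / 4 is at most 576 times a
    weight. *)
Lemma pairs_step m n : (m <= n)%N ->
  Ex (@pairs m n.+1) <= Ex (fun t : sub R n => al ^+ 2 * pairs m t + 576 * stat (hsg R) t).
Proof.
move=> mn; apply: (Ex_step T_meas T_unif_tree T_unif_nontree T_consistent) => t tt.
have L0 : 0 < #|liftb t|%:R :> R.
  rewrite (card_liftb T_meas T_unif_tree T_unif_nontree T_consistent tt).
  by rewrite divr_gt0 // (num_trees_gt0 T_meas T_unif_tree T_unif_nontree).
under eq_bigr => f ltf do rewrite (pairs_lift mn tt ltf).
rewrite exchange_big /= mulrDr.
have -> : 576 * stat (hsg R) t =
    \sum_(p <- code n (cfg t)) \sum_(p' <- code n (cfg t)) (p == p')%:R * (576 * hw t p).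
  rewrite /stat mulr_sumr big_seq [RHS]big_seq; apply: eq_bigr => p pC.
  have uC := code_uniq T_meas T_unif_tree T_unif_nontree T_consistent tt.
  rewrite (bigD1_seq p) //= eqxx mul1r big1 ?addr0 // => p' pp'.
  by rewrite eq_sym (negbTE pp') mul0r.
have -> : al ^+ 2 * pairs m t = \sum_(p <- code n (cfg t)) \sum_(p' <- code n (cfg t))
    al ^+ 2 * (same m p.1.1 p'.1.1 * (hw t p * hw t p')).
  by rewrite /pairs mulr_sumr; apply: eq_bigr => p _; rewrite mulr_sumr.
rewrite !mulr_sumr -big_split /= [leLHS]big_seq [leRHS]big_seq; apply: ler_sum => p pC.
rewrite !mulr_sumr -big_split exchange_big /= [leLHS]big_seq [leRHS]big_seq.
apply: ler_sum => p' pC'; have [sp ab cp q3] := codeP tt pC.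
have [sp' ab' cp' q3'] := codeP tt pC'.
rewrite -mulr_sumr -mulrDr.
have [pp'|pp'] := eqVneq p p'.
  rewrite -pp' /same eqxx !mul1r.
  apply: (@le_trans _ _ (\sum_(f | liftb t f) (144 : R))).
    apply: ler_sum => f /andP[/asboolP tf /asboolP trf].
    have gf : lcfg (@cfg R n.+1 f) p.1.1 \in fibre (cfg t p.1.1).
      by rewrite inE (@tree_valid R n f _ tf sp) (@Tr_is_trc R n f t _ tf trf sp) eqxx.
    have := loc_le q3 ab cp gf; have := loc_ge0 p (lcfg (@cfg R n.+1 f) p.1.1).
    move: (loc _ _ _) => x x0 x12.
    by have := ler_pM x0 x0 x12 x12; lra.
  rewrite sumr_const -[144 *+ _]mulr_natl ler_pM2l //.
  have h4 : 4^-1 <= hw t p by exact: hk_ge.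
  have : 0 <= al ^+ 2 * (hw t p * hw t p) by rewrite !mulr_ge0 ?exprn_ge0 ?hsg_ge0 ?ltW ?alphabar_gt0.
  by move: h4; move: (hw t p) (al ^+ 2 * _) => x y; lra.
have nw : tup n p.1.1 != tup n p'.1.1.
  apply: contra_neq pp' => e; apply: (code_word_inj T_meas T_unif_tree T_unif_nontree T_consistent tt pC pC').
  by rewrite -(val_tup sp) e val_tup.
apply: (@le_trans _ _ (same m p.1.1 p'.1.1 *
    (#|liftb t|%:R * ((al * hw t p) * (al * hw t p'))))); last first.
  by rewrite le_eqVlt; apply/orP; left; apply/eqP; rewrite (_ : (false : nat)%:R = 0 :> R) //; ring.
apply: ler_wpM2l; first exact: same_ge0.
rewrite -{1}(val_tup sp) -{1}(val_tup sp').
rewrite (lift_avg2 T_meas T_unif_tree T_unif_nontree T_consistent) // !val_tup //.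
rewrite /loc !sum_fibre_hk // ![#|_|%:R * _ / _]mulrAC !divff ?mul1r //.
  by rewrite pnatr_eq0 -lt0n card_fibre_gt0.
by rewrite pnatr_eq0 -lt0n card_fibre_gt0.
Qed.

Lemma pairs_diag m (t : sub R m) : stree t -> pairs m t <= 4 * stat (hsg R) t.
Proof.
move=> tt; rewrite /pairs /stat mulr_sumr [leLHS]big_seq [leRHS]big_seq.
apply: ler_sum => p pC; have [sp _ _ _] := codeP tt pC.
have uC := code_uniq T_meas T_unif_tree T_unif_nontree T_consistent tt.
rewrite (bigD1_seq p) //= big_seq_cond big1 ?addr0 => [|p' /andP[pC' pp']].
  by rewrite /same eqxx mul1r ler_wpM2r ?hsg_ge0 ?hk_le.
have [sp' _ _ _] := codeP tt pC'.
rewrite /same !take_oversize ?sp ?sp' //; case: eqP => [e|]; last by rewrite mul0r.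
by rewrite (code_word_inj T_meas T_unif_tree T_unif_nontree T_consistent tt pC pC' e) eqxx in pp'.
Qed.

Definition pairs_const : R := 16 + 2304 / (al ^+ 2 - al).

Lemma pairs_bound m n : (m <= n)%N ->
  Ex (@pairs m n) <= pairs_const * (al ^+ (2 * n) / al ^+ m).
Proof.
have a1 := alphabar_gt1 R; have a0 := alphabar_gt0 R.
have aa : 0 < al ^+ 2 - al by rewrite subr_gt0 expr2 -[ltLHS]mulr1 ltr_pM2l.
set E := 2304 / (al ^+ 2 - al).
have E0 : 0 <= E by apply: divr_ge0; [exact: ler0n | exact: ltW].
have EE : E * al ^+ 2 - 2304 = E * al.
  apply/eqP; rewrite subr_eq addrC -subr_eq -mulrBr /E mulfVK //.
  by rewrite gt_eqF.
have pE : pairs_const = 16 + E by [].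
clearbody E; move=> mn; rewrite -(subnKC mn); move: (n - m)%N => k.
(* The exact solution of x_{k+1} = al^2 x_k + 2304 al^(m+k) with x_0 = 16 al^m; here 2304 = 576 * 4
   by [Ex_hsg], and [E] solves E (al^2 - al) = 2304. *)
suff h : Ex (@pairs m (m + k)) <= pairs_const * al ^+ (m + 2 * k) - E * al ^+ (m + k).
  apply: (le_trans h); rewrite lerBlDr -[leLHS]addr0 lerD ?mulr_ge0 ?exprn_ge0 ?(ltW a0) //.
  rewrite (_ : (2 * (m + k) = m + 2 * k + m)%N); last by rewrite mulnDr mul2n -addnn addnAC.
  by rewrite [X in _ <= _ * (X / _)]exprD mulfK ?lexx // expf_neq0 // gt_eqF.
elim: k => [|k IH].
  rewrite muln0 !addn0; apply: (@le_trans _ _ (Ex (fun t : sub R m => 4 * stat (hsg R) t))).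
    by apply: ExLe => t tt; exact: pairs_diag.
  rewrite ExZ pE (_ : (16 + E) * al ^+ m - E * al ^+ m = 16 * al ^+ m); last by ring.
  have := Ex_hsg T_meas T_unif_tree T_unif_nontree T_consistent m.
  by move: (Ex _) (al ^+ m) => x y; lra.
rewrite addnS; apply: le_trans (pairs_step (leq_addr k m)) _.
rewrite ExD !ExZ; have := Ex_hsg T_meas T_unif_tree T_unif_nontree T_consistent (m + k).
have := ler_wpM2l (exprn_ge0 2 (ltW a0)) IH.
rewrite (_ : m + 2 * k.+1 = (m + 2 * k).+2)%N; last by rewrite mulnS addnCA.
rewrite !exprS; move: EE; rewrite expr2; move: (Ex _) (Ex _) => X Y.
move: (al ^+ (m + 2 * k)) (al ^+ (m + k)) => u v EE h1 h2.
have e : al * al * (pairs_const * u - E * v) + 2304 * v =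
  pairs_const * (al * (al * u)) - (E * (al * al) - 2304) * v by ring.
apply: (@le_trans _ _ (al * al * (pairs_const * u - E * v) + 2304 * v)).
  by move: h1 h2; rewrite expr0 mulr1; lra.
by rewrite e EE; lra.
Qed.

End SecondMoments.

(** * The two kinds of exceptional events *)

Section NullEvents.
Local Open Scope classical_set_scope.
Local Open Scope ring_scope.
Variables (R : realType) (d : measure_display) (Omega : measurableType d).
Variables (P : probability Omega R).

Lemma expr43_ge k : k%:R / 3 <= (4 / 3) ^+ k :> R.
Proof.
suff : 1 + k%:R / 3 <= (4 / 3) ^+ k :> R by lra.
elim: k => [|k IH]; first by rewrite mul0r addr0.
have k0 : 0 <= k%:R :> R by [].
rewrite exprS -natr1; move: ((4 / 3) ^+ k) (k%:R) IH k0 => x y; lra.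
Qed.

(** The sets where [A m n] holds for all n past N increase with N, so their union obeys the same
    bound as the [A m n]. The event lies in every [Z m], whose probability decays in m. *)
Lemma negligible_decay (A : nat -> nat -> set Omega) (B : nat -> set Omega) (c : R) (m0 : nat) :
  (forall m n, measurable (A m n)) -> (forall m, measurable (B m)) ->
  (forall m n, (m <= n)%N -> (m0 <= m)%N -> (P (A m n) <= (c / (4 / 3) ^+ (m - m0))%:E)%E) ->
  (forall m, (m0 <= m)%N -> (P (B m) <= (c / (4 / 3) ^+ (m - m0))%:E)%E) ->
  P.-negligible [set w | forall m, (m0 <= m)%N ->
     (exists N, forall n, (N <= n)%N -> A m n w) \/ B m w].
Proof.
move=> mA mB PA PB.
pose U m N := \bigcap_(n in [set n | (N <= n)%N]) A m n.
pose Z m := (\bigcup_N U m N) `|` B m.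
have mU m N : measurable (U m N) by apply: bigcap_measurable => [|n _]; [exists N => /= | exact: mA].
have mUU m : measurable (\bigcup_N U m N) by apply: bigcup_measurable => n _.
have mZ m : measurable (Z m) by exact: measurableU.
pose ZZ := \bigcap_(m in [set m | (m0 <= m)%N]) Z m.
have mZZ : measurable ZZ by apply: bigcap_measurable => [|n _]; [exists m0 => /= | exact: mZ].
exists ZZ; split=> //; last first.
  move=> w /= h m /h [[N hN]|Bw]; [left|by right].
  by exists N => // n Nn; exact: hN.
have PU m : (m0 <= m)%N -> (P (\bigcup_N U m N) <= (c / (4 / 3) ^+ (m - m0))%:E)%E.
  move=> m0m; have cv : (P \o U m) x @[x --> \oo] --> P (\bigcup_N U m N).
    apply: nondecreasing_cvg_mu => //.
    move=> N N' NN'; apply/subsetPset => w h n N'n; apply: h.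
    exact: leq_trans NN' N'n.
  rewrite -(cvg_lim _ cv) //; apply: lime_le; first by apply/cvg_ex; eexists; exact: cv.
  near=> N => /=; apply: (@le_trans _ _ (P (A m (maxn m N)))).
    by apply: le_measure; rewrite ?inE // => w; apply; rewrite /= leq_maxr.
  by apply: PA => //; rewrite leq_maxl.
have PZ m : (m0 <= m)%N -> (P ZZ <= (2 * c / (4 / 3) ^+ (m - m0))%:E)%E.
  move=> m0m; apply: (@le_trans _ _ (P (Z m))).
    by apply: le_measure; rewrite ?inE // => w; exact.
  apply: (le_trans (measureU2 _ (mUU m) (mB m))).
  by rewrite -mulrA mulr_natl mulr2n EFinD leeD ?PU ?PB.
apply/eqP; rewrite eq_le measure_ge0 andbT.
have fP : P ZZ \is a fin_num by rewrite fin_num_measure.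
rewrite -(fineK fP) lee_fin leNgt; apply/negP => r0.
have c0 : 0 <= c.
  by have := PB m0 (leqnn _); rewrite subnn expr0 divr1 => /(le_trans (measure_ge0 _ _)); rewrite lee_fin.
(* With (4/3)^k at least k/3, this [k] makes 2 c / (4/3)^k smaller than the supposedly positive
   [P ZZ]. *)
pose k := (Num.truncn (6 * c / fine (P ZZ))).+1.
have kk : 6 * c / fine (P ZZ) < k%:R by rewrite truncnS_gt.
clearbody k; have h := expr43_ge k.
have := PZ (m0 + k)%N (leq_addr _ _); rewrite addKn -(fineK fP) lee_fin leNgt.
apply/negP; rewrite negbK ltr_pdivrMr ?exprn_gt0 ?divr_gt0 //.
have : 6 * c < k%:R * fine (P ZZ) by rewrite -ltr_pdivrMr.
have : k%:R / 3 * fine (P ZZ) <= (4 / 3) ^+ k * fine (P ZZ) by rewrite ler_wpM2r // ltW.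
by move: (_ ^+ _) (k%:R) (fine _) => x y z; lra.
Unshelve. all: by end_near.
Qed.

Variable (T : forall n : nat, Omega -> sub R n).
Hypothesis T_meas : forall (n : nat) (t : sub R n), measurable [set w | T n w = t].
Hypothesis T_unif_tree : forall (n : nat) (t : sub R n), stree t ->
  P [set w | T n w = t] = ((num_trees R n)%:R^-1)%:E.
Hypothesis T_unif_nontree : forall (n : nat) (t : sub R n), ~ stree t ->
  P [set w | T n w = t] = 0%E.
Hypothesis T_consistent : forall (n : nat) (w : Omega), Tr_is (T n.+1 w) (T n w).
Local Notation al := (alphabar R).

(** Steps are counted rather than passes, because the curve spends equal times on edges;
    [eps * al ^+ n] steps take the time [eps] after rescaling. *)
Definition occ m n (f : sub R n) w : nat :=
  \sum_(p <- code n (cfg f) | take m p.1.1 == w) size (seg (cfg f p.1.1) p.1.2 p.2).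
Definition crowded (eps : R) m n (f : sub R n) : Prop :=
  exists w, eps * al ^+ n <= (occ m f w)%:R.
(** Repeating a letter leads to the level-n cell at that corner of the level-m ancestor; the pass
    neither enters nor exits at this corner. *)
Definition stay m n (f : sub R n) : Prop :=
  exists2 p, p \in code n (cfg f) & drop m p.1.1 = nseq (n - m) (thd p.1.2 p.2).

Lemma pairs_ge0 m n (f : sub R n) : 0 <= pairs m f.
Proof.
by do 2!apply: sumr_ge0 => ? _; rewrite !mulr_ge0 ?hsg_ge0 // same_ge0.
Qed.

(** A pass has at most two steps and weight at least 1/4, so steps number at most 8 times the
    weight; 64 is the square of 8. *)
Lemma occ_sq_le m n (f : sub R n) w : (occ m f w)%:R ^+ 2 <= 64 * pairs m f.
Proof.
pose S := \sum_(p <- code n (cfg f) | take m p.1.1 == w) hsg R p (cfg f p.1.1).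
have S0 : 0 <= S by apply: sumr_ge0 => p _; exact: hsg_ge0.
have oS : (occ m f w)%:R <= 8 * S.
  rewrite /occ natr_sum mulr_sumr; apply: ler_sum => p _.
  have : (size (seg (cfg f p.1.1) p.1.2 p.2))%:R <= 2 :> R.
    by rewrite ler_nat /seg; case: ifP.
  by have : 4^-1 <= hsg R p (cfg f p.1.1) := hk_ge _ _; lra.
apply: (@le_trans _ _ ((8 * S) ^+ 2)); first by rewrite lerXn2r ?nnegrE ?mulr_ge0.
rewrite exprMn (_ : 8 ^+ 2 = 64); last by rewrite -natrX.
rewrite ler_pM2l // expr2 {1}/S mulr_suml /pairs big_mkcond /=.
apply: ler_sum => p _; rewrite /S mulr_sumr; case: eqP => [pw|_]; last first.
  by apply: sumr_ge0 => p' _; rewrite !mulr_ge0 ?hsg_ge0 // same_ge0.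
rewrite big_mkcond; apply: ler_sum => p' _; rewrite /same pw eq_sym.
by case: eqP => _; rewrite ?mul1r ?mul0r.
Qed.

(** Markov's inequality for [pairs], which already sums over the level-m cells and so handles all of
    them at once. *)
Lemma prob_crowded eps m n : 0 < eps -> (m <= n)%N ->
  (P [set w | `[< crowded eps m (T n w) >]] <=
    (64 * pairs_const R / eps ^+ 2 / al ^+ m)%:E)%E.
Proof.
move=> e0 mn; have a0 := alphabar_gt0 R.
pose K : R := 64 / (eps * al ^+ n) ^+ 2.
have ea0 : 0 < eps * al ^+ n by rewrite mulr_gt0 ?exprn_gt0.
apply: (@le_trans _ _ (Ex (fun t : sub R n => K * pairs m t))%:E).
  apply: (prob_le_Ex T_meas T_unif_tree T_unif_nontree (A := fun t => `[< crowded eps m t >])).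
    by move=> t _; rewrite mulr_ge0 ?pairs_ge0 // divr_ge0 ?exprn_ge0 ?ltW.
  move=> t _ /asboolP[w hw]; rewrite /K mulrAC ler_pdivlMr ?exprn_gt0 // mul1r.
  by apply: le_trans (occ_sq_le m t w); rewrite lerXn2r ?nnegrE ?ler0n ?(ltW ea0).
rewrite lee_fin ExZ.
apply: (@le_trans _ _ (K * (pairs_const R * (al ^+ (2 * n) / al ^+ m)))).
  apply: ler_wpM2l; first by rewrite divr_ge0 ?exprn_ge0 ?(ltW ea0).
  exact: (pairs_bound T_meas T_unif_tree T_unif_nontree T_consistent mn).
rewrite /K le_eqVlt; apply/orP; left; apply/eqP.
rewrite exprMn -exprM mulnC; field.
by rewrite !expf_neq0 ?gt_eqF.
Qed.

(* Nonzero on the passes that miss the corner at which their cell sits in its level-m ancestor. *)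
Definition staysg m k p (q : st) : R :=
  if drop m p.1.1 == nseq k (thd p.1.2 p.2) then vk R (kind q p.1.2 p.2) else 0.

Lemma staysg_ge0 m k p q : 0 <= staysg m k p q.
Proof. by rewrite /staysg; case: ifP => // _; apply: le_trans (vk_ge _ _); rewrite invr_ge0. Qed.

(** At [k = 0], [vk] is at most 1, hence at most 4 times [hk], and [Ex_hsg] gives 16; every further
    level gains 1/2 by [sum_fibre_vk]. *)
Lemma Ex_stay m k : Ex (@stat R (staysg m k) (m + k)) <= 16 * al ^+ m / 2 ^+ k.
Proof.
elim: k => [|k IH].
  rewrite addn0 expr0 divr1; apply: (@le_trans _ _ (Ex (fun t : sub R m => 4 * stat (hsg R) t))).
    apply: (Ex_le T_meas T_unif_tree T_unif_nontree) => t _; rewrite /stat mulr_sumr.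
    apply: ler_sum => p _; have : 4^-1 <= hsg R p (cfg t p.1.1) := hk_ge _ _.
    rewrite /staysg; case: ifP => _; last lra.
    by have := vk_le1 R (kind (cfg t p.1.1) p.1.2 p.2); lra.
  rewrite ExZ; have := Ex_hsg T_meas T_unif_tree T_unif_nontree T_consistent m.
  by move: (Ex _) (al ^+ m) => x y; lra.
rewrite addnS; apply: (@le_trans _ _ (Ex (@stat R (fun p q => 2^-1 * staysg m k p q) (m + k)))).
  apply: (linear_step T_meas T_unif_tree T_unif_nontree T_consistent) => p q sp ab cp q3.
  apply: (@le_trans _ _ (if drop m p.1.1 == nseq k (thd p.1.2 p.2) then
     \sum_(g in fibre q) \sum_(s <- lcode g p.1.2 p.2 | s.1.1 == thd s.1.2 s.2)
       vk R (kind (sel g s.1.1) s.1.2 s.2) else 0)); last first.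
    rewrite /staysg; case: ifP => _; first exact: sum_fibre_vk.
    by rewrite !mulr0.
  apply: (@le_trans _ _ (\sum_(g in fibre q) if drop m p.1.1 == nseq k (thd p.1.2 p.2) then
     \sum_(s <- lcode g p.1.2 p.2 | s.1.1 == thd s.1.2 s.2)
       vk R (kind (sel g s.1.1) s.1.2 s.2) else 0)); last by case: ifP => // _; rewrite big1_eq.
  apply: ler_sum => g; rewrite inE => /andP[vg /eqP tg].
  have [_ _ _ /allP stays] := lcode_ok R vg ab (etrans (congr1 (fun q => conn0 q _ _) tg) cp).
  have sub_ s : s \in lcode g p.1.2 p.2 -> staysg m k.+1 (child p s) (sel g s.1.1) <=
      if drop m p.1.1 == nseq k (thd p.1.2 p.2) then
        if s.1.1 == thd s.1.2 s.2 then vk R (kind (sel g s.1.1) s.1.2 s.2) else 0 else 0.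
    move=> sl; rewrite /staysg /child /=.
    have -> : drop m (rcons p.1.1 s.1.1) = rcons (drop m p.1.1) s.1.1.
      by rewrite drop_rcons // sp leq_addr.
    have -> : thd s.1.2 s.2 :: nseq k (thd s.1.2 s.2) = rcons (nseq k (thd s.1.2 s.2)) (thd s.1.2 s.2).
      by elim: (k) => //= j <-.
    rewrite eqseq_rcons; case: eqP => [D|_] /=; last first.
      case: ifP => // _; case: ifP => // _.
      by apply: le_trans (vk_ge _ _); rewrite invr_ge0.
    case: (boolP (_ == thd s.1.2 s.2)) => [/eqP sd|_]; last by case: ifP.
    (* The inheritance clause of [chkcode]: a child counted here has a parent that misses the same
       corner, so the condition on the parent holds. *)
    have /implyP/(_ (introT eqP sd))/eqP e := stays s sl.
    by rewrite D -sd e eqxx.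
  rewrite /loc big_seq; apply: (@le_trans _ _ (\sum_(s <- lcode g p.1.2 p.2)
     if drop m p.1.1 == nseq k (thd p.1.2 p.2) then
        if s.1.1 == thd s.1.2 s.2 then vk R (kind (sel g s.1.1) s.1.2 s.2) else 0 else 0)).
    by rewrite [leRHS]big_seq; exact: ler_sum.
  by case: ifP => _; rewrite ?big1_eq // -big_mkcond.
have -> : Ex (@stat R (fun p q => 2^-1 * staysg m k p q) (m + k)) =
    2^-1 * Ex (@stat R (staysg m k) (m + k)).
  rewrite -ExZ /Ex; congr (_ * _); apply: eq_bigr => t _.
  by rewrite /stat mulr_sumr.
rewrite exprS invfM; move: IH; move: (Ex _) (al ^+ m) => X y.
by move: ((2 ^+ k)^-1) => z; lra.
Qed.

Lemma prob_stay m n : (m <= n)%N ->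
  (P [set w | `[< stay m (T n w) >]] <= (64 * al ^+ m / 2 ^+ (n - m))%:E)%E.
Proof.
move=> mn; move: (subnKC mn) => {mn}; move: (n - m)%N => k e; subst n.
apply: (@le_trans _ _ (Ex (fun t : sub R (m + k) => 4 * stat (staysg m k) t))%:E).
  apply: (prob_le_Ex T_meas T_unif_tree T_unif_nontree (A := fun t => `[< stay m t >])).
    by move=> t _; rewrite mulr_ge0 // sumr_ge0 // => p _; exact: staysg_ge0.
  move=> t tt /asboolP[p pC]; rewrite addKn => dp.
  have uC := code_uniq T_meas T_unif_tree T_unif_nontree T_consistent tt.
  rewrite /stat (bigD1_seq p) //= mulrDr ler_wpDr ?mulr_ge0 ?sumr_ge0 // => [p' _|].
    exact: staysg_ge0.
  by rewrite /staysg dp eqxx; have := vk_ge R (kind (cfg t p.1.1) p.1.2 p.2); lra.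
rewrite lee_fin ExZ; have := Ex_stay m k.
by move: (Ex _) (al ^+ m) (2 ^+ k) => x y z; lra.
Qed.

(** The base 4/3 is a common lower bound for the decay rates [alphabar] and 2 of the two
    alternatives. *)
Lemma null_event eps m0 : 0 < eps ->
  P.-negligible [set w | forall m, (m0 <= m)%N ->
     (exists N, forall n, (N <= n)%N -> crowded eps m (T n w)) \/ stay m0 (T m w)].
Proof.
move=> e0; have a0 := alphabar_gt0 R; have a1 := alphabar_gt1 R.
have D0 : 0 <= pairs_const R.
  have aa : 0 < al ^+ 2 - al by rewrite subr_gt0 expr2 -[ltLHS]mulr1 ltr_pM2l.
  by rewrite addr_ge0 ?divr_ge0 ?ler0n // ltW.
pose c1 := 64 * pairs_const R / eps ^+ 2; pose c2 := 64 * al ^+ m0.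
have c10 : 0 <= c1 by apply: divr_ge0; [exact: mulr_ge0 | exact: exprn_ge0 (ltW e0)].
have c20 : 0 <= c2 by apply: mulr_ge0 => //; exact: exprn_ge0 (ltW a0).
have al43 : 4 / 3 <= al by rewrite /alphabar lerDl divr_ge0 ?sqrtr_ge0.
have := @negligible_decay (fun m n => [set w | `[< crowded eps m (T n w) >]])
  (fun m => [set w | `[< stay m0 (T m w) >]]) (c1 + c2) m0.
have mA m n : measurable [set w | `[< crowded eps m (T n w) >]].
  exact: (level_measurable (@T_meas n) (fun t => `[< crowded eps m t >])).
have mB m : measurable [set w | `[< stay m0 (T m w) >]].
  exact: (level_measurable (@T_meas m) (fun t => `[< stay m0 t >])).
move=> /(_ mA mB) H; apply: negligibleS (H _ _).
- move=> w /= h m /h [[N hN]|hs]; [left|by right; exact/asboolP].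
  by exists N => n /hN hn; exact/asboolP.
- move=> m n mn m0m; apply: (le_trans (prob_crowded e0 mn)).
  rewrite lee_fin -/c1; apply: (@le_trans _ _ (c1 / (4 / 3) ^+ (m - m0))).
    rewrite ler_wpM2l // lef_pV2 ?posrE ?exprn_gt0 ?divr_gt0 //.
    apply: (@le_trans _ _ (al ^+ (m - m0))); first by rewrite lerXn2r ?nnegrE ?divr_ge0 ?(ltW a0).
    by rewrite ler_eXn2l // leq_subr.
  by rewrite ler_wpM2r ?invr_ge0 ?exprn_ge0 ?divr_ge0 // lerDl.
move=> m m0m; apply: (le_trans (prob_stay m0m)).
rewrite lee_fin -/c2; apply: (@le_trans _ _ (c2 / (4 / 3) ^+ (m - m0))).
  rewrite ler_wpM2l // lef_pV2 ?posrE ?exprn_gt0 ?divr_gt0 //.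
  by rewrite lerXn2r ?nnegrE ?divr_ge0 //; lra.
by rewrite ler_wpM2r ?invr_ge0 ?exprn_ge0 ?divr_ge0 // lerDr.
Qed.

End NullEvents.

(** * The limit curve *)

Section Replicate.
Variables (S T : eqType) (r : rel T) (f : S -> T) (c : S -> nat).
Hypothesis r_refl : reflexive r.

Definition replicate (l : seq S) : seq T := flatten [seq nseq (c e) (f e) | e <- l].

Lemma mem_replicate l x : x \in replicate l -> x \in map f l.
Proof.
case/flatten_mapP => e el /nseqP[-> _]; exact: map_f.
Qed.

Lemma pairwise_replicate l : pairwise r (map f l) -> pairwise r (replicate l).
Proof.
elim: l => //= e l IH /andP[h /IH h']; rewrite /replicate /= -/(replicate l).
rewrite pairwise_cat h' andbT; apply/andP; split.
  apply/allrelP => x y /nseqP[-> _] /mem_replicate/(allP h); exact.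
by elim: (c e) => //= n ->; rewrite andbT; apply/allP => x /nseqP[-> _].
Qed.

Lemma count_replicate (a : pred T) l :
  count a (replicate l) = \sum_(e <- l | a (f e)) c e.
Proof.
elim: l => [|e l IH]; first by rewrite big_nil.
rewrite /replicate /= -/(replicate l) count_cat IH big_cons count_nseq.
by case: (a (f e)); rewrite ?mul1n ?mul0n.
Qed.

End Replicate.

Section Limit.
Local Open Scope classical_set_scope.
Local Open Scope ring_scope.
Variables (R : realType) (t : forall n : nat, sub R n).
Hypothesis t_tree : forall n, stree (t n).
Hypothesis t_Tr : forall n, Tr_is (t n.+1) (t n).
Local Notation al := (alphabar R).
Local Notation U := (u R).
Local Notation cf n := (cfg (t n)).
Local Notation CD n := (code n (cf n)).
Local Notation words m := [seq p.1.1 | p <- CD m].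
Implicit Types (v w : seq 'I_3) (x y : pt R).

Let tree_cf n : tree_cfg n (cf n).
Proof. exact: cfg_chain. Qed.

Lemma code_step n : CD n.+1 = refine (cf n.+1) (CD n).
Proof. by rewrite /=; congr refine; apply: code_ext => w sw; rewrite (Tr_is_trc (t_tree _) (@t_Tr n)). Qed.

Definition nsteps n p : nat := size (seg (cf n p.1.1) p.1.2 p.2).
(** Entry k is the level-m cell of the edge from vertex k to vertex k+1 of [upath]. *)
Definition cells m n : seq (seq 'I_3) := replicate (fun p : pass => take m p.1.1) (nsteps n) (CD n).

Definition before m v w : bool := (index v (words m) <= index w (words m))%N.

Lemma before_refl m : reflexive (before m).
Proof. by move=> v; exact: leqnn. Qed.

Lemma words_uniq m : uniq (words m).
Proof. by have [] := code_ok R (tree_cf m). Qed.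

Lemma size_word m w : w \in words m -> size w = m.
Proof. by case/mapP => p /code_size sp ->. Qed.

Lemma words_before m : pairwise (before m) (words m).
Proof.
apply/(pairwiseP [::]) => i j /= ik jk ij.
by rewrite /before !index_uniq ?words_uniq // ltnW.
Qed.

(** Refinement replaces a pass by passes inside the same cell, so the order of the level-m ancestors
    persists and each is visited in one block. *)
Lemma coarse_before m n : (m <= n)%N ->
  pairwise (before m) [seq take m p.1.1 | p <- CD n] /\
  {subset [seq take m p.1.1 | p <- CD n] <= words m}.
Proof.
move=> mn; rewrite -(subnKC mn); elim: (n - m)%N => [|k [IH1 IH2]].
  have -> : [seq take m p.1.1 | p <- CD (m + 0)] = words (m + 0).
    by rewrite addn0; apply/eq_in_map => p /code_size sp; rewrite take_oversize ?sp.
  by rewrite addn0; split=> //; exact: words_before.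
rewrite addnS code_step.
have -> : [seq take m p.1.1 | p <- refine (cf (m + k).+1) (CD (m + k))] =
  replicate (fun p : pass => take m p.1.1)
    (fun p => size (lcode (lcfg (cf (m + k).+1) p.1.1) p.1.2 p.2)) (CD (m + k)).
  rewrite /refine map_flatten -map_comp /replicate; congr flatten.
  apply/eq_in_map => p /code_size sp; rewrite /refine1 /= -map_comp.
  elim: (lcode _ _ _) => //= s l ->; congr cons.
  by rewrite take_rcons_le ?sp ?leq_addr.
split; first by apply: pairwise_replicate => //; exact: before_refl.
by move=> w /mem_replicate/IH2.
Qed.

Lemma cells_before m n : (m <= n)%N ->
  pairwise (before m) (cells m n) /\ {subset cells m n <= words m}.
Proof.
move=> /coarse_before[h1 h2]; split.
  by apply: pairwise_replicate => //; exact: before_refl.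
by move=> w /mem_replicate/h2.
Qed.

Lemma count_cells m n w : count_mem w (cells m n) = occ m (t n) w.
Proof. exact: count_replicate. Qed.

Lemma size_pts n : size (pts R (cf n) (CD n)) = size (cells n n).
Proof.
rewrite /pts /cells /replicate !size_flatten /shape -!map_comp; congr sumn.
by apply: eq_map => p /=; rewrite size_map size_nseq.
Qed.

Lemma size_cells m n : size (cells m n) = size (cells n n).
Proof.
rewrite /cells /replicate !size_flatten /shape -!map_comp; congr sumn.
by apply: eq_map => p /=; rewrite !size_nseq.
Qed.

Lemma incell_corner w a : incell w (psiw w (U a)).
Proof. by exists (U a) => //; exact: tri_u. Qed.

Lemma incell_take m w x : incell w x -> incell (take m w) x.
Proof. by rewrite -{1}(cat_take_drop m w); exact: incell_cat. Qed.

Lemma step_in_cell_code m n x y C k : chain x y C ->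
  let V := replicate (fun p : pass => take m p.1.1) (nsteps n) C in
  let q := x :: pts R (cf n) C in (k < size V)%N ->
  incell (nth [::] V k) (nth (u1 R) q k) /\ incell (nth [::] V k) (nth (u1 R) q k.+1).
Proof.
elim: C x k => // p C IH x k [-> ch].
have inc a : incell (take m p.1.1) (psiw p.1.1 (U a)) by exact/incell_take/incell_corner.
rewrite /replicate /= -/(replicate _ _ C) /pts /= -/(pts R _ C) /pseg /nsteps /seg.
rewrite -/(nsteps n); case: (hasE _ _ _) => /=; first by case: k => [|k] /=; [split|exact: IH].
by case: k => [|[|k]] /=; [split|split|exact: IH].
Qed.

Lemma step_in_cell m n k : (k < size (cells m n))%N ->
  incell (nth [::] (cells m n) k) (nth (u1 R) (upath (t n)) k) /\
  incell (nth [::] (cells m n) k) (nth (u1 R) (upath (t n)) k.+1).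
Proof.
rewrite upath_code //; have [_ _] := code_ok R (tree_cf n); exact: step_in_cell_code.
Qed.

Lemma size_upath n : size (upath (t n)) = (size (cells n n)).+1.
Proof. by rewrite upath_code //= size_pts. Qed.

Lemma last_upath n : nth (u1 R) (upath (t n)) (size (cells n n)) = u2 R.
Proof.
have [_ _ ch] := code_ok R (tree_cf n).
by rewrite upath_code // -size_pts -last_nth; exact: last_pts.
Qed.

Definition endcell m : seq 'I_3 := nseq m o1.

Lemma incell_endcell m : incell (endcell m) (u2 R).
Proof. by rewrite (_ : u2 R = U o1) // -(psiw_u R m o1); exact: incell_corner. Qed.

Lemma incell_u2 m w : size w = m -> incell w (u2 R) -> w = endcell m.
Proof.
by move=> <- [y ty]; rewrite (_ : u2 R = U o1) // => /esym/(psiw_corner ty)[].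
Qed.

Lemma chain_last x y p C : chain x y (rcons C p) -> y = psiw p.1.1 (U p.2).
Proof. by elim: C x => [|p' C IH] x /= [_]; [move=> <-|exact: IH]. Qed.

Lemma words_last m : exists V, words m = rcons V (endcell m).
Proof.
have := @code_size m (cf m); have [_ _] := code_ok R (tree_cf m).
case/lastP: (CD m) => [|C p].
  by move=> /(congr1 fst) /= /eqP; rewrite eq_sym oner_eq0.
move=> /chain_last e h; exists [seq p.1.1 | p <- C]; rewrite map_rcons; congr rcons.
apply: incell_u2; first by apply: h; rewrite mem_rcons mem_head.
by rewrite e; exact: incell_corner.
Qed.

Lemma before_end m v : v \in words m -> before m v (endcell m).
Proof.
have [V e] := words_last m; rewrite /before e => vw.
have := words_uniq m; rewrite e rcons_uniq => /andP[nV _].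
by rewrite -[in leqRHS]cats1 index_cat (negbTE nV) /= eqxx addn0 -ltnS -(size_rcons V (endcell m)) index_mem.
Qed.

Lemma end_before m v : v \in words m -> before m (endcell m) v -> v = endcell m.
Proof.
move=> vw ev; have ve := before_end vw.
have ew : endcell m \in words m by have [V ->] := words_last m; rewrite mem_rcons mem_head.
have ie : index v (words m) = index (endcell m) (words m).
  by apply/eqP; rewrite eqn_leq; apply/andP; split.
by rewrite -[LHS](nth_index [::] vw) ie nth_index.
Qed.

Definition stepno n (r : R) : nat := Num.truncn (al ^+ n * r).
(** The default covers times after the last step, when the path rests at u_2. *)
Definition cell_at m n (r : R) : seq 'I_3 := nth (endcell m) (cells m n) (stepno n r).

Lemma cell_at_word m n r : (m <= n)%N -> cell_at m n r \in words m.
Proof.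
move=> mn; rewrite /cell_at; case: (ltnP (stepno n r) (size (cells m n))) => h.
  by apply: (proj2 (cells_before mn)); rewrite mem_nth.
by rewrite nth_default //; have [V ->] := words_last m; rewrite mem_rcons mem_head.
Qed.

Lemma stepno_le n r r' : 0 <= r -> r <= r' -> (stepno n r <= stepno n r')%N.
Proof.
move=> r0 rr'; apply: Num.Theory.le_truncn.
by rewrite ler_wpM2l // exprn_ge0 // ltW // alphabar_gt0.
Qed.

Lemma cell_at_mono m n r r' : (m <= n)%N -> 0 <= r -> r <= r' ->
  before m (cell_at m n r) (cell_at m n r').
Proof.
move=> mn r0 rr'; have kk := stepno_le n r0 rr'.
case: (ltnP (stepno n r') (size (cells m n))) => h'; last first.
  by rewrite /before {2}/cell_at nth_default //; apply: before_end; exact: cell_at_word.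
rewrite /cell_at; have h := leq_ltn_trans kk h'.
move: kk; rewrite leq_eqVlt => /orP[/eqP ->|kk]; first exact: before_refl.
have /(pairwiseP (endcell m)) := proj1 (cells_before mn).
by apply.
Qed.

Lemma Xn_incell m n r : (m <= n)%N -> 0 <= r -> incell (cell_at m n r) (Xn (t n) r).
Proof.
move=> mn r0; rewrite /Xn /LI size_upath /= -/(stepno n r) /cell_at.
case: ifP => h; last first.
  by rewrite last_upath nth_default ?size_cells 1?leqNgt ?h //; exact: incell_endcell.
have h' : (stepno n r < size (cells m n))%N by rewrite size_cells.
have [h1 h2] := step_in_cell h'; rewrite (set_nth_default [::]) //.
have a0 : 0 <= al ^+ n * r by rewrite mulr_ge0 // exprn_ge0 // ltW // alphabar_gt0.
have e : al ^+ n * r - (stepno n r)%:R = 1 - ((stepno n r).+1%:R - al ^+ n * r).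
  by rewrite -natr1; ring.
rewrite e; apply: incell_convex => //.
have /andP[k1 k2] := truncn_itv a0.
by move: k1 k2; rewrite -/(stepno n r) -natr1 => k1 k2; apply/andP; split; lra.
Qed.

Lemma Xn_end n r : (size (cells n n) <= stepno n r)%N -> Xn (t n) r = u2 R.
Proof. by move=> h; rewrite /Xn /LI size_upath /= -/(stepno n r) ltnNge h /= last_upath. Qed.

Lemma count_window (T : eqType) (a b d : T) (V : seq T) i j :
  (i <= j)%N -> (j < size V)%N ->
  (forall k, (i <= k <= j)%N -> nth d V k = a \/ nth d V k = b) ->
  (j.+1 - i <= count_mem a V + count_mem b V)%N.
Proof.
move=> ij jV h; pose V' := take (j.+1 - i) (drop i V).
have sV' : size V' = (j.+1 - i)%N by rewrite size_takel // size_drop leq_sub2r.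
have all' : all (predU (pred1 a) (pred1 b)) V'.
  apply/(all_nthP d) => k; rewrite sV' => kk; rewrite nth_take // nth_drop /=.
  have /h : (i <= i + k <= j)%N by rewrite leq_addr -ltnS -(subnKC (leqW ij)) ltn_add2l.
  by case=> ->; rewrite eqxx ?orbT.
have sub' : subseq V' V.
  by apply: (@subseq_trans _ (drop i V)); [exact: take_subseq | exact: drop_subseq].
rewrite -sV' -(eqP (etrans (esym (all_count _ _)) all')).
apply: (leq_trans (leq_count_subseq _ sub')).
by rewrite -count_predUI leq_addr.
Qed.

Variable X : R -> pt R.
Hypothesis X_lim : unif_cvg (fun n => Xn (t n)) X.

Lemma bc_cvg k r e : 0 <= r -> 0 < e -> exists N, forall n, (N <= n)%N ->
  `|bc k (Xn (t n) r) - bc k (X r)| < e.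
Proof.
move=> r0 e0; have [|N h] := X_lim (eps := e / 6); first by rewrite divr_gt0.
exists N => n /h/(_ r r0) hn; apply: le_lt_trans (bc_lip _ _ _) _.
by move: hn; move: (pdist _ _) => x; lra.
Qed.

Lemma leave_cell w r : 0 <= r -> ~ incell w (X r) -> exists N, forall n, (N <= n)%N ->
  ~ incell w (Xn (t n) r).
Proof.
move=> r0 /incellP/existsNP[k /negP]; rewrite -ltNge => hk.
have [|N h] := @bc_cvg k r (off R w k - bc k (X r)) r0; first by rewrite subr_gt0.
exists N => n /h hn /incellP/(_ k); apply/negP; rewrite -ltNge.
by move: hn; rewrite ltr_norml => /andP[_]; rewrite ltrBlDr subrK.
Qed.

Lemma leave_cells m r : 0 <= r -> exists N, forall n w, (N <= n)%N -> size w = m ->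
  incell w (Xn (t n) r) -> incell w (X r).
Proof.
move=> r0.
have /choice[N hN] : forall w : m.-tuple 'I_3, exists N, forall n, (N <= n)%N ->
    incell w (Xn (t n) r) -> incell w (X r).
  move=> w; have [i|ni] := pselect (incell w (X r)); first by exists 0%N.
  by have [N h] := leave_cell r0 ni; exists N => n /h.
exists (\max_w N w) => n w Nn sw; rewrite -(val_tup sw); apply: hN.
exact: leq_trans (leq_bigmax _) Nn.
Qed.

(** Cells are closed and finite in number at each level, so for large n the point X_n(r) avoids all
    those not containing X(r). *)
Lemma cell_at_limit m r : 0 <= r -> exists N, forall n, (N <= n)%N -> (m <= n)%N ->
  incell (cell_at m n r) (X r).
Proof.
move=> r0; have [N h] := leave_cells m r0; exists N => n Nn mn.
apply: (h n) => //; last exact: Xn_incell.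
exact/size_word/cell_at_word.
Qed.

(** Only [endcell m] contains u_2 among the cells of level m, and it comes last in the order; so the
    later point lies in it for every m, and these cells shrink to u_2. *)
Lemma stay_u2 r r' : 0 <= r -> r <= r' -> X r = u2 R -> X r' = u2 R.
Proof.
move=> r0 rr' Xr; have r'0 := le_trans r0 rr'.
have ends m : incell (endcell m) (X r').
  have [N1 h1] := cell_at_limit m r0; have [N2 h2] := cell_at_limit m r'0.
  pose n := maxn (maxn N1 N2) m.
  have n1 : (N1 <= n)%N by rewrite !leq_max leqnn.
  have n2 : (N2 <= n)%N by rewrite !leq_max leqnn orbT.
  have mn : (m <= n)%N by rewrite leq_max leqnn orbT.
  have e1 : cell_at m n r = endcell m.
    apply: incell_u2; first exact/size_word/cell_at_word.
    by rewrite -Xr; exact: h1.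
  suff <- : cell_at m n r' = endcell m by exact: h2.
  apply: end_before; first exact: cell_at_word.
  by rewrite -e1; exact: cell_at_mono.
have tX : tri (X r') by move=> k; have /incellP/(_ k) := ends 0%N.
apply: (@bc1_u R o1) => //; apply/eqP; rewrite eq_le bc_le1 //= leNgt; apply/negP => lt1.
have d0 : 0 < 1 - bc o1 (X r') by rewrite subr_gt0.
pose k := (Num.truncn (3 / (1 - bc o1 (X r')))).+1.
have kk : 3 / (1 - bc o1 (X r')) < k%:R by rewrite truncnS_gt.
have /incellP/(_ o1) := ends k; rewrite off_nseq.
have k2 : (4 / 3) ^+ k <= 2 ^+ k :> R by rewrite lerXn2r ?nnegrE ?divr_ge0 //; lra.
have := expr43_ge R k; clearbody k => k1 h.
have p2 : 0 < 2 ^+ k :> R by rewrite exprn_gt0.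
have h2 : (1 - bc o1 (X r')) * 2 ^+ k <= 1 by rewrite -ler_pdivlMr // div1r; move: h; lra.
have h3 : (1 - bc o1 (X r')) * (k%:R / 3) <= (1 - bc o1 (X r')) * 2 ^+ k.
  by rewrite ler_wpM2l ?(ltW d0) //; exact: le_trans k1 k2.
move: kk; rewrite ltr_pdivrMr //.
by move: h2 h3; move: (1 - bc o1 (X r')) (2 ^+ k) (k%:R) => x y z; lra.
Qed.

Lemma chain_nth x y C i (d : pass) : chain x y C -> (i.+1 < size C)%N ->
  psiw (nth d C i).1.1 (U (nth d C i).2) = psiw (nth d C i.+1).1.1 (U (nth d C i.+1).1.2).
Proof.
elim: C x i => // p [//|p' C] IH x i [_ ch]; case: i => [|i] h; first by case: ch.
exact: (IH _ i ch).
Qed.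

(** Only entry and exit count: a pass along two edges may still run through [x] in the middle. *)
Definition misses m x : Prop := exists p c,
  [/\ p \in CD m, x = psiw p.1.1 (U c), p.1.2 != c & p.2 != c].

(** If the pass of [v] began or ended at [x], its neighbour in the code would contain [x] too. By
    the gap in the indices this neighbour is not [w], so three cells would meet at [x]. A first pass
    has no predecessor, but it starts at u_1, which lies in one cell only. *)
Lemma separated_misses m v w x : v \in words m -> w \in words m ->
  ((index v (words m)).+1 < index w (words m))%N -> incell v x -> incell w x -> misses m x.
Proof.
move=> vw ww ij vx wx; set i := index v _ in ij; set j := index w _ in ij.
have [oC _ ch] := code_ok R (tree_cf m).
have si : (i < size (words m))%N by rewrite index_mem.
have sj : (j < size (words m))%N by rewrite index_mem.
move: (si) (sj); rewrite size_map => ci cj.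
pose d : pass := ([::], o0, o0); pose p := nth d (CD m) i.
have pC : p \in CD m by rewrite mem_nth.
have wi l : (l < size (CD m))%N -> nth [::] (words m) l = (nth d (CD m) l).1.1.
  by move=> lC; rewrite (nth_map d).
have pv : p.1.1 = v by rewrite -wi // nth_index.
have nth_eq l l' : (l < size (words m))%N -> (l' < size (words m))%N ->
    nth [::] (words m) l = nth [::] (words m) l' -> l = l'.
  by move=> hl hl' /eqP; rewrite nth_uniq ?words_uniq // => /eqP.
have vwne : v != w by apply: contraTneq ij => e; rewrite /i /j e -leqNgt leqnSn.
have sv := size_word vw; have sw := size_word ww; have svw : size v = size w by rewrite sv sw.
case: (vx) => y ty xy; case: (wx) => z tz xz.
have [c [c' [yc zc']]] := psiw_meet svw vwne ty tz (etrans (esym xy) xz).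
(* at most two cells of a level contain x *)
have third l a : (l < size (words m))%N -> l != i -> l != j ->
    psiw (nth [::] (words m) l) (U a) <> x.
  move=> lw li lj e; have wl : nth [::] (words m) l \in words m by rewrite mem_nth.
  have := psiw_meet3 svw (etrans sv (esym (size_word wl))) ty tz (tri_u R a)
    (etrans (esym xy) xz) (etrans (esym xy) (esym e)).
  rewrite (negbTE vwne) /= => /orP[] /eqP e'.
    by move/eqP: li; apply; rewrite /i e' index_uniq ?words_uniq.
  by move/eqP: lj; apply; rewrite /j e' index_uniq ?words_uniq.
exists p, c; split=> //; first by rewrite pv xy yc.
  apply/eqP => pc; case: i @p ij si ci pC pv third pc => [|l] p ij si ci pC pv third pc.
    have : x = U o0.
      rewrite xy yc -pv -pc /p; move: ch ci; case: (CD m) => // p0 C /= [<-] _.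
      by [].
    rewrite xy => xo; have [ev _] := psiw_corner ty xo.
    have [ew _] := psiw_corner tz (etrans (esym (etrans (esym xy) xz)) xo).
    by move: vwne; rewrite ev ew svw eqxx.
  have lw : (l < size (words m))%N by apply: ltn_trans si.
  have lC : (l < size (CD m))%N by apply: ltn_trans ci.
  apply: (third l (nth d (CD m) l).2 lw).
  - by rewrite neq_ltn ltnSn.
  - by rewrite neq_ltn (ltn_trans _ (ltn_trans (ltnSn _) ij)).
  by rewrite wi // (chain_nth d ch ci) -/p pc pv xy yc.
apply/eqP => pc; have i1C : (i.+1 < size (CD m))%N by apply: ltn_trans ij _.
have i1w : (i.+1 < size (words m))%N by rewrite size_map.
apply: (third i.+1 (nth d (CD m) i.+1).1.2 i1w).
- by rewrite neq_ltn ltnSn orbT.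
- by rewrite neq_ltn ij.
by rewrite wi // -(chain_nth d ch i1C) -/p pc pv xy yc.
Qed.

(** From level m0, [x] is known to be a vertex; hence it is a corner of the level-m0 ancestor of the
    cell passed at level m, and [psiw_corner] makes the remaining letters constant. *)
Lemma misses_stay m0 m x : (m0 <= m)%N -> misses m0 x -> misses m x -> stay m0 (t m).
Proof.
move=> m0m [p0 [c0 [p0C x0 _ _]]] [p [c [pC xc ac bc_]]].
have sp := code_size pC; have sp0 := code_size p0C.
exists p => //; have -> : thd p.1.2 p.2 = c.
  have /allP/(_ p pC)/and3P[_ ab _] := (let: And3 h _ _ := code_ok R (tree_cf m) in h).
  have h := @all3P (fun a => all (fun b => all (fun c => [&& a != b, a != c & b != c] ==>
    (thd a b == c)) I3) I3) isT p.1.2.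
  by have := all3P (all3P h p.2) c; rewrite ab ac bc_ => /eqP.
have st : size (take m0 p.1.1) = m0 by rewrite size_takel ?sp.
have sd : size (drop m0 p.1.1) = (m - m0)%N by rewrite size_drop sp.
suff [e he] : exists e, psiw (drop m0 p.1.1) (U c) = U e.
  have [hd /u_inj ce] := psiw_corner (tri_u R c) he.
  by rewrite hd sd ce.
have e1 : psiw (take m0 p.1.1) (psiw (drop m0 p.1.1) (U c)) = psiw p0.1.1 (U c0).
  by rewrite -psiw_cat cat_take_drop -xc -x0.
have [e|ne] := eqVneq (take m0 p.1.1) p0.1.1.
  by exists c0; move: e1; rewrite e => /psiw_inj.
have [||e [e' [he _]]] := psiw_meet _ ne _ (tri_u R c0) e1.
- by rewrite st sp0.
- exact: tri_psiw (tri_u R c).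
by exists e.
Qed.

(** By monotonicity every step between the two times lies in [v] or [w]. There are at least
    [al ^+ n * (r' - r)] of them, and one of the two cells takes half. *)
Lemma crowded_between m n r r' : (m <= n)%N -> 0 <= r -> r < r' ->
  (stepno n r' < size (cells n n))%N ->
  (index (cell_at m n r') (words m) <= (index (cell_at m n r) (words m)).+1)%N ->
  crowded ((r' - r) / 2) m (t n).
Proof.
move=> mn r0 rr' h' idx; set v := cell_at m n r in idx; set w := cell_at m n r' in idx.
have kk := stepno_le n r0 (ltW rr').
have h : (stepno n r' < size (cells m n))%N by rewrite size_cells.
have vw : v \in words m by exact: cell_at_word.
have ww : w \in words m by exact: cell_at_word.
have := @count_window _ v w (endcell m) _ _ _ kk h.
have between k : (stepno n r <= k <= stepno n r')%N ->
    nth (endcell m) (cells m n) k = v \/ nth (endcell m) (cells m n) k = w.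
  move=> /andP[k1 k2]; have kC := leq_ltn_trans k2 h.
  have [/(pairwiseP (endcell m)) pw sub_] := cells_before mn.
  set z := nth _ _ k; have zw : z \in words m by apply: sub_; rewrite mem_nth.
  have mono k3 k4 : (k3 <= k4)%N -> (k4 < size (cells m n))%N ->
     before m (nth (endcell m) (cells m n) k3) (nth (endcell m) (cells m n) k4).
    move=> k34 k4C; move: k34; rewrite leq_eqVlt => /orP[/eqP ->|k34].
      exact: before_refl.
    by apply: pw => //; exact: ltn_trans k4C.
  have b1 : (index v (words m) <= index z (words m))%N by exact: mono.
  have b2 : (index z (words m) <= index w (words m))%N by exact: mono.
  have inj z' : z' \in words m -> index z (words m) = index z' (words m) -> z = z'.
    by move=> z'w e; rewrite -[LHS](nth_index [::] zw) e nth_index.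
  have [e|ne] := eqVneq (index z (words m)) (index v (words m)); first by left; exact: inj.
  right; apply: inj => //; apply/eqP; rewrite eqn_leq b2 /=; apply: leq_trans idx _.
  by rewrite ltn_neqAle eq_sym ne.
move=> /(_ between); rewrite !count_cells => cnt.
have a0 : 0 < al ^+ n by rewrite exprn_gt0 // alphabar_gt0.
have /andP[t1 _] := truncn_itv (mulr_ge0 (ltW a0) r0).
have /andP[_ t2] := truncn_itv (mulr_ge0 (ltW a0) (le_trans r0 (ltW rr'))).
have : al ^+ n * r' - al ^+ n * r <= (occ m (t n) v)%:R + (occ m (t n) w)%:R.
  rewrite -natrD; apply: (@le_trans _ _ ((stepno n r').+1 - stepno n r)%N%:R); last by rewrite ler_nat.
  by rewrite natrB ?leqW //; apply: lerB => //; exact: ltW.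
move=> tot.
have [h1|h1] := leP ((r' - r) / 2 * al ^+ n) (occ m (t n) v)%:R; first by exists v.
exists w; move: tot h1; move: (al ^+ n) (_%:R) (_%:R) => A B D; lra.
Qed.

Lemma self_avoiding_of_regular :
  (forall k m0 : nat, ~ forall m, (m0 <= m)%N ->
     (exists N, forall n, (N <= n)%N -> crowded k.+1%:R^-1 m (t n)) \/ stay m0 (t m)) ->
  self_avoiding X.
Proof.
move=> reg.
have key r r' : 0 <= r -> r < r' -> X r = X r' -> X r = u2 R.
  move=> r0 rr' e; apply: contrapT => nu; have r'0 := le_trans r0 (ltW rr').
  (* Reciprocals of integers suffice as thresholds, which leaves countably many null events. *)
  pose k := Num.truncn (2 / (r' - r)).
  have d0 : 0 < r' - r by rewrite subr_gt0.
  have keps : k.+1%:R^-1 <= (r' - r) / 2.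
    rewrite -[leRHS]invrK lef_pV2 ?posrE ?invr_gt0 ?divr_gt0 ?ltr0n //.
    by rewrite invf_div ltW // truncnS_gt.
  have alt m : misses m (X r) \/
      exists N, forall n, (N <= n)%N -> crowded k.+1%:R^-1 m (t n).
    have [mi|nmi] := pselect (misses m (X r)); [by left|right].
    have [N1 h1] := cell_at_limit m r0; have [N2 h2] := cell_at_limit m r'0.
    (* As X(r') differs from u_2, the path X_n has not ended by time r' for large n, so all step
       numbers up to that time are in range. *)
    have [N3 h3] : exists N, forall n, (N <= n)%N -> Xn (t n) r' <> u2 R.
      apply: contrapT => /forallNP no; apply: nu; rewrite e.
      apply: bc_inj => l; apply/eqP; rewrite -subr_eq0 -normr_le0 leNgt; apply/negP => pos.
      have [N hN] := bc_cvg l r'0 pos; apply: (no N) => n Nn en.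
      by have := hN n Nn; rewrite en distrC ltxx.
    exists (maxn (maxn N1 N2) (maxn N3 m)) => n; rewrite !geq_max.
    move=> /andP[/andP[n1 n2] /andP[n3 mn]].
    have hs : (stepno n r' < size (cells n n))%N.
      by rewrite ltnNge; apply/negP => /Xn_end; exact: h3.
    have [w hw] : crowded ((r' - r) / 2) m (t n).
      apply: crowded_between => //; rewrite leqNgt; apply/negP => ij; apply: nmi.
      apply: (separated_misses _ _ ij); try exact: cell_at_word.
        exact: h1.
      by rewrite e; exact: h2.
    exists w; apply: le_trans hw; by rewrite ler_wpM2r // exprn_ge0 // ltW // alphabar_gt0.
  (* If [X r] is missed at some level m0, each later miss is a [stay m0]; if it is never missed,
     every level is crowded. Both contradict regularity. *)
  have [[m0 mi]|no] := pselect (exists m0, misses m0 (X r)).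
    apply: (reg k m0) => m m0m; case: (alt m); last by left.
    by move=> mi'; right; exact: misses_stay mi mi'.
  apply: (reg k 0%N) => m _; case: (alt m) => [mi|]; last by left.
  by exfalso; apply: no; exists m.
move=> [s| |] t' s0 st th; last by move: s0; rewrite leeNy_eq.
  2: by move: st; rewrite ltNge leey.
(* By [stay_u2] a visit to u_2 is final, so one at time s would give [hitime X <= s], against
   [s < t]. *)
have hs : X s = u2 R -> False.
  move=> Xs; have : (hitime X <= s%:E)%E.
    apply: ereal_inf_lbound; left; exists s => //; split; first by rewrite -lee_fin.
    by move=> s' ss'; apply: stay_u2 Xs; rewrite -?lee_fin.
  by move=> hs; have := lt_le_trans st (le_trans th hs); rewrite ltxx.
case: t' st {th} => [t'| |] st; last by move: st; rewrite ltNge leNye.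
  by rewrite lte_fin in st; move=> /= e; apply: hs; apply: (key s t') => //; rewrite -lee_fin.
exact: hs.
Qed.

End Limit.

Unset Implicit Arguments.
Local Open Scope ring_scope.

Theorem mainTheorem12 (R : realType) (d : measure_display) (Omega : measurableType d)
  (P : probability Omega R) (T : forall n : nat, Omega -> sub R n)
  (T_meas : forall (n : nat) (t : sub R n), measurable [set w | T n w = t]%classic)
  (T_unif_tree : forall (n : nat) (t : sub R n), stree t ->
     P [set w | T n w = t]%classic = ((num_trees R n)%:R^-1)%:E)
  (T_unif_nontree : forall (n : nat) (t : sub R n), ~ stree t ->
     P [set w | T n w = t]%classic = 0%E)
  (T_consistent : forall (n : nat) (w : Omega), Tr_is (T n.+1 w) (T n w)) :
  {ae P, forall w : Omega, forall X : R -> pt R,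
     unif_cvg (fun n => Xn (T n w)) X -> self_avoiding X}.
Proof.
(* Both families of null events concern the trees alone, so a single exceptional set serves every
   limit [X]. *)
pose nontree n : set Omega := [set w | ~~ treeb (T n w)]%classic.
pose irregular k m0 : set Omega := [set w | forall m, (m0 <= m)%N ->
  (exists N, forall n, (N <= n)%N -> crowded (k.+1%:R^-1) m (T n w)) \/ stay m0 (T m w)]%classic.
have null : P.-negligible ((\bigcup_n nontree n) `|` \bigcup_k \bigcup_m0 irregular k m0)%classic.
  apply: negligibleU; apply: negligible_bigcup => k.
    exists (nontree k); split=> //.
      exact: (level_measurable (T_meas k) (fun t => ~~ treeb t)).
    exact: (tree_ae T_meas T_unif_nontree).
  apply: negligible_bigcup => m0.
  by apply: (null_event T_meas T_unif_tree T_unif_nontree T_consistent); rewrite invr_gt0.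
apply: (negligibleS _ null) => w /= bad; apply: contrapT => /not_orP[trees regular].
apply: bad => X Xlim; apply: self_avoiding_of_regular Xlim _.
- by move=> n; apply: contrapT => nt; apply: trees; exists n => //; exact/asboolPn.
- by move=> n; exact: T_consistent.
by move=> k m0 irr; apply: regular; exists k => //; exists m0.
Qed.
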